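(* For $\alpha\ge 2$ and $\beta\in(0,1]$ let $T_{\alpha,\beta}:[-1,1]\to[-1,1]$, $T_{\alpha,\beta}(x)=1-2\beta|x|^\alpha$. Let $\tilde\alpha$ be the zero in $[2,+\infty)$ of the function $\Lambda(\alpha)=\ln 2+\ln\alpha+1-\alpha$ (one has $\tilde\alpha\in[2.67834,2.67835]$). Then for every $\alpha>\tilde\alpha$ there exists $\epsilon(\alpha)>0$ such that for all $\beta\in(1-\epsilon(\alpha),1]$ the map $T_{\alpha,\beta}$, with additive uniformly distributed noise, exhibits Noise Induced Order.
   Context: $m$ is Lebesgue measure. The noise kernel is $\rho=\frac12\chi_{[-1,1]}$, and for $\xi>0$, $\rho_\xi(x)=\frac1\xi\rho(x/\xi)$; $\xi$ is the noise amplitude. A boundary condition $\pi:\mathbb R\to[-1,1]$ is fixed, which is either periodic, $\pi_P(x)=x\bmod 2$ (representatives in $(-1,1]$), or reflecting, $\pi_R(x)=\min_{i\in\mathbb Z}|(x+1)-4i|-1$; $\pi_*\mu(A)=\mu(\pi^{-1}(A))$. The random dynamical system with additive noise of amplitude $\xi$ associated with $T:[-1,1]\to[-1,1]$ is $X_{n+1}=\pi(T(X_n)+\Omega_\xi)$, where $\Omega_\xi$ are independent with density $\rho_\xi$. Its annealed transfer operator is $L_\xi\mu=\pi_*(\hat\rho_\xi*\widehat{L\mu})$, where $L\mu(A)=\mu(T^{-1}A)$, a hat denotes extension by zero to $\mathbb R$, and $(\hat\rho_\xi*\hat\nu)(A)=\int_{[-\xi,\xi]}\rho_\xi(y)\hat\nu(A-y)\,dm(y)$.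 A stationary measure is a probability measure $\mu_\xi$ with $L_\xi\mu_\xi=\mu_\xi$. Noise Induced Order: there exist $0<\xi_1<\xi_2$ such that for all $\xi\ge\xi_1$ the system has a unique stationary measure $\mu_\xi$, with density $f_\xi$, and the Lyapunov exponent $\lambda(\xi)=\int\ln(|T'|)\,d\mu_\xi$ transitions continuously (as a function of $\xi$) from positive to negative, i.e. $\lambda(\xi_1)>0$ and $\lambda(\xi_2)<0$. *)

(* Defs.v *)
From HB Require Import structures.
From mathcomp Require Import all_boot all_order all_algebra.
From mathcomp Require Import all_classical all_reals all_analysis.

Set Implicit Arguments.
Unset Strict Implicit.
Unset Printing Implicit Defensive.

Import Order.TTheory GRing.Theory Num.Theory.
Import numFieldTopology.Exports numFieldNormedType.Exports.

Local Open Scope classical_set_scope.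
Local Open Scope ring_scope.

(* A measure on [-1, 1] is represented by a Borel measure on R carried by
   [-1, 1], and a map of [-1, 1] into itself by a function on R of which only
   the values (and, for the Lyapunov exponent, the derivative) on [-1, 1]
   matter. *)

Section random_dynamical_system.
Context {R : realType}.
Implicit Types (pi T : R -> R) (xi : R) (nu : set R -> \bar R).

Definition phase_space : set R := `[-1, 1].

(* x mod 2 with representative in (-1, 1]: the integer k = ceil ((x - 1) / 2)
   is the one such that 2 k - 1 < x <= 2 k + 1. *)
Definition periodic_bc (x : R) : R := x - 2 * (Num.ceil ((x - 1) / 2))%:~R.

(* The infimum is over a discrete set and is attained. *)
Definition reflecting_bc (x : R) : R :=
  inf [set `|(x + 1) - 4 * i%:~R| | i in [set: int]] - 1.

Definition boundary_condition pi := pi = periodic_bc \/ pi = reflecting_bc.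

Definition noise_kernel (x : R) : R := 2^-1 * \1_phase_space x.

Definition scaled_noise_kernel xi (x : R) : R := xi^-1 * noise_kernel (x / xi).

Definition transfer T nu (A : set R) : \bar R :=
  nu (phase_space `&` T @^-1` A).

Definition extension_by_zero nu (A : set R) : \bar R := nu (A `&` phase_space).

Definition noise_convolution xi nu (A : set R) : \bar R :=
  (\int[lebesgue_measure]_(y in `[(- xi)%R, xi])
     ((scaled_noise_kernel xi y)%:E * nu [set (a - y)%R | a in A]))%E.

Definition annealed_transfer pi T xi nu (A : set R) : \bar R :=
  noise_convolution xi (extension_by_zero (transfer T nu)) (pi @^-1` A).

Definition stationary_measure pi T xi
    (mu : probability (measurableTypeR R) R) : Prop :=
  mu phase_space = 1%E /\
  forall A : set (measurableTypeR R), measurable A ->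
    annealed_transfer pi T xi mu A = mu A.

Definition unique_stationary_measure pi T xi
    (mu : probability (measurableTypeR R) R) : Prop :=
  stationary_measure pi T xi mu /\
  forall nu : probability (measurableTypeR R) R,
    stationary_measure pi T xi nu ->
    forall A : set (measurableTypeR R), measurable A -> nu A = mu A.

Definition has_density (f : R -> R)
    (mu : probability (measurableTypeR R) R) : Prop :=
  [/\ measurable_fun [set: measurableTypeR R] f,
      forall x, 0 <= f x &
      forall A : set (measurableTypeR R), measurable A ->
        mu A = (\int[lebesgue_measure]_(x in A) (f x)%:E)%E].

(* [lne] is the logarithm extended by ln 0 = -oo, whereas [ln] sends 0 to 0. *)
Definition lyapunov_exponent T
    (mu : probability (measurableTypeR R) R) : \bar R :=
  (\int[mu]_(x in phase_space) lne (`|derive1 T x|)%:E)%E.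

Definition noise_induced_order pi T : Prop :=
  exists xi1 xi2 : R, 0 < xi1 < xi2 /\
  exists (mu : R -> probability (measurableTypeR R) R) (f : R -> R -> R)
         (lambda : R -> R),
    [/\ forall xi, xi1 <= xi ->
          [/\ unique_stationary_measure pi T xi (mu xi),
              has_density (f xi) (mu xi) &
              lyapunov_exponent T (mu xi) = (lambda xi)%:E],
        {within `[xi1, +oo[, continuous lambda},
        0 < lambda xi1 &
        lambda xi2 < 0].

Definition unimodal_map (alpha beta x : R) : R :=
  1 - 2 * beta * `|x| `^ alpha.

Definition Lambda (alpha : R) : R := ln 2 + ln alpha + 1 - alpha.

End random_dynamical_system.

(* Main.v *)
(* For a stationary measure mu of T x = 1 - 2 b |x|^a the Lyapunov exponent is
   ln (2 a b) - (a - 1) E, with E the mean of - ln |X| under mu.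

   At xi = 2 the noise covers one period of either boundary condition, so mu is uniform, E = 1 and the
   exponent is Lambda a + ln b < 0.

   At b = 1 and small noise the exponent is positive for every a > 2. The metric
   dx / (1 - x^2 + r xi)^g is expanded by T away from a neighbourhood of 0 of radius of order xi^(1/a).
   In terms of primitives chi of test functions h, stationarity gives the weak transfer identity
   int h dmu = int (P chi / T')' dmu + int (P chi / T') T'' / T' dmu, with P the average over the noise
   window. As chi -> P chi / T' contracts the weighted sup norm by some q < 1, iterating bounds
   |int h dmu| by O(xi^(g - 1)) times the weighted norm of chi. Hence |X| is rarely small, and the points where
   ln |T'| fails to be compensated by the coboundary of - ln weight contribute only a positive power of xi.

   From the xi1 so obtained on, the same expansion shows that every interval reaches 0, hence -1 up to
   noise, in a bounded number of steps. This gives a Doeblin minorization for all xi >= xi1 and b close to 1,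
   whence existence, uniqueness and continuity in (b, xi) of the stationary measure and of E. *)

Require Import Defs.
From HB Require Import structures.
From mathcomp Require Import all_boot all_order all_algebra.
From mathcomp Require Import all_classical all_reals all_analysis.
From mathcomp Require Import measurable_realfun real_interval.
From mathcomp Require Import ring lra zify.

Import Order.TTheory GRing.Theory Num.Theory.
Import numFieldTopology.Exports numFieldNormedType.Exports.

Local Open Scope classical_set_scope.
Local Open Scope ring_scope.

Set Implicit Arguments.
Unset Strict Implicit.
Unset Printing Implicit Defensive.

(** The Doeblin rate degenerates as [xi] tends to 0, so mixing cannot decide the sign of the
    exponent at small noise. The small-noise estimate is therefore proved for an arbitrary
    stationary measure at [b = 1]; mixing enters only once [xi1] is frozen, and [b] is then moved by
    perturbation at that single noise level. The noiseless transfer operator on densities is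
    singular at the critical value 1. Working with primitives of tests puts this singularity into a
    difference quotient, which stays continuous. Since [ln |T'|] is unbounded below, oscillation
    estimates do not apply to it directly; each use of E passes through a truncation, whose error is
    controlled by the bounded density that one step of noise produces. Two exponents g occur. Mixing
    uses [1 - 1/a], the least value for which [T] expands; the small-noise estimate uses
    [1 - 1/(4a)], because the square root of the critical radius, of order [xi^(1/(2a))], has to
    beat the factor [xi^(g - 1)]. *)

Lemma Rintegral_probability_cst d (X : measurableType d) (R : realType)
    (mu : probability X R) (r : R) : \int[mu]_x r = r.
Proof.
rewrite Rintegral_cst//; transitivity (r * fine (1%E : \bar R)); last by rewrite mulr1.
by congr (_ * fine _); exact: probability_setT.
Qed.

(** * Markov operators on bounded measurable functions *)

Section markov.
Context d d' (X : measurableType d) (Y : measurableType d') (R : realType).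
Implicit Types (g h : X -> R) (phi : X * Y -> X) (a b c e K : R).

Definition bmf g := measurable_fun setT g /\ exists M : R, forall x, `|g x| <= M.

Lemma bmf_cst (a : R) : bmf (fun=> a).
Proof. by split=> //; exists `|a|. Qed.

Lemma bmfD g h : bmf g -> bmf h -> bmf (fun x => g x + h x).
Proof.
move=> [mg [M gM]] [mh [N hN]]; split; first exact: measurable_funD.
by exists (M + N) => x; rewrite (le_trans (ler_normD _ _))// lerD.
Qed.

Lemma bmfZ a g : bmf g -> bmf (fun x => a * g x).
Proof.
move=> [mg [M gM]]; split; first exact: measurable_funM.
by exists (`|a| * M) => x; rewrite normrM ler_wpM2l.
Qed.

Lemma bmfB g h : bmf g -> bmf h -> bmf (fun x => g x - h x).
Proof.
move=> mg mh; have := bmfD mg (bmfZ (-1) mh).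
by congr bmf; apply/funext => x; rewrite mulN1r.
Qed.

Lemma bmf_indic (A : set X) : measurable A -> bmf \1_A.
Proof.
move=> mA; split; first exact: measurable_indic.
by exists 1 => x; rewrite indicE; case: (_ \in _); rewrite /= ?normr1// normr0.
Qed.

Lemma bmf_integrable (mu : probability X R) g : bmf g ->
  mu.-integrable setT (EFin \o g).
Proof.
move=> [mg [M gM]]; apply: measurable_bounded_integrable => //.
  exact: fin_num_fun_lty.
by exists M; split => [|y My x _] /=; rewrite ?num_real//; exact: le_trans (gM x) (ltW My).
Qed.

Variable U : probability Y R.

Definition transition phi g (x : X) : R := \int[U]_y g (phi (x, y)).

Lemma transition_integrable phi g x : measurable_fun setT phi -> bmf g ->
  U.-integrable setT (EFin \o (fun y => g (phi (x, y)))).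
Proof.
move=> mphi [mg [M gM]]; apply: measurable_bounded_integrable => //.
- exact: fin_num_fun_lty.
- by apply: measurableT_comp => //; apply: measurableT_comp => //; exact: measurable_pair1.
- by exists M; split => [|y My z _] /=; rewrite ?num_real//; exact: le_trans (gM _) (ltW My).
Qed.

Section one_map.
Variables (phi : X * Y -> X) (mphi : measurable_fun setT phi).
Notation P := (transition phi).

Lemma transition_cst a : P (fun=> a) = fun=> a.
Proof.
by apply/funext => x; rewrite /transition Rintegral_probability_cst.
Qed.

Lemma transitionD g h : bmf g -> bmf h ->
  P (fun x => g x + h x) = fun x => P g x + P h x.
Proof.
by move=> mg mh; apply/funext => x; rewrite /transition RintegralD//;
  exact: (transition_integrable x mphi).
Qed.

Lemma transitionZ a g : bmf g -> P (fun x => a * g x) = fun x => a * P g x.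
Proof.
by move=> mg; apply/funext => x; rewrite /transition RintegralZl//;
  exact: (transition_integrable x mphi).
Qed.

Lemma transitionB g h : bmf g -> bmf h ->
  P (fun x => g x - h x) = fun x => P g x - P h x.
Proof.
by move=> mg mh; apply/funext => x; rewrite /transition RintegralB//;
  exact: (transition_integrable x mphi).
Qed.

Lemma le_transition g h : bmf g -> bmf h -> (forall x, g x <= h x) ->
  forall x, P g x <= P h x.
Proof.
by move=> mg mh gh x; apply: le_Rintegral => //; exact: (transition_integrable x mphi).
Qed.

Lemma bmf_transition g : bmf g -> bmf (P g).
Proof.
move=> bg; have [mg [M gM]] := bg; split; last first.
  exists M => x; rewrite ler_norml; apply/andP; split.
    rewrite -[leLHS](_ : P (fun=> - M) x = _); last by rewrite transition_cst.
    apply: le_transition => // [|z]; first exact: bmf_cst.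
    by have := gM z; rewrite ler_norml => /andP[].
  rewrite -[leRHS](_ : P (fun=> M) x = _); last by rewrite transition_cst.
  apply: le_transition => // [|z]; first exact: bmf_cst.
  by have := gM z; rewrite ler_norml => /andP[].
(* Tonelli's theorem concerns nonnegative integrands, hence the shift of [g] by its bound. *)
have bgM : bmf (fun x => g x + M) by apply: bmfD => //; exact: bmf_cst.
have -> : P g = fun x => P (fun x => g x + M) x - M.
  by apply/funext => x; rewrite transitionD ?transition_cst ?addrK//; exact: bmf_cst.
apply: measurable_funB => //.
apply: (@measurableT_comp _ _ _ _ _ _ (@fine R)) => //.
apply: (@measurable_fun_fubini_tonelli_F _ _ _ _ _ U
   (fun z => ((g (phi z) + M)%:E))).
  apply/measurable_EFinP/measurable_funD => //.
  exact: measurableT_comp.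
move=> z; rewrite lee_fin -lerBlDr sub0r.
by have := gM (phi z); rewrite ler_norml => /andP[].
Qed.

Lemma bmf_iter_transition k g : bmf g -> bmf (iter k P g).
Proof. by move=> bg; elim: k => // k IH /=; exact: bmf_transition. Qed.

Lemma transition_itv g a b : bmf g -> (forall x, a <= g x <= b) ->
  forall x, a <= P g x <= b.
Proof.
move=> bg gab x; apply/andP; split.
  rewrite -[leLHS](_ : P (fun=> a) x = _); last by rewrite transition_cst.
  by apply: le_transition => // [|z]; [exact: bmf_cst|have /andP[] := gab z].
rewrite -[leRHS](_ : P (fun=> b) x = _); last by rewrite transition_cst.
by apply: le_transition => // [|z]; [exact: bmf_cst|have /andP[] := gab z].
Qed.

Lemma iter_transition_itv k g a b : bmf g -> (forall x, a <= g x <= b) ->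
  forall x, a <= iter k P g x <= b.
Proof.
move=> bg gab; elim: k => //= k IH; apply: transition_itv => //.
exact: bmf_iter_transition.
Qed.

Lemma iter_transition_cst k a : iter k P (fun=> a) = fun=> a.
Proof. by elim: k => //= k ->; exact: transition_cst. Qed.

Lemma iter_transitionD k g h : bmf g -> bmf h ->
  iter k P (fun x => g x + h x) = fun x => iter k P g x + iter k P h x.
Proof.
by move=> bg bh; elim: k => //= k ->; rewrite transitionD//; exact: bmf_iter_transition.
Qed.

Lemma iter_transitionZ k a g : bmf g ->
  iter k P (fun x => a * g x) = fun x => a * iter k P g x.
Proof.
by move=> bg; elim: k => //= k ->; rewrite transitionZ//; exact: bmf_iter_transition.
Qed.

Lemma iter_transitionB k g h : bmf g -> bmf h ->
  iter k P (fun x => g x - h x) = fun x => iter k P g x - iter k P h x.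
Proof.
by move=> bg bh; elim: k => //= k ->; rewrite transitionB//; exact: bmf_iter_transition.
Qed.

Definition stationary (mu : probability X R) := forall A, measurable A ->
  (\int[mu]_x U [set y | A (phi (x, y))] = mu A)%E.

(** Stationarity says that the image of [mu \x U] under [phi] agrees with [mu] on measurable sets;
    Tonelli unfolds the integral against this image. *)
Lemma ge0_stationary_integral (mu : probability X R) (f : X -> \bar R) :
  stationary mu -> measurable_fun setT f -> (forall x, 0 <= f x)%E ->
  (\int[mu]_x \int[U]_y f (phi (x, y)) = \int[mu]_x f x)%E.
Proof.
move=> smu mf f0.
transitivity (\int[pushforward (mu \x U)%E phi]_x f x)%E.
  rewrite ge0_integral_pushforward// preimage_setT.
  rewrite (@fubini_tonelli1 _ _ _ _ _ mu U (f \o phi))//.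
  - exact: measurableT_comp.
  - by move=> x; exact: f0.
apply: (eq_measure_integral mu
  (m1 := measure_function_pushforward__canonical__measure_function_Measure
    (mu \x U)%E mphi)) => A mA _.
rewrite -[RHS]smu// /pushforward /product_measure1/=.
by apply: eq_integral => x _; congr (U _); apply/seteqP; split => y /=;
  rewrite /xsection/= inE.
Qed.

Lemma stationary_Rintegral (mu : probability X R) g : stationary mu -> bmf g ->
  \int[mu]_x P g x = \int[mu]_x g x.
Proof.
move=> smu bg; have [mg [M gM]] := bg.
have bgM : bmf (fun x => g x + M) by apply: bmfD => //; exact: bmf_cst.
have bM : bmf (fun=> M) by exact: bmf_cst.
suff: \int[mu]_x P (fun x => g x + M) x = \int[mu]_x (g x + M).
  rewrite transitionD// transition_cst.
  have bPg : bmf (P g) by exact: bmf_transition.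
  rewrite !RintegralD ?Rintegral_probability_cst//;
    try exact: bmf_integrable.
  exact: addIr.
have gM0 x : 0 <= g x + M.
  rewrite -lerBlDr sub0r; by have := gM x; rewrite ler_norml => /andP[].
rewrite {1}/Rintegral; congr fine.
rewrite -(@ge0_stationary_integral mu (fun x => (g x + M)%:E) smu); last 2 first.
- by apply/measurable_EFinP; have [] := bgM.
- by move=> x; rewrite lee_fin.
apply: eq_integral => x _; rewrite /transition fineK//.
by apply: integrable_fin_num => //; exact: (transition_integrable x mphi bgM).
Qed.

Lemma stationary_iter_Rintegral (mu : probability X R) k g :
  stationary mu -> bmf g -> \int[mu]_x iter k P g x = \int[mu]_x g x.
Proof.
move=> smu bg; elim: k => //= k IH; rewrite stationary_Rintegral//.
exact: bmf_iter_transition.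
Qed.

Definition osc_le g c := forall x x', g x - g x' <= c.

(** Oscillation form of Doeblin's condition: the [n]-step laws from any two starting points differ
    by at most [c] in total variation. *)
Definition contracting n c := forall g, bmf g -> (forall x, 0 <= g x <= 1) ->
  osc_le (iter n P g) c.

(** Subtracting the infimum of [g] and dividing by [K] brings [g] into the range [0, 1]; constants
    are fixed by [P]. *)
Lemma contracting_osc n c g K : contracting n c -> bmf g -> 0 < K ->
  osc_le g K -> osc_le (iter n P g) (c * K).
Proof.
move=> cnc bg K0 gK x x'.
have [mg [M gM]] := bg.
have hi : has_inf (range g).
  split; first by exists (g x), x.
  exists (- M) => _ [z _ <-]; by have := gM z; rewrite ler_norml => /andP[].
set a := inf (range g).
have ga z : 0 <= g z - a by rewrite subr_ge0; apply: ge_inf; [exact: hi.2|exists z].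
have gK' z : g z - a <= K.
  rewrite lerBlDr addrC -lerBlDr; apply: lb_le_inf; first exact: hi.1.
  by move=> _ [w _ <-]; rewrite lerBlDr addrC -lerBlDr; exact: gK.
pose h z := K^-1 * (g z - a).
have bga : bmf (fun z => g z - a) by apply: bmfB => //; exact: bmf_cst.
have bh : bmf h by exact: bmfZ.
have h01 z : 0 <= h z <= 1.
  by rewrite /h mulr_ge0 ?invr_ge0 ?(ltW K0)//= mulrC ler_pdivrMr// mul1r.
have := cnc h bh h01 x x'; rewrite /h iter_transitionZ// -mulrBr.
rewrite iter_transitionB//; last exact: bmf_cst.
rewrite iter_transition_cst opprB addrA subrK.
by rewrite mulrC ler_pdivrMr.
Qed.

Lemma contracting_iter n c j : 0 < c -> contracting n c ->
  contracting (j * n) (c ^+ j).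
Proof.
move=> c0 cnc g bg g01; elim: j => [|j IH].
  move=> x x' /=; rewrite expr0 lerBlDr.
  by have /andP[_ /le_trans->//] := g01 x; rewrite lerDl; have /andP[] := g01 x'.
rewrite mulSn iterD exprS; apply: contracting_osc => //; last exact: exprn_gt0.
exact: bmf_iter_transition.
Qed.

Lemma Rintegral_bounds (mu : probability X R) g a b : bmf g ->
  (forall x, a <= g x <= b) -> a <= \int[mu]_x g x <= b.
Proof.
move=> bg gab; apply/andP; split.
  rewrite (_ : a = \int[mu]_x (cst a x)); last first.
    by rewrite Rintegral_probability_cst.
  apply: le_Rintegral => //; [exact: (bmf_integrable _ (bmf_cst _))| |].
    exact: bmf_integrable.
  by move=> x _; have /andP[] := gab x.
rewrite [leRHS](_ : b = \int[mu]_x (cst b x)); last first.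
  by rewrite Rintegral_probability_cst.
apply: le_Rintegral => //; [exact: bmf_integrable|exact: (bmf_integrable _ (bmf_cst _))|].
by move=> x _; have /andP[] := gab x.
Qed.

Lemma osc_le_Rintegral (mu : probability X R) g c x : bmf g -> osc_le g c ->
  `|\int[mu]_z g z - g x| <= c.
Proof.
move=> bg gc; rewrite ler_distl; apply: Rintegral_bounds => // z.
by rewrite lerBlDr -lerBlDl gc/= -lerBlDl gc.
Qed.

End one_map.

Lemma probability_inhabited (mu : probability X R) : exists x : X, True.
Proof.
apply: contrapT => X0; have := @probability_setT _ _ _ mu.
rewrite (_ : [set: X] = set0).
  by rewrite measure0 => /eqP; rewrite eqe eq_sym oner_eq0.
by apply/seteqP; split => // x _; apply: X0; exists x.
Qed.

(** Telescoping: [P h - P' h' = (P h - P' h) + P' (h - h')] for the [M]-th iterates [h] and [h'].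
    The first term is at most [e] since [h] stays in [0, 1], and [P'] does not increase the sup
    norm. *)
Lemma iter_transition_perturbation phi phi' g M e :
  measurable_fun setT phi -> measurable_fun setT phi' ->
  (forall h, bmf h -> (forall x, 0 <= h x <= 1) ->
    forall x, `|transition phi h x - transition phi' h x| <= e) ->
  bmf g -> (forall x, 0 <= g x <= 1) ->
  forall x, `|iter M (transition phi) g x - iter M (transition phi') g x| <= M%:R * e.
Proof.
move=> mphi mphi' He bg g01; elim: M => [x|M IH x /=].
  by rewrite subrr normr0 mul0r.
set h := iter M _ g; set h' := iter M _ g.
have bh : bmf h by exact: bmf_iter_transition.
have bh' : bmf h' by exact: bmf_iter_transition.
have h01 : forall x, 0 <= h x <= 1 by exact: iter_transition_itv.
rewrite -(subrK (transition phi' h x) (transition phi h x)) -addrA.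
rewrite (le_trans (ler_normD _ _))// -natr1 mulrDl mul1r [leRHS]addrC lerD//; first exact: He.
rewrite ler_norml; have := @transition_itv phi' mphi' (fun z => h z - h' z)
  (- (M%:R * e)) (M%:R * e) (bmfB bh bh') _ x.
by rewrite transitionB//; apply => z; rewrite -ler_norml; exact: IH.
Qed.

(** Only the first operator has to mix. The iterate [h] of [g] under it is nearly constant, so its
    means under [mu] and [mu'] are both within [c] of [h x0]; what remains is the [M]-step
    discrepancy of the iterates, integrated against [mu']. *)
Lemma stationary_perturbation phi phi' (mu mu' : probability X R) g M c e :
  measurable_fun setT phi -> measurable_fun setT phi' ->
  stationary phi mu -> stationary phi' mu' ->
  (forall h, bmf h -> (forall x, 0 <= h x <= 1) ->
    forall x, `|transition phi h x - transition phi' h x| <= e) ->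
  bmf g -> (forall x, 0 <= g x <= 1) ->
  osc_le (iter M (transition phi) g) c ->
  `|\int[mu]_x g x - \int[mu']_x g x| <= 2 * c + M%:R * e.
Proof.
move=> mphi mphi' smu smu' He bg g01 gc.
have [x0 _] := probability_inhabited mu.
rewrite -(stationary_iter_Rintegral mphi M smu)//.
rewrite -(stationary_iter_Rintegral mphi' M smu')//.
set h := iter M _ g; set h' := iter M _ g.
have bh : bmf h by exact: bmf_iter_transition.
have bh' : bmf h' by exact: bmf_iter_transition.
have -> : \int[mu]_x h x - \int[mu']_x h' x =
    (\int[mu]_x h x - h x0) - (\int[mu']_x h x - h x0)
    + \int[mu']_x (h x - h' x).
  rewrite RintegralB//; [ring|exact: bmf_integrable|exact: bmf_integrable].
rewrite (le_trans (ler_normD _ _))// lerD//.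
  rewrite (le_trans (ler_normB _ _))// mulr_natl mulr2n lerD//;
    exact: osc_le_Rintegral.
rewrite ler_norml; apply: Rintegral_bounds => [|z]; first exact: bmfB.
by rewrite -ler_norml; exact: iter_transition_perturbation.
Qed.

Lemma contracting_cvg phi n c e : measurable_fun setT phi -> 0 < c < 1 ->
  contracting phi n c -> 0 < e -> exists M, contracting phi M e.
Proof.
move=> mphi /andP[c0 c1] cc e0.
have /cvgrPdist_lt /(_ e e0)[j _ /(_ j (leqnn j))] : c ^+ j @[j --> \oo] --> 0.
  by apply: cvg_expr; rewrite ger0_norm ?(ltW c0).
rewrite sub0r normrN ger0_norm ?exprn_ge0 ?(ltW c0)// => cje.
exists (j * n)%N => g bg g01 x x'; rewrite (le_trans _ (ltW cje))//.
exact: (contracting_iter mphi j c0 cc bg g01 x x').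
Qed.

Lemma Rintegral_indic (mu : probability X R) A : measurable A ->
  \int[mu]_x \1_A x = fine (mu A).
Proof. by move=> mA; rewrite /Rintegral integral_indic// setIT. Qed.

Lemma indic_itv01 (A : set X) x : 0 <= (\1_A x : R) <= 1.
Proof. by rewrite indicE; case: (_ \in _); rewrite /= ?lexx ?ler01. Qed.

(** The perturbation estimate of a system against itself, with [e = 0] and an oscillation made
    arbitrarily small by iterating. *)
Lemma contracting_stationary_unique phi n c (mu nu : probability X R) :
  measurable_fun setT phi -> 0 < c < 1 -> contracting phi n c ->
  stationary phi mu -> stationary phi nu ->
  forall A, measurable A -> mu A = nu A.
Proof.
move=> mphi c01 cc smu snu A mA.
suff : \int[mu]_x \1_A x - \int[nu]_x \1_A x = 0.
  rewrite !Rintegral_indic// => /eqP; rewrite subr_eq0 => /eqP mn.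
  by rewrite -(@fineK _ (mu A)) ?fin_num_measure// mn fineK// fin_num_measure.
apply/eqP; rewrite -normr_le0; apply/ler_addgt0Pr => e e0; rewrite add0r.
have e20 : 0 < e / 2 by rewrite divr_gt0.
have [M cM] := contracting_cvg mphi c01 cc e20.
have := @stationary_perturbation phi phi mu nu \1_A M (e / 2) 0 mphi mphi smu snu.
have -> : 2 * (e / 2) + M%:R * 0 = e by field.
apply.
- by move=> h _ _ x; rewrite subrr normr0.
- exact: bmf_indic.
- by move=> x; exact: indic_itv01.
- by apply: cM; [exact: bmf_indic|move=> x; exact: indic_itv01].
Qed.

End markov.

(** * Stationary measures of contracting operators *)

Section stationary_existence.
Context d d' (X : measurableType d) (Y : measurableType d') (R : realType).
Variables (U : probability Y R) (phi : X * Y -> X).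
Hypothesis mphi : measurable_fun setT phi.
Notation P := (transition U phi).
Implicit Types (g h : X -> R) (e : R).

(** The sum is the minimum of [n] and the integer part of [t], written as a sum of indicators of
    upper level sets. *)
Lemma itv01_step_approx (n : nat) (t : R) : 0 <= t ->
  [/\ \sum_(i < n) ((i.+1%:R <= t)%R%:R : R) <= t,
      \sum_(i < n) ((i.+1%:R <= t)%R%:R : R) <= n%:R,
      n%:R <= t -> \sum_(i < n) ((i.+1%:R <= t)%R%:R : R) = n%:R &
      t <= n%:R -> t - 1 <= \sum_(i < n) ((i.+1%:R <= t)%R%:R : R)].
Proof.
move=> t0; elim: n => [|n [IH1 IH2 IH3 IH4]].
  by rewrite big_ord0; split => // t0'; rewrite lerBlDr add0r (le_trans t0').
rewrite big_ord_recr/=; have [nt|tn] := leP n.+1%:R t.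
  have nt' : n%:R <= t by rewrite (le_trans _ nt)// ler_nat.
  rewrite (IH3 nt') natr1; split => // tn.
  by rewrite lerBlDr (le_trans tn)// lerDl.
rewrite addr0; split => //.
- by rewrite (le_trans IH2)// ler_nat.
- move=> _; have [/IH4//|/ltW nt] := leP t n%:R.
  by rewrite IH3// lerBlDr natr1 ltW.
Qed.

Lemma sandwich_dist (a b c z : R) :
  c <= a -> a <= c + z -> c <= b -> b <= c + z -> `|a - b| <= 2 * z.
Proof. by move=> *; rewrite ler_norml; lra. Qed.

Lemma iter_osc_le l g K : bmf g -> 0 < K -> osc_le g K ->
  osc_le (iter l P g) K.
Proof.
move=> bg K0 gK; rewrite -[K]mul1r; apply: contracting_osc => //.
move=> h bh h01 x x'; have := iter_transition_itv U mphi l bh h01 x.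
have := iter_transition_itv U mphi l bh h01 x'; lra.
Qed.

Lemma bmf_osc_le g : bmf g -> exists2 K, 0 < K & osc_le g K.
Proof.
move=> [mg [M gM]]; exists (2 * `|M| + 1); first by rewrite ltr_wpDl// mulr_ge0.
move=> x x'; have := gM x; have := gM x'.
have := ler_norm M; have := ler_norm (g x); have := ler_norm (- g x').
rewrite normrN; lra.
Qed.

Variables (n : nat) (c : R).
Hypotheses (c01 : 0 < c < 1) (cc : contracting U phi n c).

Lemma iter_transition_limit g : bmf g ->
  exists l, forall e, 0 < e -> exists k, forall j x, (k <= j)%N ->
    `|iter j P g x - l| <= e.
Proof.
move=> bg; have [K K0 gK] := bmf_osc_le bg; have [mg [M gM]] := bg.
have [[x0 _]|nX] := pselect (exists x : X, True); last first.
  by exists 0 => e e0; exists 0%N => j x; case: nX; exists x.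
pose S := [set z | exists k, forall x, iter k P g x <= z].
have itM k x : - M <= iter k P g x <= M.
  by apply: iter_transition_itv => // z; rewrite -ler_norml.
have lbS : lbound S (- M).
  by move=> z [k /(_ x0)]; apply: le_trans; have /andP[] := itM k x0.
have S0 : S !=set0 by exists M, 0%N => x; have /andP[] := itM 0%N x.
exists (inf S) => e e0.
have [k ck] := contracting_cvg mphi c01 cc (divr_gt0 e0 K0).
exists k => // j x kj.
have oj : osc_le (iter j P g) e.
  rewrite -(subnKC kj) iterD -[e](divfK (lt0r_neq0 K0)).
  apply: contracting_osc => //; first exact: bmf_iter_transition.
  exact: iter_osc_le.
rewrite ler_distl; apply/andP; split.
  rewrite lerBlDr; apply: ge_inf; first by exists (- M).
  by exists j => w; have := oj w x; lra.
rewrite -lerBlDr; apply: lb_le_inf => // z [k' /= zk'].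
have bj : bmf (iter j P g) by exact: bmf_iter_transition.
have Hw w : iter j P g x - e <= iter j P g w <= iter j P g x + e.
  by have := oj x w; have := oj w x; lra.
(* The single value at [x0] of the iterate of order [k' + j] is above [P^j g x - e] and below
   [z]. *)
have /andP[+ _] := iter_transition_itv U mphi k' bj Hw x0.
rewrite -iterD.
move=> /le_trans; apply; rewrite addnC iterD.
have Hz w : - M <= iter k' P g w <= z by rewrite zk' andbT; have /andP[] := itM k' w.
have bk' := bmf_iter_transition U mphi k' bg.
by have /andP[] := iter_transition_itv U mphi j bk' Hz x0.
Qed.

(* By contraction [P^n g] converges uniformly to a constant. On indicators this constant is the
   stationary measure; domination of the kernels gives sigma-additivity. *)
Definition limit_functional g : R := xget 0 [set l | forall e, 0 < e ->
  exists k, forall j x, (k <= j)%N -> `|iter j P g x - l| <= e].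
Notation ell := limit_functional.

Lemma limit_functionalP g e : bmf g -> 0 < e ->
  exists k, forall j x, (k <= j)%N -> `|iter j P g x - ell g| <= e.
Proof.
move=> bg e0; rewrite /ell; case: xgetP => [l _ /(_ e e0)//|H].
by have [l Hl] := iter_transition_limit bg; have := H l; case.
Qed.

Variable x0 : X.

Lemma limit_functional_cvg g : bmf g -> iter k P g x0 @[k --> \oo] --> ell g.
Proof.
move=> bg; apply/cvgrPdist_le => e e0.
have [k Hk] := limit_functionalP bg e0.
by exists k => // j /= kj; rewrite distrC; exact: Hk.
Qed.

Lemma limit_functionalE g l : bmf g -> iter k P g x0 @[k --> \oo] --> l ->
  ell g = l.
Proof.
move=> bg Hl; exact: (cvg_unique (@Rhausdorff R) (limit_functional_cvg bg) Hl).
Qed.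

Lemma limit_functional_cst a : ell (fun=> a) = a.
Proof.
apply: limit_functionalE; first exact: bmf_cst.
by under eq_fun do rewrite iter_transition_cst; exact: cvg_cst.
Qed.

Lemma limit_functionalD g h : bmf g -> bmf h ->
  ell (fun x => g x + h x) = ell g + ell h.
Proof.
move=> bg bh; apply: limit_functionalE; first exact: bmfD.
under eq_fun do rewrite iter_transitionD//.
by apply: cvgD; exact: limit_functional_cvg.
Qed.

Lemma limit_functionalZ a g : bmf g -> ell (fun x => a * g x) = a * ell g.
Proof.
move=> bg; apply: limit_functionalE; first exact: bmfZ.
under eq_fun do rewrite iter_transitionZ//.
by apply: cvgM; [exact: cvg_cst|exact: limit_functional_cvg].
Qed.

Lemma limit_functional_transition g : bmf g -> ell (P g) = ell g.
Proof.
move=> bg; apply: limit_functionalE; first exact: bmf_transition.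
under eq_fun do rewrite -iterSr.
by have := limit_functional_cvg bg; rewrite -(cvg_shiftS (fun k => iter k P g x0)).
Qed.

Lemma limit_functional_itv g a b : bmf g -> (forall x, a <= g x <= b) ->
  a <= ell g <= b.
Proof.
move=> bg gab; have H := limit_functional_cvg bg; apply/andP; split.
  apply: (cvgr_to_ge H); apply: nearW => k.
  by have /andP[] := iter_transition_itv U mphi k bg gab x0.
apply: (cvgr_to_le H); apply: nearW => k.
by have /andP[] := iter_transition_itv U mphi k bg gab x0.
Qed.

Lemma le_limit_functional g h : bmf g -> bmf h -> (forall x, g x <= h x) ->
  ell g <= ell h.
Proof.
move=> bg bh gh; apply: (ler_cvg_to (limit_functional_cvg bg) (limit_functional_cvg bh)).
by apply: nearW => k; elim: k x0 => [|k IH] x /=; [exact: gh|apply: le_transition => //;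
  exact: bmf_iter_transition].
Qed.

Lemma limit_functional_sum (I : Type) (r : seq I) (g : I -> X -> R) :
  (forall i, bmf (g i)) ->
  bmf (fun x => \sum_(i <- r) g i x) /\
  ell (fun x => \sum_(i <- r) g i x) = \sum_(i <- r) ell (g i).
Proof.
move=> bg; elim: r => [|i r [IH1 IH2]].
  rewrite big_nil -[in RHS](limit_functional_cst 0).
  under eq_fun do rewrite big_nil.
  by split => //; exact: bmf_cst.
under eq_fun do rewrite big_cons; rewrite big_cons -IH2.
by split; [exact: bmfD|exact: limit_functionalD].
Qed.

Variable m : {finite_measure set X -> \bar R}.
Hypothesis phi_dominated : forall A x, measurable A ->
  (U [set y | A (phi (x, y))] <= m A)%E.

(** A measure is a function on all sets; 0 is a default value off the sigma-algebra, where linearity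
    of [ell] says nothing. *)
Let nu (A : set X) : \bar R := if `[< measurable A >] then (ell \1_A)%:E else 0%E.

Let nuE A : measurable A -> nu A = (ell \1_A)%:E.
Proof. by move=> mA; rewrite /nu; case: asboolP. Qed.

Let nu0 : nu set0 = 0%E.
Proof.
rewrite nuE// -[RHS](congr1 EFin (limit_functional_cst 0)); congr (ell _)%:E.
by apply/funext => x; rewrite indic0.
Qed.

Let nu_ge0 A : (0 <= nu A)%E.
Proof.
rewrite /nu; case: asboolP => // mA; rewrite lee_fin.
by have /andP[] := limit_functional_itv (bmf_indic R mA) (indic_itv01 R A).
Qed.

Lemma transition_indic A x : measurable A ->
  (transition U phi \1_A x)%:E = U [set y | A (phi (x, y))].
Proof.
move=> mA; rewrite /transition /Rintegral fineK; last first.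
  by apply: integrable_fin_num => //; exact: (transition_integrable U x mphi (bmf_indic R mA)).
have mB : measurable [set y | A (phi (x, y))].
  rewrite -[X in measurable X]setTI.
  by apply: (measurableT_comp mphi (measurable_pair1 x)).
rewrite -[in RHS](setIT [set y | A (phi (x, y))]) -integral_indic//.
Qed.

Let nu_le A : measurable A -> (nu A <= m A)%E.
Proof.
move=> mA; rewrite nuE// -(fineK (fin_num_measure m _ mA)) lee_fin.
rewrite -limit_functional_transition; last exact: bmf_indic.
have bA := bmf_indic R mA.
suff Hx x : 0 <= P \1_A x <= fine (m A).
  by have /andP[] := limit_functional_itv (bmf_transition U mphi bA) Hx.
have /andP[-> _] := transition_itv U mphi bA (indic_itv01 R A) x.
rewrite -lee_fin [leRHS](fineK (fin_num_measure m _ mA)) transition_indic//.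
exact: phi_dominated.
Qed.

Let nuU A B : measurable A -> measurable B -> A `&` B = set0 ->
  nu (A `|` B) = (nu A + nu B)%E.
Proof.
move=> mA mB AB; rewrite !nuE//; last exact: measurableU.
rewrite -EFinD -limit_functionalD; [|exact: bmf_indic..].
congr (ell _)%:E; apply/funext => x; rewrite !indicE.
have [xA|xA] := boolP (x \in A); have [xB|xB] := boolP (x \in B);
  rewrite in_setU ?xA ?xB ?(negbTE xA) ?(negbTE xB)/= ?addr0 ?add0r//.
by have : set0 x by rewrite -AB; split; exact/set_mem.
Qed.

Let nu_bigU (F : (set X)^nat) k : (forall i, measurable (F i)) ->
  trivIset setT F -> nu (\big[setU/set0]_(i < k) F i) = (\sum_(i < k) nu (F i))%E.
Proof.
move=> mF tF; elim: k => [|k IH]; first by rewrite !big_ord0 nu0.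
rewrite !big_ord_recr/= nuU ?IH//.
  exact: bigsetU_measurable.
by apply: (@trivIset_bigsetUI _ predT) => //; rewrite /predT /= trueE.
Qed.

(** Finite additivity comes from the linearity of [ell]. The remainder after [k] sets has [nu]-mass
    at most its [m]-mass, which tends to 0 because [m] is finite; the partial sums are squeezed. *)
Let nu_sigma_additive : semi_sigma_additive nu.
Proof.
move=> F mF tF mUF; set A := \bigcup_k F k.
have msub k : measurable (\big[setU/set0]_(i < k) F i) by exact: bigsetU_measurable.
have subA k : \big[setU/set0]_(i < k) F i `<=` A.
  by rewrite -bigcup_mkord => x [i _ Fx]; exists i.
have dec k : A = (\big[setU/set0]_(i < k) F i) `|` (A `\` \big[setU/set0]_(i < k) F i).
  by rewrite setDUK.
have mD k : measurable (A `\` \big[setU/set0]_(i < k) F i) by exact: measurableD.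
have nuA k : nu A = (\sum_(i < k) nu (F i) + nu (A `\` \big[setU/set0]_(i < k) F i))%E.
  by rewrite {1}(dec k) nuU// ?nu_bigU// setDIK.
have mA k : m A = (\sum_(i < k) m (F i) + m (A `\` \big[setU/set0]_(i < k) F i))%E.
  rewrite {1}(dec k) measureU// ?setDIK//; congr (_ + _)%E.
  by rewrite measure_bigsetU.
have nuf k : nu (F k) = (ell \1_(F k))%:E by rewrite nuE.
have mf k : m (F k) = (fine (m (F k)))%:E by rewrite fineK// fin_num_measure.
have mc := @measure_semi_sigma_additive _ _ _ m F mF tF mUF.
rewrite nuE//; apply: cvg_EFin.
  by apply: nearW => k; rewrite (eq_bigr (fun i => (ell \1_(F i))%:E)) ?sumEFin.
have mc' : (fun k => ell \1_A - (fine (m A) - fine (\sum_(0 <= i < k) m (F i)))) @ \oo --> ell \1_A.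
  rewrite -[X in _ --> X](subr0 (ell \1_A)); apply: cvgB; first exact: cvg_cst.
  rewrite -(subrr (fine (m A))); apply: cvgB; first exact: cvg_cst.
  by apply: fine_cvg; rewrite fineK ?fin_num_measure.
apply: (squeeze_cvgr _ mc' (cvg_cst (ell \1_A))); apply: nearW => k /=.
rewrite !big_mkord.
have := nuA k; have := mA k; have := nu_le (mD k); have := nu_ge0 (A `\` \big[setU/set0]_(i < k) F i).
rewrite (nuE mUF) (nuE (mD k)).
rewrite (eq_bigr (fun i : 'I_k => (fine (m (F i)))%:E)) ?sumEFin//.
rewrite [in X in _ -> _ -> _ -> X -> _](eq_bigr (fun i : 'I_k => (ell \1_(F i))%:E)) ?sumEFin//.
rewrite (eq_bigr (fun i : 'I_k => (ell \1_(F i))%:E)) ?sumEFin//.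
rewrite -(fineK (fin_num_measure m _ mUF)) -(fineK (fin_num_measure m _ (mD k))) -!EFinD !lee_fin /=.
by move=> h1 h2 [->] [->]; lra.
Qed.

HB.instance Definition _ := isMeasure.Build _ _ _ nu nu0 nu_ge0 nu_sigma_additive.

Let nu_setT : nu setT = 1%E.
Proof. by rewrite nuE// indicT (limit_functional_cst 1). Qed.

HB.instance Definition _ := @Measure_isProbability.Build _ _ R nu nu_setT.

(** The integral and [ell] agree on indicators by construction. Slicing [g] at [N] levels gives a
    combination [h] of indicators with [h <= g <= h + 1/N]; both functionals are monotone, so they
    differ by at most [2/N] on [g]. *)
Lemma Rintegral_limit_functional g : bmf g -> (forall x, 0 <= g x <= 1) ->
  \int[nu]_x g x = ell g.
Proof.
move=> bg g01; apply/eqP; rewrite -subr_eq0 -normr_le0; apply/ler_addgt0Pr => e e0.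
rewrite add0r.
pose N := (Num.truncn (2 / e)).+1.
have N0 : 0 < N%:R :> R by rewrite ltr0n.
have Ne : 2 / N%:R <= e.
  rewrite ler_pdivrMr// mulrC -ler_pdivrMr// ltW//.
  by rewrite /N truncnS_gt.
pose B (i : 'I_N) := [set x | i.+1%:R <= N%:R * g x].
have mB i : measurable (B i).
  rewrite (_ : B i = setT `&` (fun x => N%:R * g x) @^-1` `[i.+1%:R, +oo[).
    by apply: (bmfZ N%:R bg).1 => //; exact: measurable_itv.
  by rewrite setTI; apply/seteqP; split => x; rewrite /B /= in_itv/= andbT.
pose h x : R := \sum_(i < N) N%:R^-1 * \1_(B i) x.
have bh i : bmf (fun x => N%:R^-1 * \1_(B i) x : R).
  by apply: bmfZ; exact: bmf_indic.
have [bh' ellh] := limit_functional_sum (index_enum 'I_N) bh.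
have hint : \int[nu]_x h x = ell h.
  rewrite /h ellh.
  have : forall r : seq 'I_N, bmf (fun x => \sum_(i <- r) N%:R^-1 * \1_(B i) x : R) /\
     \int[nu]_x (\sum_(i <- r) N%:R^-1 * \1_(B i) x) =
     \sum_(i <- r) ell (fun x => N%:R^-1 * \1_(B i) x).
    elim=> [|i r [IH1 IH2]].
      split; first by under eq_fun do rewrite big_nil; exact: bmf_cst.
      under eq_Rintegral do rewrite big_nil.
      by rewrite big_nil Rintegral_probability_cst.
    split; first by under eq_fun do rewrite big_cons; exact: bmfD.
    under eq_Rintegral do rewrite big_cons.
    rewrite big_cons -IH2.
    rewrite RintegralD//; [|exact: bmf_integrable..]; congr (_ + _).
    rewrite limit_functionalZ; last exact: bmf_indic.
    rewrite RintegralZl//; last by apply: bmf_integrable; exact: bmf_indic.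
    rewrite Rintegral_indic//; congr (_ * _).
    by rewrite -[RHS]/(fine (ell \1_(B i))%:E); congr fine; exact: nuE.
  by move=> /(_ (index_enum 'I_N)) [].
have hgh x : h x <= g x <= h x + N%:R^-1.
  have /andP[g0 g1] := g01 x.
  have Ng0 : 0 <= N%:R * g x by rewrite mulr_ge0.
  have [S1 _ _ S2] := itv01_step_approx N Ng0.
  have {}S2 := S2 (ler_piMr (ltW N0) g1).
  have hE : h x = N%:R^-1 * \sum_(i < N) ((i.+1%:R <= N%:R * g x)%R%:R : R).
    rewrite /h -mulr_sumr; congr (_ * _); apply: eq_bigr => i _.
    by rewrite indicE; congr (nat_of_bool _)%:R; apply/idP/idP; rewrite inE.
  have hN : N%:R * h x = \sum_(i < N) ((i.+1%:R <= N%:R * g x)%R%:R : R).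
    by rewrite hE mulrA divff ?mul1r// lt0r_neq0.
  apply/andP; split; rewrite -(ler_pM2l N0) ?mulrDr ?divff ?lt0r_neq0// hN//.
  by rewrite -lerBlDr.
have bN : bmf (fun x => h x + N%:R^-1) by apply: bmfD => //; exact: bmf_cst.
have i1 : \int[nu]_x h x <= \int[nu]_x g x.
  apply: le_Rintegral => //; [exact: bmf_integrable..|].
  by move=> x _; have /andP[] := hgh x.
have i2 : \int[nu]_x g x <= \int[nu]_x h x + N%:R^-1.
  rewrite -[X in _ <= _ + X](Rintegral_probability_cst nu) -RintegralD//; last 2 first.
  - exact: bmf_integrable.
  - by apply: bmf_integrable; exact: bmf_cst.
  apply: le_Rintegral => //; [exact: bmf_integrable..|].
  by move=> x _; have /andP[] := hgh x.
have l1 : ell h <= ell g.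
  by apply: le_limit_functional => // x; have /andP[] := hgh x.
have l2 : ell g <= ell h + N%:R^-1.
  rewrite -[X in _ <= _ + X]limit_functional_cst -limit_functionalD//; last exact: bmf_cst.
  by apply: le_limit_functional => // x; have /andP[] := hgh x.
rewrite hint in i1 i2.
apply: le_trans Ne.
apply: (sandwich_dist i1 i2 l1 l2).
Qed.

(** [ell] does not change under [P], being a limit of iterates, and it is integration against [nu]
    on the bounded function [P \1_A]. *)
Lemma stationary_exists : exists mu : probability X R, stationary U phi mu.
Proof.
exists nu => A mA.
under eq_integral do rewrite -transition_indic//.
transitivity (ell \1_A)%:E; last exact/esym/nuE.
have bA := bmf_indic R mA; have bPA := bmf_transition U mphi bA.
have /= H := Rintegral_limit_functional bPA (transition_itv U mphi bA (indic_itv01 R A)).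
rewrite limit_functional_transition// in H.
rewrite -H /Rintegral fineK//.
by apply: (integrable_fin_num measurableT); exact: (bmf_integrable _ bPA).
Qed.

End stationary_existence.

(** * The noisy map *)

Section affine_change_of_variables.
Context {R : realType}.
Notation m := (@lebesgue_measure R).
Local Open Scope ereal_scope.

(** Uniqueness of Lebesgue measure: the rescaled image measure has the right value on half-open
    intervals. *)
Lemma lebesgue_measure_affine (a b : R) (A : set (measurableTypeR R)) :
  (0 < a)%R -> measurable A ->
  (a%:E * m ((fun x : measurableTypeR R => a * x + b : measurableTypeR R)%R @^-1` A) = m A)%E.
Proof.
move=> a0 mA; apply/esym.
have mf : measurable_fun [set: measurableTypeR R]
    (fun x : measurableTypeR R => a * x + b : measurableTypeR R)%R.
  by apply: measurable_funD => //; exact: measurable_funM.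
pose p := measure_function_pushforward__canonical__measure_function_Measure m mf.
pose s := mscale (NngNum (ltW a0)) p.
apply: (@lebesgue_measure_unique _ s) => //= _ [[c d]] _ <-.
rewrite /s /mscale/= /pushforward.
rewrite (_ : _ @^-1` _ = `]((c - b) / a)%R, ((d - b) / a)%R]%classic); last first.
  apply/seteqP; split => x /=; rewrite !in_itv/= ltr_pdivrMr// ler_pdivlMr// mulrC;
  by rewrite ltrBlDr lerBrDr.
rewrite !lebesgue_measure_itv/= !lte_fin ltr_pM2r ?invr_gt0// ltrD2r.
case: ifPn => _; last by rewrite mule0.
rewrite -!EFinD -EFinM; congr EFin.
by rewrite -mulrBl opprB addrA subrK mulrCA divff ?mulr1// lt0r_neq0.
Qed.

Lemma ge0_integral_affine (a b : R) (D : set R) (f : R -> \bar R) :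
  (0 < a)%R -> measurable D -> measurable_fun setT f -> (forall x, 0 <= f x) ->
  \int[m]_(x in [set x | D (a * x + b)%R]) f (a * x + b)%R =
  a^-1%:E * \int[m]_(x in D) f x.
Proof.
move=> a0 mD mf f0.
have mg : measurable_fun [set: measurableTypeR R]
    (fun x : measurableTypeR R => a * x + b : measurableTypeR R)%R.
  by apply: measurable_funD => //; exact: measurable_funM.
have -> : \int[m]_(x in [set x | D (a * x + b)%R]) f (a * x + b)%R =
    \int[pushforward m (fun x : measurableTypeR R => a * x + b : measurableTypeR R)%R]_(x in D) f x.
  by rewrite ge0_integral_pushforward//; exact: measurable_funTS.
pose p := measure_function_pushforward__canonical__measure_function_Measure m mg.
have a0' : (0 <= a)%R by exact: ltW.
have := @ge0_integral_mscale _ _ R p D mD (NngNum a0') f (measurable_funTS mf) (fun x _ => f0 x).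
move=> /(congr1 (fun z => a^-1%:E * z)).
rewrite /= muleA -EFinM mulVf ?lt0r_neq0// mul1e => <-; congr (_ * _).
apply: (eq_measure_integral m (m1 := mscale (NngNum a0') p)) => A mA _.
by rewrite /mscale/= /pushforward; exact: lebesgue_measure_affine.
Qed.

Lemma ge0_integral_shift (b : R) (D : set R) (f : R -> \bar R) :
  measurable D -> measurable_fun setT f -> (forall x, 0 <= f x) ->
  \int[m]_(x in [set x | D (x + b)%R]) f (x + b)%R = \int[m]_(x in D) f x.
Proof.
move=> mD mf f0; have := @ge0_integral_affine 1 b D f ltr01 mD mf f0.
rewrite invr1 mul1e => <-; under [RHS]eq_integral do rewrite mul1r.
by congr (\int[m]_(x in _) _); apply/seteqP; split => x /=; rewrite mul1r.
Qed.

Lemma ge0_integral_opp (D : set R) (f : R -> \bar R) :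
  measurable D -> measurable_fun setT f -> (forall x, 0 <= f x) ->
  \int[m]_(x in [set x | D (- x)%R]) f (- x)%R = \int[m]_(x in D) f x.
Proof.
move=> mD mf f0.
have -> : \int[m]_(x in [set x | D (- x)%R]) f (- x)%R =
    \int[pushforward m (-%R : _ -> measurableTypeR R)]_(x in D) f x.
  by rewrite ge0_integral_pushforward//; exact: measurable_funTS.
by apply: eq_measure_integral => //= A mA AS; exact: lebesgue_measureN.
Qed.

End affine_change_of_variables.

(** * Common properties of the periodic and the reflecting boundary condition *)

Section boundary_conditions.
Context {R : realType}.
Notation m := (@lebesgue_measure R).
Implicit Types (pi : R -> R) (x y z : R).

Lemma int_cell (p z : R) : 0 < p -> exists (k : int) (r : R),
  [/\ r = k%:~R, 2 * p * r - p < z & z <= 2 * p * r + p].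
Proof.
move=> p0; exists (Num.ceil ((z - p) / (2 * p))); eexists; split; first by [].
all: move: (Num.ceil _) (ceil_itv ((z - p) / (2 * p))) => k.
all: have p20 : 0 < 2 * p by rewrite mulr_gt0.
all: rewrite intrD mulrNz mulr1z ltr_pdivlMr// ler_pdivrMr// => /andP[].
all: by move: (k%:~R) => r; lra.
Qed.

Lemma periodic_bcE (k : int) (r : R) z : r = k%:~R -> 2 * r - 1 < z <= 2 * r + 1 ->
  periodic_bc z = z - 2 * r.
Proof.
move=> rk /andP[h1 h2]; rewrite /periodic_bc (_ : Num.ceil _ = k) -?rk//.
apply: ceil_def; rewrite intrD mulrNz mulr1z -rk.
by rewrite ltr_pdivlMr// ler_pdivrMr//; apply/andP; split; lra.
Qed.

(** On this cell [4 r] is a nearest multiple of 4 to [z + 1]: its distance is at most 2, and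
    distinct multiples of 4 are at least 4 apart. *)
Lemma reflecting_bcE (k : int) (r : R) z : r = k%:~R -> 4 * r - 3 <= z <= 4 * r + 1 ->
  reflecting_bc z = `|z + 1 - 4 * r| - 1.
Proof.
move=> rk /andP[h1 h2]; rewrite /reflecting_bc; congr (_ - 1).
have zk : `|z + 1 - 4 * r| <= 2 by rewrite ler_norml; lra.
apply/eqP; rewrite eq_le; apply/andP; split.
  by apply: ge_inf; [exists 0 => _ [i _ <-]|exists k; rewrite ?rk].
apply: lb_le_inf; first by exists `|z + 1 - 4 * r|, k; rewrite ?rk.
move=> _ [i _ <-]; have [->|ik] := eqVneq i k; first by rewrite rk.
apply: (le_trans zk).
have : 1 <= `|(k - i)%:~R| :> R.
  by rewrite -intr_norm ler1z -gtz0_ge1 normr_gt0 subr_eq0 eq_sym.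
rewrite intrB -rk; move: r (i%:~R) zk {rk h1 h2} => u v zk.
have : 4 * `|u - v| <= `|z + 1 - 4 * v| + `|z + 1 - 4 * u|.
  have -> : 4 * `|u - v| = `|(z + 1 - 4 * v) - (z + 1 - 4 * u)|.
    have -> : z + 1 - 4 * v - (z + 1 - 4 * u) = 4 * (u - v) by ring.
    by rewrite normrM (ger0_norm (ler0n R 4)).
  exact: ler_normB.
lra.
Qed.

Lemma bc_range pi z : boundary_condition pi -> `|pi z| <= 1.
Proof.
move=> [->|->].
  have [k [r [rk k1 k2]]] := int_cell z (@ltr01 R).
  rewrite (@periodic_bcE k r)//; last by apply/andP; split; lra.
  by rewrite ler_norml; apply/andP; split; lra.
have [k [r [rk k1 k2]]] := int_cell (z + 1) (ltr0n R 2).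
rewrite (@reflecting_bcE k r)//; last by apply/andP; split; lra.
have : `|z + 1 - 4 * r| <= 2 by rewrite ler_norml; lra.
have := normr_ge0 (z + 1 - 4 * r).
by move=> ? ?; rewrite ler_norml; apply/andP; split; lra.
Qed.

(** 4 is the period of the reflection and twice that of the reduction modulo 2, hence a period of
    both. *)
Lemma bc_periodic pi z : boundary_condition pi -> pi (z + 4) = pi z.
Proof.
move=> [->|->].
  have [k [r [rk k1 k2]]] := int_cell z (@ltr01 R).
  rewrite (@periodic_bcE k r z)//; last by apply/andP; split; lra.
  rewrite (@periodic_bcE (k + 2) (r + 2)) ?intrD ?rk//; [ring|rewrite -rk].
  by apply/andP; split; lra.
have [k [r [rk k1 k2]]] := int_cell (z + 1) (ltr0n R 2).
rewrite (@reflecting_bcE k r z)//; last by apply/andP; split; lra.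
rewrite (@reflecting_bcE (k + 1) (r + 1)) ?intrD ?rk//; last first.
  by rewrite -rk; apply/andP; split; lra.
by congr (`|_| - 1); ring.
Qed.

(** The endpoint -1 is excluded because the periodic condition sends it to 1. *)
Lemma bc_id pi z : boundary_condition pi -> -1 < z <= 1 -> pi z = z.
Proof.
move=> [->|->] /andP[z1 z2].
  by rewrite (@periodic_bcE 0 0)// ?mulr0 ?subr0//; apply/andP; split; lra.
rewrite (@reflecting_bcE 0 0)// ?mulr0; last by apply/andP; split; lra.
by rewrite subr0 ger0_norm ?addrK//; lra.
Qed.

(** The modulus of [pi z] is the same for both conditions. Even observables cannot tell them apart,
    which is how the small-noise analysis covers both at once. *)
Lemma bc_norm pi z : boundary_condition pi -> `|z| <= 2 ->
  `|pi z| = 1 - `|(`|z| - 1)|.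
Proof.
move=> hpi; rewrite ler_norml => /andP[z1 z2].
have [zN1|zN1] := leP z (-1).
  rewrite (ler0_norm (_ : z <= 0)); last by lra.
  rewrite (ger0_norm (_ : 0 <= - z - 1)); last by lra.
  have -> : pi z = pi (z + 4) by rewrite (bc_periodic _ hpi).
  case: hpi => ->.
    rewrite (@periodic_bcE 1 1)//; last by apply/andP; split; lra.
    by rewrite ger0_norm; lra.
  rewrite (@reflecting_bcE 1 1)//; last by apply/andP; split; lra.
  by rewrite (ler0_norm (_ : z + 4 + 1 - 4 * 1 <= 0)) ?ler0_norm; lra.
have [z1'|z1'] := leP z 1.
  rewrite (bc_id hpi) ?zN1//; have [z0|z0] := leP 0 z.
    by rewrite (ger0_norm z0) ler0_norm; lra.
  by rewrite (ltr0_norm z0) ler0_norm; lra.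
rewrite (ger0_norm (_ : 0 <= z)); last by lra.
rewrite (ger0_norm (_ : 0 <= z - 1)); last by lra.
case: hpi => ->.
  rewrite (@periodic_bcE 1 1)//; last by apply/andP; split; lra.
  by rewrite ler0_norm; lra.
rewrite (@reflecting_bcE 1 1)//; last by apply/andP; split; lra.
by rewrite (ler0_norm (_ : z + 1 - 4 * 1 <= 0)) ?ger0_norm; lra.
Qed.

Lemma bc_second_cell pi : boundary_condition pi ->
  (forall z, 1 < z <= 3 -> pi z = z - 2) \/ (forall z, 1 < z <= 3 -> pi z = 2 - z).
Proof.
move=> [->|->]; [left|right] => z /andP[z1 z2].
  by rewrite (@periodic_bcE 1 1) ?mulr1//; apply/andP; split; lra.
rewrite (@reflecting_bcE 1 1)//; last by apply/andP; split; lra.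
by rewrite ler0_norm; lra.
Qed.

Lemma measurable_ceil : measurable_fun setT (fun x : R => (Num.ceil x)%:~R : R).
Proof.
apply: nondecreasing_measurable => //= x y xy.
by rewrite ler_int; apply: le_ceil.
Qed.

Lemma bc_measurable pi : boundary_condition pi -> measurable_fun setT pi.
Proof.
move=> [->|->].
  apply: measurable_funB => //; apply: measurable_funM => //.
  apply: (measurableT_comp measurable_ceil).
  by apply: measurable_funM => //; exact: measurable_funB.
rewrite (_ : reflecting_bc =
   fun z => `|z + 1 - 4 * (Num.ceil ((z - 1) / 4))%:~R| - 1); last first.
  apply/funext => z; apply: (@reflecting_bcE (Num.ceil ((z - 1) / 4)) _ z erefl).
  have /andP[] := ceil_itv ((z - 1) / 4).
  rewrite intrD mulrNz mulr1z ltr_pdivlMr// ler_pdivrMr//.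
  by move: (Num.Def.ceil _)%:~R => k ? ?; apply/andP; split; lra.
apply: measurable_funB => //; apply: measurableT_comp => //.
apply: measurable_funB; first exact: measurable_funD.
apply: measurable_funM => //; apply: (measurableT_comp measurable_ceil).
by apply: measurable_funM => //; exact: measurable_funB.
Qed.

Local Open Scope ereal_scope.

(** A period covers [-1, 1] twice: by the identity on []-1, 1]], by a translation or a reflection on
    []1, 3]]. *)
Lemma ge0_integral_bc_period pi (f : R -> \bar R) : boundary_condition pi ->
  measurable_fun setT f -> (forall x, 0 <= f x) ->
  \int[m]_(z in `](-1)%R, 3%R]) f (pi z) = 2%:E * \int[m]_(z in `[(-1)%R, 1%R]) f z.
Proof.
move=> hpi mf f0; have mpi := bc_measurable hpi.
have mfpi : measurable_fun setT (fun z => f (pi z)) by exact: measurableT_comp.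
rewrite (_ : `](-1)%R, 3%R]%classic = `](-1)%R, 1%R] `|` `]1%R, 3%R]); last first.
  by apply: itv_bndbnd_setU; rewrite bnd_simp; lra.
rewrite ge0_integral_setU//=; last 2 first.
- exact: measurable_funTS.
- by apply/disj_setPS => z [/=]; rewrite !in_itv/=; lra.
have mfS (A : set R) : measurable_fun A f by exact: measurable_funTS.
have -> : \int[m]_(z in `](-1)%R, 1%R]) f (pi z) = \int[m]_(z in `[(-1)%R, 1%R]) f z.
  transitivity (\int[m]_(z in `](-1)%R, 1%R]) f z).
    by apply: eq_integral => z; rewrite inE/= in_itv/= => z1; rewrite (bc_id hpi).
  exact: integral_itv_obnd_cbnd.
have -> : \int[m]_(z in `]1%R, 3%R]) f (pi z) = \int[m]_(z in `[(-1)%R, 1%R]) f z.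
  have [H|H] := bc_second_cell hpi.
    transitivity (\int[m]_(z in `]1%R, 3%R]) f (z + - 2)%R).
      by apply: eq_integral => z; rewrite inE/= in_itv/= => z1; rewrite H.
    rewrite -integral_itv_obnd_cbnd// -[RHS](@ge0_integral_shift _ (- 2)%R)//.
    congr (\int[m]_(x in _) _); apply/seteqP; split => x /=; rewrite !in_itv/=; lra.
  transitivity (\int[m]_(z in `]1%R, 3%R]) f (- z + 2)%R).
    by apply: eq_integral => z; rewrite inE/= in_itv/= => z1; rewrite H// addrC.
  rewrite -[RHS]integral_itv_bndo_bndc//.
  rewrite -[RHS](@ge0_integral_shift _ 2%R)//.
  rewrite -[RHS](@ge0_integral_opp _ [set x | `[(-1)%R, 1%R[%classic (x + 2)%R] (fun x => f (x + 2)%R))//.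
  - rewrite (_ : [set x | _ (- x)%R] = `]1%R, 3%R]%classic)//.
    by rewrite predeqE => x /=; rewrite !in_itv/=; split; lra.
  - rewrite (_ : [set x | `[(-1)%R, 1%R[%classic (x + 2)%R] = `[(-3)%R, (-1)%R[%classic)//.
    by apply/seteqP; split => x /=; rewrite !in_itv/=; lra.
  - by apply: measurableT_comp => //; exact: measurable_funD.
by rewrite -mule2n mule_natl.
Qed.

Lemma ge0_integral_bc_shift4 pi (a b : R) (f : R -> \bar R) : boundary_condition pi ->
  measurable_fun setT f -> (forall x, 0 <= f x) ->
  \int[m]_(z in `](a + 4)%R, (b + 4)%R]) f (pi z) = \int[m]_(z in `]a, b]) f (pi z).
Proof.
move=> hpi mf f0; have mpi := bc_measurable hpi.
have mfpi : measurable_fun setT (fun z => f (pi z)) by exact: measurableT_comp.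
rewrite -[LHS](@ge0_integral_shift _ 4%R _ (fun z => f (pi z)))//.
rewrite (_ : [set x | `](a + 4)%R, (b + 4)%R]%classic (x + 4)%R] = `]a, b]%classic); last first.
  by apply/seteqP; split => x /=; rewrite !in_itv/=; lra.
by apply: eq_integral => z _; rewrite (bc_periodic _ hpi).
Qed.

Lemma ge0_integral_bc_itv pi (n : nat) (f : R -> \bar R) : boundary_condition pi ->
  measurable_fun setT f -> (forall x, 0 <= f x) ->
  \int[m]_(z in `](- 1 - 4 * n%:R)%R, (- 1 + 4 * n%:R)%R]) f (pi z) =
  (4 * n%:R)%:E * \int[m]_(z in `[(-1)%R, 1%R]) f z.
Proof.
move=> hpi mf f0; have mpi := bc_measurable hpi.
have mfpi : measurable_fun setT (fun z => f (pi z)) by exact: measurableT_comp.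
have H (k : nat) : \int[m]_(z in `](-1)%R, (- 1 + 4 * k%:R)%R]) f (pi z) =
    (2 * k%:R)%:E * \int[m]_(z in `[(-1)%R, 1%R]) f z.
  elim: k => [|k IH].
    by rewrite !mulr0 addr0 set_itvoc0 integral_set0 mul0e.
  have k0 : (0 <= k%:R :> R)%R by [].
  rewrite (_ : `](-1)%R, (- 1 + 4 * k.+1%:R)%R]%classic =
     `](-1)%R, 3%R] `|` `](-1 + 4)%R, (- 1 + 4 * k%:R + 4)%R]); last first.
    rewrite (@itv_bndbnd_setU _ _ _ (BRight 3%R)); last 2 first.
    - by rewrite bnd_simp; lra.
    - by rewrite bnd_simp -[k.+1%:R]natr1; lra.
    congr (_ `|` _); rewrite -[k.+1%:R]natr1 mulrDr mulr1 addrA.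
    by rewrite (_ : -1 + 4 = 3 :> R)%R//; lra.
  rewrite ge0_integral_setU//=; last 2 first.
  - exact: measurable_funTS.
  - by apply/disj_setPS => z [/=]; rewrite !in_itv/=; lra.
  rewrite ge0_integral_bc_shift4// IH ge0_integral_bc_period//.
  rewrite -ge0_muleDl ?lee_fin ?mulr_ge0//.
  by rewrite -EFinD -[k.+1%:R]natr1; congr (_%:E * _); lra.
have S (k : nat) a b : \int[m]_(z in `](a + 4 * k%:R)%R, (b + 4 * k%:R)%R]) f (pi z) =
    \int[m]_(z in `]a, b]) f (pi z).
  elim: k => [|k IH]; first by rewrite mulr0 !addr0.
  have E c : (c + 4 * k.+1%:R = c + 4 * k%:R + 4 :> R)%R by rewrite -[k.+1%:R]natr1; ring.
  by rewrite !E ge0_integral_bc_shift4.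
rewrite -(S n) subrK (_ : - 1 + 4 * n%:R + 4 * n%:R = - 1 + 4 * (2 * n)%:R)%R.
  by rewrite H natrM mulrA (_ : 2 * 2%:R = 4 :> R)%R//; ring.
by rewrite natrM; ring.
Qed.

End boundary_conditions.

(** * The random system as a Markov kernel on the line *)

Section noisy_map.
Context {R : realType}.
Notation m := (@lebesgue_measure R).
Notation X := (measurableTypeR R).

Lemma ltrN11 : (-1 < 1 :> R). Proof. by lra. Qed.

Definition noise : probability X R := uniform_prob ltrN11.

(* Clamping extends the kernel from [-1, 1] to R; stationary measures do not see it. *)
Definition clamp (x : R) : R := Num.max (-1) (Num.min 1 x).

Lemma clamp_itv x : -1 <= clamp x <= 1.
Proof. by rewrite /clamp le_max ge_max ge_min !lexx /= andbT ltW// ltrN11. Qed.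

Lemma clamp_norm x : `|clamp x| <= 1.
Proof. by rewrite ler_norml clamp_itv. Qed.

Lemma clamp_id x : `|x| <= 1 -> clamp x = x.
Proof.
by rewrite ler_norml /clamp => /andP[? ?]; rewrite min_r// max_r.
Qed.

Definition noisy_map (pi T : R -> R) (xi : R) (z : (X * X)%type) : X :=
  pi (T (clamp z.1) + xi * z.2).

Variables (pi T : R -> R).
Hypotheses (hpi : boundary_condition pi) (mT : measurable_fun setT T).

Lemma measurable_clamp : measurable_fun setT clamp.
Proof.
apply: measurable_maxr => //; exact: measurable_minr.
Qed.

Lemma measurable_noisy_map xi : measurable_fun setT (noisy_map pi T xi).
Proof.
apply: (measurableT_comp (bc_measurable hpi)).
apply: measurable_funD.
  apply: (measurableT_comp mT); exact: (measurableT_comp measurable_clamp).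
by apply: measurable_funM.
Qed.

Local Open Scope ereal_scope.

Lemma ge0_integral_noise (t xi : R) (f : R -> \bar R) : (0 < xi)%R ->
  measurable_fun setT f -> (forall x, 0 <= f x) ->
  \int[noise]_y f (t + xi * y)%R =
  (2 * xi)^-1%:E * \int[m]_(z in `[(t - xi)%R, (t + xi)%R]) f z.
Proof.
move=> xi0 mf f0; rewrite /noise integral_uniform//; last first.
  have mg : measurable_fun setT (fun y : R => t + xi * y)%R.
    exact: (measurable_funD (measurable_cst t) (@mulrl_measurable R _ xi)).
  exact: (measurableT_comp mf mg).
rewrite opprK (_ : 1 + 1 = 2 :> R)%R; last by lra.
rewrite invfM EFinM -muleA; congr (_ * _).
rewrite -(@ge0_integral_affine _ xi t)//.
rewrite (_ : [set x | `[(t - xi)%R, (t + xi)%R]%classic (xi * x + t)%R] = `[(-1)%R, 1%R]%classic); last first.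
  rewrite predeqE => x /=; rewrite !in_itv/=; split => /andP[h1 h2]; apply/andP; split; nra.
by apply: eq_integral => y _; rewrite addrC.
Qed.

Hypothesis TS : forall x, (`|x| <= 1)%R -> (`|T x| <= 1)%R.

Lemma ge0_integral_noisy_map xi x (f : R -> \bar R) : (0 < xi)%R ->
  measurable_fun setT f -> (forall x, 0 <= f x) ->
  \int[noise]_y f (noisy_map pi T xi (x, y)) =
  (2 * xi)^-1%:E * \int[m]_(z in `[(T (clamp x) - xi)%R, (T (clamp x) + xi)%R]) f (pi z).
Proof.
move=> xi0 mf f0; rewrite /noisy_map/= (@ge0_integral_noise _ _ (fun z => f (pi z)))//.
exact: (measurableT_comp mf (bc_measurable hpi)).
Qed.

(** The noise window is contained in [2 n] periods with [n <= xi + 1], so one step has density at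
    most [4 n / (2 xi)]. The stated constant is twice what this gives. *)
Lemma noisy_map_upper xi x (f : R -> \bar R) : (0 < xi)%R ->
  measurable_fun setT f -> (forall x, 0 <= f x) ->
  \int[noise]_y f (noisy_map pi T xi (x, y)) <=
  (4 + 4 / xi)%:E * \int[m]_(z in `[(-1)%R, 1%R]) f z.
Proof.
move=> xi0 mf f0; rewrite ge0_integral_noisy_map//.
have mfpi : measurable_fun setT (fun z => f (pi z)).
  exact: (measurableT_comp mf (bc_measurable hpi)).
pose n := (Num.truncn xi).+1.
have nxi : (xi < n%:R)%R by exact: truncnS_gt.
have nxi' : (n%:R <= xi + 1)%R by rewrite /n -natr1 lerD2r truncn_le// ltW.
have n1 : (1 <= n%:R :> R)%R by rewrite ler1n.
have I0 : 0 <= \int[m]_(z in `[(-1)%R, 1%R]) f z by exact: integral_ge0.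
apply: (@le_trans _ _ ((2 * xi)^-1%:E * ((4 * n%:R)%:E * \int[m]_(z in `[(-1)%R, 1%R]) f z))).
  apply: lee_wpmul2l; first by rewrite lee_fin invr_ge0 mulr_ge0 // ltW.
  rewrite -(ge0_integral_bc_itv n hpi mf f0).
  apply: ge0_subset_integral => //=; first exact: measurable_funTS.
  move=> z /=; rewrite !in_itv/=; have := TS (clamp_norm x); rewrite ler_norml => /andP[? ?] /andP[? ?].
  by apply/andP; split; lra.
rewrite muleA -EFinM; apply: lee_wpmul2r => //; rewrite lee_fin.
have -> : (4 + 4 / xi = (2 * xi)^-1 * (8 * xi + 8))%R by field; rewrite lt0r_neq0.
by rewrite ler_wpM2l ?invr_ge0 ?mulr_ge0 ?ltW//; lra.
Qed.

(** A window of length 4 is one period: its part below -1, moved up by 4, completes the rest to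
    []-1, 3]], whatever its centre. *)
Lemma noisy_map_full x (f : R -> \bar R) :
  measurable_fun setT f -> (forall x, 0 <= f x) ->
  \int[noise]_y f (noisy_map pi T 2 (x, y)) =
  2^-1%:E * \int[m]_(z in `[(-1)%R, 1%R]) f z.
Proof.
move=> mf f0; rewrite ge0_integral_noisy_map//.
have mfpi : measurable_fun setT (fun z => f (pi z)).
  exact: (measurableT_comp mf (bc_measurable hpi)).
have := TS (clamp_norm x); rewrite ler_norml; set t := T _ => /andP[t1 t2].
rewrite -integral_itv_obnd_cbnd; last exact: measurable_funTS.
suff -> : \int[m]_(z in `](t - 2)%R, (t + 2)%R]) f (pi z) =
    \int[m]_(z in `](-1)%R, 3%R]) f (pi z).
  by rewrite ge0_integral_bc_period// muleA -EFinM invfM divfK.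
rewrite (@itv_bndbnd_setU _ _ _ (BRight (-1)%R)); last 2 first.
- by rewrite bnd_simp; lra.
- by rewrite bnd_simp; lra.
rewrite ge0_integral_setU//; last 2 first.
- exact: measurable_funTS.
- by apply/disj_setPS => z [/=]; rewrite !in_itv/=; lra.
rewrite [in RHS](@itv_bndbnd_setU _ _ _ (BRight (t + 2)%R)); last 2 first.
- by rewrite bnd_simp; lra.
- by rewrite bnd_simp; lra.
rewrite ge0_integral_setU; [|by []|by []|exact: measurable_funTS|by []|]; last first.
  by apply/disj_setPS => z [/=]; rewrite !in_itv/=; lra.
rewrite addeC; congr (_ + _).
rewrite -[LHS](ge0_integral_bc_shift4 _ _ hpi mf f0).
have -> : (t - 2 + 4 = t + 2)%R by ring.
by have -> : (-1 + 4 = 3 :> R)%R by ring.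
Qed.

(** Bridge between the annealed operator of the statement and the Markov kernel: Fubini exchanges
    noise and state, and clamping is invisible to a measure carried by the phase space. Conversely,
    stationarity for the kernel forces this support, since [pi] takes its values in [-1, 1]. *)
Lemma stationary_measureP xi (mu : probability X R) : (0 < xi)%R ->
  stationary_measure pi T xi mu <-> stationary noise (noisy_map pi T xi) mu.
Proof.
move=> xi0; have mphi := measurable_noisy_map xi.
have mS : measurable ([set x | `|x| <= 1]%R : set X).
  rewrite (_ : [set x | _] = `[(-1)%R, 1%R]%classic)//.
  by rewrite predeqE => x /=; rewrite in_itv/= ler_norml.
have SE : phase_space = [set x : X | `|x| <= 1]%R.
  by rewrite /phase_space predeqE => x /=; rewrite in_itv/= ler_norml.
have key (A : set X) : measurable A -> mu phase_space = 1 ->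
    annealed_transfer pi T xi mu A =
    \int[mu]_x noise [set y | A (noisy_map pi T xi (x, y))].
  move=> mA muS.
  pose h (x y : X) : \bar R := (\1_A (pi (T (clamp x) + y)%R))%:E.
  have mg : measurable_fun setT (fun z : X * X => pi (T (clamp z.1) + z.2)%R : X).
    apply: (measurableT_comp (bc_measurable hpi)).
    apply: measurable_funD => //.
    by apply: (measurableT_comp mT); exact: (measurableT_comp measurable_clamp).
  have mh : measurable_fun setT (fun z : X * X => h z.1 z.2).
    by apply/measurable_EFinP; exact: (measurableT_comp (measurable_indic mA) mg).
  have h0 x y : 0 <= h x y by rewrite lee_fin.
  have mG : measurable_fun setT (fun y : X => \int[mu]_x h x y).
    exact: (@measurable_fun_fubini_tonelli_G _ _ _ _ _ mu (fun z => h z.1 z.2)).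
  transitivity ((2 * xi)^-1%:E * \int[m]_(y in `[(- xi)%R, xi]) \int[mu]_x h x y).
    rewrite /annealed_transfer /noise_convolution.
    rewrite -ge0_integralZl//=; last 3 first.
    - exact: measurable_funTS.
    - by move=> y _; apply: integral_ge0.
    - by rewrite lee_fin invr_ge0 mulr_ge0// ltW.
    apply: eq_integral => y; rewrite inE/= in_itv/= => /andP[y1 y2].
    congr (_ * _).
      congr EFin; rewrite /scaled_noise_kernel /noise_kernel indicE mem_set.
        by rewrite mulr1 -invfM mulrC.
      rewrite /phase_space/= in_itv/= ler_pdivlMr// ler_pdivrMr// mulN1r mul1r.
      by rewrite y1.
    have mB : measurable [set x : X | A (pi (T (clamp x) + y)%R)].
      rewrite -[X in measurable X]setTI.
      by apply: (measurableT_comp mg (measurable_pair2 y)).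
    transitivity (mu [set x : X | A (pi (T (clamp x) + y)%R)]); last first.
      by rewrite /h -[in LHS](setIT [set x : X | A (pi (T (clamp x) + y)%R)]) -integral_indic//.
    have muSc : mu (~` phase_space) = 0.
      by rewrite probability_setC// ?muS ?subee// SE.
    rewrite (measureDI mu mB mS) /= [X in X + _](_ : _ = 0); last first.
      apply/eqP; rewrite -measure_le0 -muSc le_measure// ?inE.
      - exact: measurableD.
      - by rewrite SE; exact: measurableC.
      - by rewrite SE => x [].
    rewrite add0e /extension_by_zero /transfer; congr (mu _).
    rewrite SE predeqE => x /=; split => [[x1 [[z Az zx] _]]|[Ax x1]].
      by split => //; rewrite (clamp_id x1) -zx subrK.
    split => //; split; last exact: TS.
    by exists (T x + y)%R; rewrite ?addrK// -(clamp_id x1).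
  transitivity (\int[noise]_y \int[mu]_x h x (0 + xi * y)%R).
    by rewrite (@ge0_integral_noise 0 xi (fun y => \int[mu]_x h x y))// ?sub0r ?add0r// => y;
      exact: integral_ge0.
  rewrite -(@fubini_tonelli _ _ _ _ _ mu noise (fun z => h z.1 (0 + xi * z.2)%R))//=; last first.
    have ms : measurable_fun setT (fun z : X * X => (z.1, (0 + xi * z.2)%R) : X * X).
      apply: measurable_fun_pair => //=; apply: measurable_funD => //.
      by apply: measurable_funM.
    exact: (measurableT_comp mh ms).
  apply: eq_integral => x _.
  have mC : measurable [set y | A (noisy_map pi T xi (x, y))].
    rewrite -[X in measurable X]setTI.
    by apply: (measurableT_comp mphi (measurable_pair1 x)).
  rewrite -[in RHS](setIT [set y | A (noisy_map pi T xi (x, y))]) -integral_indic//.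
  by apply: eq_integral => y _; rewrite /h add0r.
split=> [[muS sm] A mA|sm].
  by rewrite -key// sm.
suff muS : mu phase_space = 1 by split => // A mA; rewrite key// sm.
rewrite -(sm phase_space) ?SE//.
transitivity (\int[mu]_x cst 1 x).
  apply: eq_integral => x _.
  rewrite (_ : [set y | _] = setT); first exact: probability_setT.
  by rewrite predeqE => y; split => // _; rewrite /= bc_range.
rewrite integral_cst// mul1e; exact: probability_setT.
Qed.

End noisy_map.

Section noisy_transition.
Context {R : realType}.
Notation m := (@lebesgue_measure R).
Notation X := (measurableTypeR R).
Variables (pi : R -> R).
Hypothesis (hpi : boundary_condition pi).
Notation P T xi := (transition (@noise R) (noisy_map pi T xi)).
Implicit Types (T : R -> R) (xi : R).

Definition selfmap (T : R -> R) :=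
  measurable_fun setT T /\ forall x, `|x| <= 1 -> `|T x| <= 1.

Lemma bmf_bc (g : X -> R) : bmf g -> bmf (fun x : X => g (pi x)).
Proof.
move=> [mg [M gM]]; split; last by exists M.
exact: (measurableT_comp mg (bc_measurable hpi)).
Qed.

Lemma bmf_integrable_itv (g : X -> R) (a b : itv_bound R) : bmf g ->
  (m [set` Interval a b] < +oo)%E -> m.-integrable [set` Interval a b] (EFin \o g).
Proof.
move=> [mg [M gM]] fin; apply: measurable_bounded_integrable => //.
  exact: measurable_funTS.
by exists M; split => [|y My x _] /=; rewrite ?num_real//; exact: le_trans (gM x) (ltW My).
Qed.

Lemma lebesgue_itv_lty (b1 b2 : bool) (a b : R) :
  (m [set` Interval (BSide b1 a) (BSide b2 b)] < +oo)%E.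
Proof. by rewrite lebesgue_measure_itv/=; case: ifP => // _; rewrite -EFinD ltry. Qed.

Lemma Rintegral_itv_cst (b1 b2 : bool) (a b r : R) : a <= b ->
  \int[m]_(z in [set` Interval (BSide b1 a) (BSide b2 b)]) r = r * (b - a).
Proof.
move=> ab; rewrite Rintegral_cst//.
transitivity (r * fine ((b - a)%:E)) => //; congr (_ * fine _).
transitivity (m [set` Interval (BSide b1 a) (BSide b2 b)]) => //.
rewrite lebesgue_measure_itv/= lte_fin; case: ifPn => //.
by rewrite -leNgt => ba; rewrite (@le_anti _ _ a b) ?subrr// ab ba.
Qed.

Lemma transition_noisyE T xi (g : X -> R) x : selfmap T -> 0 < xi -> bmf g ->
  P T xi g x = (2 * xi)^-1 *
  \int[m]_(z in `[T (clamp x) - xi, T (clamp x) + xi]) g (pi z).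
Proof.
move=> [mT TS] xi0 bg; have [mg [M gM]] := bg.
have mphi := measurable_noisy_map hpi mT xi.
have bgM : bmf (fun x => g x + M) by apply: bmfD => //; exact: bmf_cst.
have bgMpi := bmf_bc bgM.
have bgpi := bmf_bc bg.
have gM0 z : 0 <= g z + M.
  by have := gM z; rewrite ler_norml => /andP[]; lra.
have mgM : measurable_fun setT (fun z : R => (g z + M)%:E).
  by apply/measurable_EFinP; exact: bgM.1.
have gM0' (z : R) : (0 <= (g z + M)%:E)%E by rewrite lee_fin.
have := congr1 fine (@ge0_integral_noisy_map _ pi T hpi xi x _ xi0 mgM gM0').
have -> : fine (\int[noise]_y (g (noisy_map pi T xi (x, y)) + M)%:E)%E =
    P T xi (fun z => g z + M) x by [].
rewrite transitionD//; last exact: bmf_cst.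
rewrite transition_cst => H.
set a := T (clamp x) - xi; set b := T (clamp x) + xi.
have fin := lebesgue_itv_lty true false a b.
have ab : a <= b by rewrite /a /b; lra.
have {}H : P T xi g x + M = (2 * xi)^-1 * \int[m]_(z in `[a, b]) (g (pi z) + M).
  rewrite H fineM//; apply: integrable_fin_num => //.
  exact: (bmf_integrable_itv bgMpi fin).
rewrite RintegralD// in H; last 2 first.
- exact: (bmf_integrable_itv bgpi fin).
- exact: (bmf_integrable_itv (bmf_cst _ M) fin).
rewrite Rintegral_itv_cst// (_ : b - a = 2 * xi) in H; last by rewrite /a /b; ring.
move: H; rewrite mulrDr [M * _]mulrC mulKf ?lt0r_neq0 ?mulr_gt0//.
by move/(congr1 (fun z => z - M)); rewrite !addrK.
Qed.

Lemma window_primitive (G : R -> R) (L : R) : measurable_fun setT G ->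
  (forall x, 0 <= G x <= 1) -> exists F : R -> R, forall a b, L <= a -> a <= b ->
  [/\ \int[m]_(z in `[a, b]) G z = F b - F a, 0 <= F b - F a & F b - F a <= b - a].
Proof.
move=> mG G01; have bG : bmf (G : X -> R).
  split => //; exists 1 => x; have /andP[? ?] := G01 x.
  by rewrite ger0_norm.
exists (fun z => \int[m]_(z in `[L, z]) G z) => a b La ab.
have E : \int[m]_(z in `[a, b]) G z = \int[m]_(z in `[L, b]) G z - \int[m]_(z in `[L, a]) G z.
  rewrite Rintegral_itvB ?bnd_simp//; last exact: (bmf_integrable_itv bG (lebesgue_itv_lty _ _ _ _)).
  rewrite Rintegral_itv_obnd_cbnd//.
  exact: (bmf_integrable_itv bG (lebesgue_itv_lty _ _ _ _)).
rewrite -E; split => //; first by apply: Rintegral_ge0 => x _; have /andP[] := G01 x.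
have -> : b - a = \int[m]_(z in `[a, b]) (1 : R).
  by rewrite Rintegral_itv_cst// mul1r.
apply: le_Rintegral => //.
- exact: (bmf_integrable_itv bG (lebesgue_itv_lty _ _ _ _)).
- exact: (bmf_integrable_itv (bmf_cst _ 1) (lebesgue_itv_lty _ _ _ _)).
- by move=> x _; have /andP[] := G01 x.
Qed.

(** The noise smooths: a window integral of a test with values in [0, 1] is Lipschitz in the
    endpoints, however irregular the test. Each endpoint moves by at most [d + |xi - xi'|], and the
    change of normalisation costs a further [2 |xi - xi'|] before division by [2 xi]. *)
Lemma transition_noisy_perturbation T T' xi xi' d (g : X -> R) x :
  selfmap T -> selfmap T' -> 0 < xi -> 0 < xi' ->
  (forall x, `|x| <= 1 -> `|T x - T' x| <= d) ->
  bmf g -> (forall x, 0 <= g x <= 1) ->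
  `|P T xi g x - P T' xi' g x| <= (d + 2 * `|xi - xi'|) / xi.
Proof.
move=> hT hT' xi0 xi0' Td bg g01.
rewrite !transition_noisyE//.
set t := T _; set t' := T' _.
have t1 : `|t| <= 1 by apply: hT.2; exact: clamp_norm.
have t1' : `|t'| <= 1 by apply: hT'.2; exact: clamp_norm.
have tt' : `|t - t'| <= d by apply: Td; exact: clamp_norm.
have mG : measurable_fun setT (fun z => g (pi z)).
  exact: (measurableT_comp bg.1 (bc_measurable hpi)).
(* The base point of the primitive lies to the left of both windows. *)
have [F HF] := window_primitive (- 1 - xi - xi') mG (fun z => g01 (pi z)).
have F1 a b : - 1 - xi - xi' <= a -> - 1 - xi - xi' <= b -> `|F b - F a| <= `|b - a|.
  move=> la lb; have [ab|ba] := leP a b.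
    by have [_ h1 h2] := HF _ _ la ab; rewrite !ger0_norm// subr_ge0.
  have [_ h1 h2] := HF _ _ lb (ltW ba).
  by rewrite distrC (distrC b) !ger0_norm// subr_ge0 ltW.
have /andP[? ?] : -1 <= t <= 1 by rewrite -ler_norml.
have /andP[? ?] : -1 <= t' <= 1 by rewrite -ler_norml.
have [-> _ _] := HF (t - xi) (t + xi) ltac:(lra) ltac:(lra).
have [-> h1 h2] := HF (t' - xi') (t' + xi') ltac:(lra) ltac:(lra).
have k1 := F1 (t' + xi') (t + xi) ltac:(lra) ltac:(lra).
have k2 := F1 (t' - xi') (t - xi) ltac:(lra) ltac:(lra).
set A := F (t + xi) - F (t - xi); set A' := F (t' + xi') - F (t' - xi').
have AA : `|A - A'| <= 2 * d + 2 * `|xi - xi'|.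
  have -> : A - A' = (F (t + xi) - F (t' + xi')) - (F (t - xi) - F (t' - xi')).
    by rewrite /A /A'; ring.
  rewrite (le_trans (ler_normB _ _))//.
  have l1 : `|t + xi - (t' + xi')| <= `|t - t'| + `|xi - xi'|.
    by rewrite (_ : _ - _ = (t - t') + (xi - xi')) ?ler_normD//; ring.
  have l2 : `|t - xi - (t' - xi')| <= `|t - t'| + `|xi - xi'|.
    by rewrite (_ : _ - _ = (t - t') - (xi - xi')) ?ler_normB//; ring.
  by move: k1 k2 l1 l2 tt'; move: `|_| `|_| `|_| `|_| `|_| `|_| => *; lra.
have A'1 : `|A'| <= 2 * xi'.
  by rewrite ger0_norm//; move: h2; rewrite /A'; lra.
have -> : (2 * xi)^-1 * A - (2 * xi')^-1 * A' =
   ((A - A') + A' * ((xi' - xi) / xi')) / (2 * xi).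
  by field; rewrite ?lt0r_neq0.
rewrite normrM [X in _ * X]gtr0_norm ?invr_gt0 ?mulr_gt0//.
rewrite ler_pdivrMr ?mulr_gt0// (_ : (d + _) / xi * (2 * xi) = 2 * d + 2 * `|xi - xi'| + 2 * `|xi - xi'|); last first.
  by field; rewrite lt0r_neq0.
rewrite (le_trans (ler_normD _ _))// lerD//.
rewrite normrM normrM (gtr0_norm (_ : 0 < xi'^-1)) ?invr_gt0// mulrA ler_pdivrMr//.
rewrite (distrC xi') mulrAC ler_wpM2r// (le_trans A'1)//.
Qed.

(** Doeblin's argument: the minorization is applied to [g] at one point and to [1 - g] at the other,
    and the two are added. *)
Lemma noisy_contracting T xi N c (a b : R) : selfmap T -> 0 < xi -> a < b ->
  (forall (g : X -> R), bmf g -> (forall x, 0 <= g x <= 1) ->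
    forall x, c * \int[m]_(z in `]a, b]) g z <= iter N (P T xi) g x) ->
  contracting (@noise R) (noisy_map pi T xi) N (1 - c * (b - a)).
Proof.
move=> hT xi0 ab H g bg g01 x x'.
have mphi := measurable_noisy_map hpi hT.1 xi.
have fin := lebesgue_itv_lty false false a b.
have bg' : bmf (fun x : X => 1 - g x) by apply: bmfB => //; exact: bmf_cst.
have g01' y : 0 <= 1 - g y <= 1 by have := g01 y; lra.
have := H _ bg' g01' x; rewrite iter_transitionB//; last exact: bmf_cst.
rewrite iter_transition_cst RintegralB//; last 2 first.
- exact: (bmf_integrable_itv (bmf_cst _ 1) fin).
- exact: (bmf_integrable_itv bg fin).
rewrite Rintegral_itv_cst ?(ltW ab)// mul1r.
have := H _ bg g01 x'; set I := \int[m]_(z in _) _; rewrite mulrBr; lra.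
Qed.

Lemma noisy_stationary_exists T xi N c : selfmap T -> 0 < xi -> 0 < c < 1 ->
  contracting (@noise R) (noisy_map pi T xi) N c ->
  exists mu : probability X R, stationary (@noise R) (noisy_map pi T xi) mu.
Proof.
move=> hT xi0 c01 cc; have mphi := measurable_noisy_map hpi hT.1 xi.
(* The dominating measure is a multiple of the uniform law; the factor 2 undoes its density 1/2. *)
have C0 : 0 <= 2 * (4 + 4 / xi) by rewrite mulr_ge0// addr_ge0// divr_ge0// ltW.
pose mm := mscale (NngNum C0) (@noise R).
apply: (@stationary_exists _ _ _ _ _ _ _ mphi N c c01 cc 0 mm).
move=> A x mA; rewrite /mm/= /mscale/=.
have mB : measurable [set y | A (noisy_map pi T xi (x, y))].
  rewrite -[X in measurable X]setTI.
  by apply: (measurableT_comp mphi (measurable_pair1 x)).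
have mA1 : measurable_fun setT (fun z : X => (\1_A z : R)%:E).
  by apply/measurable_EFinP; exact: measurable_indic.
have -> : noise [set y | A (noisy_map pi T xi (x, y))] =
    (\int[noise]_y (\1_A (noisy_map pi T xi (x, y)))%:E)%E.
  by rewrite -[in LHS](setIT [set y | A (noisy_map pi T xi (x, y))]) -integral_indic//.
have -> : noise A = (2^-1%:E * \int[m]_(y in `[(-1)%R, 1%R]) (\1_A y)%:E)%E.
  transitivity (\int[noise]_y (\1_A y)%:E)%E; first by rewrite integral_indic// setIT.
  rewrite /noise integral_uniform//.
  by rewrite opprK (_ : 1 + 1 = 2).
apply: (le_trans (@noisy_map_upper _ pi T hpi hT.2 xi x (fun z => (\1_A z)%:E) xi0 mA1 _)).
  by move=> y; rewrite lee_fin.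
rewrite muleA -EFinM; apply: lee_wpmul2r; first by apply: integral_ge0 => y _; rewrite lee_fin.
rewrite lee_fin /= mulrAC divff ?mul1r//.
Qed.

End noisy_transition.

(** * The Lyapunov exponent *)

Section log_integrals.
Context {R : realType}.
Notation m := (@lebesgue_measure R).

Lemma integral_is_derive (f F : R -> R) (a b : R) : a <= b ->
  (forall x, a <= x <= b -> {for x, continuous f}) ->
  (forall x, a <= x <= b -> is_derive x 1 F (f x)) ->
  (\int[m]_(x in `[a, b]) (f x)%:E = (F b - F a)%:E)%E.
Proof.
rewrite le_eqVlt => /predU1P[<- _ _|ab cf dF].
  by rewrite set_itv1 integral_set1 subrr.
have cF x : a <= x <= b -> {for x, continuous F}.
  move=> /dF dFx; apply: differentiable_continuous; apply/derivable1_diffP.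
  exact: ex_derive.
rewrite EFinB; apply: continuous_FTC2 => //.
- apply: continuous_in_subspaceT => x; rewrite inE/= in_itv/=; exact: cf.
- split.
  + move=> x; rewrite in_itv/= => /andP[ax xb]; apply: ex_derive.
    by apply: dF; rewrite !ltW.
  + by apply: cvg_at_right_filter; apply: cF; rewrite lexx ltW.
  + by apply: cvg_at_left_filter; apply: cF; rewrite lexx ltW.
- move=> x; rewrite in_itv/= => /andP[ax xb]; rewrite derive1E.
  by have /dF[_ ->] : a <= x <= b by rewrite !ltW.
Qed.

Lemma is_derive_continuous (F : R -> R) (x l : R) : is_derive x 1 F l ->
  {for x, continuous F}.
Proof.
move=> dFx; apply: differentiable_continuous; apply/derivable1_diffP.
exact: ex_derive.
Qed.

Lemma integral_Nln01 : (\int[m]_(x in `[0%R, 1%R]) (- ln x)%:E = 1%E)%E.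
Proof.
(* With the lower endpoint [N^-2], the crude bound of [ln N] by [N] already makes the boundary term
   of the primitive [x - x ln x] at most [3 / N]. *)
pose D n := `[(n.+1%:R ^- 2 : R), 1%R]%classic.
have d0 n : 0 < n.+1%:R ^- 2 :> R by rewrite invr_gt0 exprn_gt0.
have d1 n : n.+1%:R ^- 2 <= 1 :> R.
  by rewrite invf_le1 ?exprn_gt0// exprn_ege1// ler1n.
have ID n : (\int[m]_(x in D n) (- ln x)%:E =
    (1 - (n.+1%:R ^- 2 + 2 * n.+1%:R ^- 2 * ln n.+1%:R))%:E)%E.
  transitivity (((1 - 1 * ln 1) - (n.+1%:R ^- 2 - n.+1%:R ^- 2 * ln (n.+1%:R ^- 2)) : R)%:E)%E; last first.
    rewrite ln1 mulr0 subr0 lnV ?posrE ?exprn_gt0// lnXn//; congr EFin.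
    by rewrite -mulr_natl; ring.
  apply: (@integral_is_derive _ (fun x => x - x * ln x)) => //.
  - move=> x /andP[dx _]; apply: cvgN; apply: continuous_ln; exact: lt_le_trans dx.
  - move=> x /andP[dx _]; have x0 : 0 < x by exact: lt_le_trans dx.
    have h1 := is_deriveM (is_derive_id x 1) (is_derive1_ln x0).
    have h2 := is_deriveB (is_derive_id x 1) h1.
    apply: (is_derive_eq h2).
    by rewrite /GRing.scale/= !mulr1 divff ?lt0r_neq0//; ring.
have mln : measurable_fun setT (fun x : R => (- ln x)%:E).
  by apply/measurable_EFinP; exact: (measurable_funN (@measurable_ln R)).
have ndD : nondecreasing_seq D.
  move=> i j ij; apply/subsetPset => x; rewrite /D /= !in_itv/= => /andP[h ->].
  rewrite andbT (le_trans _ h)// lef_pV2 ?posrE ?exprn_gt0//.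
  by rewrite ler_pXn2r ?nnegrE// ler_nat.
have := @ge0_nondecreasing_set_cvg_integral _ (measurableTypeR R) R D (fun x => (- ln x)%:E) m ndD
  (fun i => measurable_itv _) (fun i => measurable_funTS mln).
rewrite (_ : \bigcup_i D i = `]0, 1]%classic); last first.
  rewrite predeqE => x; rewrite /D /= in_itv/=; split.
    by move=> [i _ /=]; rewrite in_itv/= => /andP[h ->]; rewrite (lt_le_trans _ h).
  move=> /andP[x0 x1]; exists (Num.truncn x^-1) => //=; rewrite in_itv/= x1 andbT.
  have x1' : 1 <= x^-1 by rewrite invf_ge1.
  have xn : x^-1 < (Num.truncn x^-1).+1%:R by exact: truncnS_gt.
  rewrite -[leRHS]invrK lef_pV2 ?posrE ?invr_gt0 ?exprn_gt0//.
  rewrite (le_trans (ltW xn))// expr2 ler_peMl// ler1n//.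
rewrite integral_itv_obnd_cbnd; last by apply: measurable_funTS.
move=> H.
have H0 : forall i x, D i x -> (0 <= (- ln x)%:E)%E.
  move=> i x; rewrite /D /= in_itv/= => /andP[_ x1].
  by rewrite lee_fin oppr_ge0 ln_le0.
have {}H : ((1 - (n.+1%:R ^- 2 + 2 * n.+1%:R ^- 2 * ln n.+1%:R) : R)%:E @[n --> \oo] -->
    \int[m]_(x in `[0%R, 1%R]) (- ln x)%:E)%E.
  by rewrite -(funext ID); exact: H.
apply: (cvg_unique _ H) => //.
apply: cvg_EFin; first exact: nearW.
rewrite /comp/= -[X in _ --> X]subr0; apply: cvgB; first exact: cvg_cst.
apply: (@squeeze_cvgr _ _ _ _ (fun=> 0) (fun n => 3 * n.+1%:R^-1)).
- apply: nearW => n; apply/andP; split.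
    apply: addr_ge0; first exact: ltW.
    by apply: mulr_ge0; [apply: mulr_ge0 => //; exact: ltW|rewrite ln_ge0// ler1n].
  have n0 : 0 < n.+1%:R :> R by [].
  have := ln_sublinear n0; rewrite -exprVn; set N := n.+1%:R => lnN.
  have zN : N^-1 * N = 1 by rewrite mulVf ?lt0r_neq0.
  have z1 : N^-1 <= 1 by rewrite invf_le1// ler1n.
  have z0 : 0 < N^-1 by rewrite invr_gt0.
  move: (N^-1) (ln N) zN z1 z0 lnN => z l zN z1 z0 lnN.
  have : z ^+ 2 * l <= z ^+ 2 * N by rewrite ler_wpM2l ?sqr_ge0// ltW.
  have -> : z ^+ 2 * N = z by rewrite expr2 -mulrA zN mulr1.
  nra.
- exact: cvg_cst.
- rewrite -[X in _ --> X](mulr0 3); apply: cvgM; first exact: cvg_cst.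
  exact: cvg_harmonic.
Qed.

End log_integrals.

(** * Truncation and continuity of the mean of [- ln |X|] *)

Section negative_log.
Context {R : realType}.
Notation m := (@lebesgue_measure R).
Notation X := (measurableTypeR R).

(* [nlog 0 = 0], as [ln 0 = 0]. *)
Definition nlog (x : R) : R := - ln `|clamp x|.

Lemma nlog_ge0 x : 0 <= nlog x.
Proof. by rewrite oppr_ge0 ln_le0// clamp_norm. Qed.

Lemma measurable_nlog : measurable_fun setT nlog.
Proof.
apply: measurable_funN; apply: (measurableT_comp (@measurable_ln R)).
exact: (measurableT_comp (@normr_measurable R setT) measurable_clamp).
Qed.

Lemma ge0_integral_even (f : R -> \bar R) : measurable_fun setT f ->
  (forall x, 0 <= f x)%E -> (forall x, f (- x) = f x) ->
  (\int[m]_(x in `[(-1)%R, 1%R]) f x = 2%:E * \int[m]_(x in `[0%R, 1%R]) f x)%E.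
Proof.
move=> mf f0 fe.
rewrite (@itv_bndbnd_setU _ _ _ (BLeft 0%R)); last 2 first.
- by rewrite bnd_simp; lra.
- by rewrite bnd_simp; lra.
rewrite ge0_integral_setU//=; last 2 first.
- exact: measurable_funTS.
- by apply/disj_setPS => z [/=]; rewrite !in_itv/=; lra.
rewrite [X in (X + _)%E](_ : _ = \int[m]_(x in `[0%R, 1%R]) f x)%E.
  by rewrite -mule2n mule_natl.
rewrite -[RHS]integral_itv_obnd_cbnd; last exact: measurable_funTS.
rewrite -[RHS]ge0_integral_opp//.
rewrite (_ : [set x | `]0%R, 1%R]%classic (- x)%R] = `[(-1)%R, 0%R[%classic).
  by apply: eq_integral => x _; rewrite fe.
by rewrite predeqE => x /=; rewrite !in_itv/=; split; lra.
Qed.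

Lemma bmf_min_nlog M : 0 <= M -> bmf (fun x : X => Num.min (nlog x) M).
Proof.
move=> M0; split; first by apply: measurable_minr => //; exact: measurable_nlog.
exists M => x; rewrite ger0_norm ?ge_min ?lexx ?orbT//.
by rewrite le_min nlog_ge0.
Qed.

(** On [|x| <= exp (- M)] the excess of [- ln |x|] over [M] is [- ln |exp M * x|]; rescaling leaves
    [exp (- M)] times the full integral. *)
Lemma integral_nlog_tail (M : R) : 0 <= M ->
  (\int[m]_(x in `[(-1)%R, 1%R]) (Num.max (nlog x - M) 0)%:E = (2 * expR (- M))%:E)%E.
Proof.
move=> M0; have mt : measurable_fun setT (fun x => (Num.max (nlog x - M) 0)%:E).
  apply/measurable_EFinP; apply: measurable_maxr => //.
  by apply: measurable_funB => //; exact: measurable_nlog.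
have E0 := expR_gt0 M; have E0' := expR_gt0 (- M).
have E1 : expR (- M) <= 1 by rewrite expR_le1 oppr_le0.
rewrite (_ : (2 * expR (- M))%:E = (2%:E * (expR (- M))%:E)%E)//.
have -> : (\int[m]_(x in `[(-1)%R, 1%R]) (Num.max (nlog x - M) 0)%:E)%E =
    (\int[m]_(x in `[(-1)%R, 1%R]) (Num.max (- ln `|x| - M) 0)%:E)%E.
  apply: eq_integral => x; rewrite inE/= in_itv/= -ler_norml => x1.
  by rewrite /nlog clamp_id.
have mt' : measurable_fun setT (fun x : R => (Num.max (- ln `|x| - M) 0)%:E).
  apply/measurable_EFinP; apply: measurable_maxr => //.
  apply: measurable_funB => //; apply: measurable_funN.
  apply: (measurableT_comp (@measurable_ln R)); exact: normr_measurable.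
rewrite ge0_integral_even//; last 2 first.
- by move=> x; rewrite lee_fin le_max lexx orbT.
- by move=> x; rewrite normrN.
congr (_ * _)%E.
transitivity (\int[m]_(x in `[0%R, expR (- M)]) (nlog (expR M * x + 0))%:E)%E.
  rewrite (@itv_bndbnd_setU _ _ _ (BRight (expR (- M)))); [|by rewrite bnd_simp ltW|by rewrite bnd_simp].
  rewrite ge0_integral_setU//=; last 3 first.
  - exact: measurable_funTS.
  - by move=> x _; rewrite lee_fin le_max lexx orbT.
  - by apply/disj_setPS => z [/=]; rewrite !in_itv/=; lra.
  rewrite [X in (_ + X)%E](_ : _ = 0%E) ?adde0.
    apply: eq_integral => x; rewrite inE/= in_itv/= addr0 => /andP[x0 x1].
    have Ex1 : expR M * x <= 1 by rewrite mulrC -ler_pdivlMr// div1r -expRN.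
    have Ex0 : 0 <= expR M * x by rewrite mulr_ge0// ltW.
    rewrite /nlog clamp_id ?ger0_norm//; move: Ex1 Ex0; move: x0; rewrite le_eqVlt => /predU1P[<-|x0].
      (* At the origin both sides vanish by the convention [ln 0 = 0]. *)
      by rewrite mulr0 ln0// oppr0 add0r max_r// oppr_le0.
    move=> /ln_le0 + _; rewrite lnM ?posrE// expRK => ?; rewrite max_l; first by congr EFin; lra.
    lra.
  rewrite -[RHS](@integral0 _ _ _ m `]expR (- M), 1%R]); apply: eq_integral => x.
  rewrite inE/= in_itv/= => /andP[x0 x1]; have x00 : 0 < x by exact: lt_trans x0.
  rewrite gtr0_norm// max_r// lerBlDr add0r lerNl -(expRK (- M)) ler_ln ?posrE//.
  exact: ltW.
have S : [set x | `[0%R, 1%R]%classic (expR M * x + 0)%R] = `[0%R, expR (- M)]%classic.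
  rewrite predeqE => x /=; rewrite !in_itv/= addr0 pmulr_rge0//.
  rewrite expRN; have -> // : (x <= (expR M)^-1) = (expR M * x <= 1).
  by rewrite -[(expR M)^-1]mulr1 ler_pdivlMl.
have mn : measurable_fun setT (fun x => (nlog x)%:E).
  by apply/measurable_EFinP; exact: measurable_nlog.
have := @ge0_integral_affine _ (expR M) 0 `[0%R, 1%R]%classic (fun x => (nlog x)%:E)
  E0 (measurable_itv _) mn.
rewrite S => H; apply: (etrans (H _)); first by move=> x; rewrite lee_fin nlog_ge0.
rewrite expRN -[RHS]mule1 -integral_Nln01; congr (_ * _)%E.
apply: eq_integral => x; rewrite inE/= in_itv/= => /andP[x0 x1].
by rewrite /nlog clamp_id ger0_norm.
Qed.

Lemma integral_nlog : (\int[m]_(x in `[(-1)%R, 1%R]) (nlog x)%:E = 2%:E)%E.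
Proof.
have := integral_nlog_tail (lexx 0); rewrite oppr0 expR0 mulr1 => <-.
by apply: eq_integral => x _ /=; congr EFin; have := nlog_ge0 x; move: (nlog x) => z z0; rewrite addr0 max_l.
Qed.

Variables (pi : R -> R).
Hypothesis (hpi : boundary_condition pi).
Notation stat T xi mu := (stationary (@noise R) (noisy_map pi T xi) mu).

(** A stationary measure is its own law after one step, and one step of noise has bounded
    density. *)
Lemma stationary_dominated T xi (mu : probability X R) (f : R -> \bar R) :
  selfmap T -> 0 < xi -> stat T xi mu -> measurable_fun setT f ->
  (forall x, 0 <= f x)%E ->
  (\int[mu]_x f x <= (4 + 4 / xi)%:E * \int[m]_(x in `[(-1)%R, 1%R]) f x)%E.
Proof.
move=> hT xi0 smu mf f0; have mphi := measurable_noisy_map hpi hT.1 xi.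
have mf' : measurable_fun [set: X] f by [].
rewrite -(ge0_stationary_integral mphi smu mf' f0).
rewrite -[leRHS](mule1) -(probability_setT mu) -integral_cst//.
apply: ge0_le_integral => //.
- by move=> x _; apply: integral_ge0.
- apply: (@measurable_fun_fubini_tonelli_F _ _ _ _ _ (@noise R)
   (fun z => f (noisy_map pi T xi z))) => //.
  exact: (measurableT_comp mf' mphi).
- by move=> x _; exact: (noisy_map_upper hpi hT.2 x xi0 mf f0).
Qed.

Lemma stationary_has_density T xi (mu : probability X R) :
  selfmap T -> 0 < xi -> stat T xi mu -> exists f, has_density f mu.
Proof.
move=> hT xi0 smu.
have domi : mu `<< m.
  apply/null_content_dominatesP => A mA A0.
  have mA1 : measurable_fun setT (fun z : X => (\1_A z : R)%:E).
    by apply/measurable_EFinP; exact: measurable_indic.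
  suff H : (mu A <= 0)%E by apply/eqP; rewrite -measure_le0.
  have -> : mu A = (\int[mu]_x (\1_A x)%:E)%E by rewrite integral_indic// setIT.
  apply: (le_trans (stationary_dominated hT xi0 smu mA1 _)).
    by move=> x; rewrite lee_fin.
  rewrite integral_indic// (@subset_measure0 _ _ _ m _ A) ?mule0//.
  exact: measurableI.
pose f := Radon_Nikodym_SigmaFinite.f mu m.
have ff x : f x \is a fin_num by exact: Radon_Nikodym_SigmaFinite.f_fin_num.
have f0 x : (0 <= f x)%E by exact: Radon_Nikodym_SigmaFinite.f_ge0.
exists (fine \o f); split.
- apply: (measurableT_comp (fine_measurable measurableT)).
  by have /integrableP[] := Radon_Nikodym_SigmaFinite.f_integrable domi.
- by move=> x; exact: fine_ge0.
- move=> A mA; rewrite (Radon_Nikodym_SigmaFinite.f_integral domi mA).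
  by apply: eq_integral => x _; rewrite /= fineK.
Qed.

Definition mean_nlog (mu : probability X R) : R := \int[mu]_x nlog x.

(** The truncation is bounded, hence accessible to the perturbation estimates, and its cost is
    uniform over stationary measures as long as [xi] stays away from 0. *)
Lemma mean_nlog_truncate T xi (mu : probability X R) M :
  selfmap T -> 0 < xi -> stat T xi mu -> 0 <= M ->
  (\int[mu]_x (nlog x)%:E = (mean_nlog mu)%:E)%E /\
  \int[mu]_x Num.min (nlog x) M <= mean_nlog mu <=
  \int[mu]_x Num.min (nlog x) M + (4 + 4 / xi) * (2 * expR (- M)).
Proof.
move=> hT xi0 smu M0.
have mn : measurable_fun setT (fun x : X => (nlog x)%:E).
  by apply/measurable_EFinP; exact: measurable_nlog.
have n0 (x : X) : (0 <= (nlog x)%:E)%E by rewrite lee_fin nlog_ge0.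
have fin : (\int[mu]_x (nlog x)%:E < +oo)%E.
  rewrite (le_lt_trans (stationary_dominated hT xi0 smu mn n0))//.
  by rewrite integral_nlog -EFinM ltry.
have inn : mu.-integrable setT (EFin \o nlog).
  apply/integrableP; split => //.
  by under eq_integral do rewrite /= ger0_norm ?nlog_ge0//.
have E : (\int[mu]_x (nlog x)%:E = (mean_nlog mu)%:E)%E.
  by rewrite /mean_nlog /Rintegral fineK// ge0_fin_numE// integral_ge0.
split=> //.
have bmin := bmf_min_nlog M0.
have imin := bmf_integrable mu bmin.
have mt : measurable_fun setT (fun x : X => (Num.max (nlog x - M) 0)%:E).
  apply/measurable_EFinP; apply: measurable_maxr => //.
  by apply: measurable_funB => //; exact: measurable_nlog.
have t0 (x : X) : (0 <= (Num.max (nlog x - M) 0)%:E)%E.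
  by rewrite lee_fin le_max lexx orbT.
have it := stationary_dominated hT xi0 smu mt t0.
rewrite integral_nlog_tail// -EFinM in it.
have itn : mu.-integrable setT (EFin \o (fun x => Num.max (nlog x - M) 0)).
  apply/integrableP; split => //.
  under eq_integral do rewrite /= ger0_norm ?le_max ?lexx ?orbT//.
  by apply: le_lt_trans it _; rewrite ltry.
apply/andP; split.
  by apply: le_Rintegral => // x _; rewrite ge_min lexx.
have -> : mean_nlog mu = \int[mu]_x (Num.min (nlog x) M + Num.max (nlog x - M) 0).
  apply: eq_Rintegral => x _; have [nM|nM] := leP (nlog x) M.
    by rewrite max_r ?addr0// subr_le0.
  by rewrite max_l ?subr_ge0 1?ltW// addrC subrK.
rewrite RintegralD// lerD2l -lee_fin /Rintegral fineK//.
exact: (integrable_fin_num measurableT itn).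
Qed.

Lemma mean_nlog_continuity T xi N c xi0 (mu : probability X R) e :
  selfmap T -> 0 < xi0 -> xi0 <= xi -> 0 < c < 1 ->
  contracting (@noise R) (noisy_map pi T xi) N c -> stat T xi mu -> 0 < e ->
  exists2 d, 0 < d & forall T' xi' (mu' : probability X R), selfmap T' ->
    xi0 <= xi' -> (forall x, `|x| <= 1 -> `|T x - T' x| <= d) ->
    `|xi - xi'| <= d -> stat T' xi' mu' -> `|mean_nlog mu - mean_nlog mu'| <= e.
Proof.
move=> hT xi00 xi0xi c01 cc smu e0.
have xip : 0 < xi by exact: lt_le_trans xi0xi.
pose C := 2 * (4 + 4 / xi0); have C0 : 0 < C.
  by rewrite mulr_gt0// addr_gt0// divr_gt0.
have [M M1 CM] : exists2 M, 1 <= M & C * expR (- M) <= e / 4.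
  exists (1 + `|ln (4 * C / e)|); first by rewrite lerDl.
  have h0 : 0 < 4 * C / e by rewrite divr_gt0// mulr_gt0.
  rewrite mulrC -ler_pdivlMr// -[leRHS]lnK ?posrE ?divr_gt0// ler_expR.
  have -> : e / 4 / C = (4 * C / e)^-1 by field; rewrite !lt0r_neq0.
  rewrite lnV ?posrE// lerN2.
  by rewrite (le_trans (ler_norm _))// lerDr.
have M0 : 0 < M by exact: lt_le_trans M1.
have e8 : 0 < e / (16 * M) by rewrite divr_gt0// mulr_gt0.
have mphi := measurable_noisy_map hpi hT.1 xi.
have [K cK] := contracting_cvg mphi c01 cc e8.
(* Budget after multiplication by [M]: the oscillation contributes [2 M e / (16 M) = e / 8] and the
   [K] perturbed steps, each at most [3 d / xi], another [e / 8]. Truncation costs at most [e / 4]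
   for either measure. *)
have d0 : 0 < e * xi / (24 * M * K.+1%:R).
  by rewrite divr_gt0 ?mulr_gt0.
exists (e * xi / (24 * M * K.+1%:R)) => // T' xi' mu' hT' xi0xi' TT' xixi' smu'.
have xip' : 0 < xi' by exact: lt_le_trans xi0xi'.
set d := e * xi / _ in d0 TT' xixi'.
have [_ /andP[l1 l2]] := mean_nlog_truncate hT xip smu (ltW M0).
have [_ /andP[l1' l2']] := mean_nlog_truncate hT' xip' smu' (ltW M0).
have tl x : xi0 <= x -> (4 + 4 / x) * (2 * expR (- M)) <= e / 4.
  move=> x0; apply: le_trans CM; rewrite /C mulrCA mulrA ler_wpM2r ?expR_ge0//.
  rewrite ler_pM2l// lerD2l ler_pM2l// lef_pV2 ?posrE//.
  exact: lt_le_trans x0.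
pose g (x : X) : R := M^-1 * Num.min (nlog x) M.
have bmin := bmf_min_nlog (ltW M0).
have bg : bmf g by exact: bmfZ.
have g01 x : 0 <= g x <= 1.
  rewrite /g mulr_ge0 ?invr_ge0 ?(ltW M0) ?le_min ?nlog_ge0 ?(ltW M0)//=.
  by rewrite mulrC ler_pdivrMr// mul1r ge_min lexx orbT.
have mphi' := measurable_noisy_map hpi hT'.1 xi'.
have pert := fun h bh h01 x => @transition_noisy_perturbation _ pi hpi T T' xi xi' d h x
  hT hT' xip xip' TT' bh h01.
have := stationary_perturbation mphi mphi' smu smu' pert bg g01 (cK g bg g01).
rewrite /g !RintegralZl//; [|exact: bmf_integrable..].
rewrite -mulrBr normrM gtr0_norm ?invr_gt0// mulrC ler_pdivrMr//.
set I := \int[mu]_x _; set I' := \int[mu']_x _ => II'.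
have : `|I - I'| <= e / 4.
  apply: le_trans II' _.
  have h : (d + 2 * `|xi - xi'|) / xi <= 3 * d / xi.
    by rewrite ler_pM2r ?invr_gt0//; lra.
  have : K%:R * ((d + 2 * `|xi - xi'|) / xi) <= K.+1%:R * (3 * d / xi).
    apply: ler_pM => //; last by rewrite ler_nat.
    apply: mulr_ge0; last by rewrite invr_ge0 ltW.
    by apply: addr_ge0; [exact: ltW|exact: mulr_ge0].
  have -> : K.+1%:R * (3 * d / xi) = e / (8 * M).
    by rewrite /d; field; rewrite !lt0r_neq0.
  move=> h2; have -> : e / 4 = (2 * (e / (16 * M)) + e / (8 * M)) * M.
    by field; rewrite lt0r_neq0.
  by rewrite ler_pM2r// lerD2l.
have := tl _ xi0xi; have := tl _ xi0xi'.
move: l1 l2 l1' l2'; rewrite -/I -/I' => l1 l2 l1' l2'.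
move: ((4 + 4 / xi) * _) l2 => A l2; move: ((4 + 4 / xi') * _) l2' => A' l2'.
rewrite !ler_norml => t1 t2 /andP[i1 i2]; apply/andP; split; lra.
Qed.

End negative_log.

(** * The unimodal family and its Lyapunov exponent *)

Section unimodal.
Context {R : realType}.
Notation m := (@lebesgue_measure R).
Notation X := (measurableTypeR R).
Implicit Types (a b x u : R).

Lemma powR_itv01 a u : 0 < a -> 0 <= u <= 1 -> 0 <= u `^ a <= 1.
Proof.
move=> a0 /andP[u0 u1]; rewrite powR_ge0/=.
have : u `^ a <= 1 `^ a by apply: ge0_ler_powR; rewrite ?nnegrE// ltW.
by rewrite powR1.
Qed.

Lemma unimodal_selfmap a b : 0 < a -> 0 < b <= 1 -> selfmap (unimodal_map a b).
Proof.
move=> a0 /andP[b0 b1]; split.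
  apply: measurable_funB => //; apply: measurable_funM => //.
  apply: (measurableT_comp (@measurable_powR R a)); exact: normr_measurable.
move=> x x1; have /andP[p0 p1] : 0 <= `|x| `^ a <= 1.
  by apply: powR_itv01 => //; rewrite normr_ge0.
rewrite /unimodal_map ler_norml; apply/andP; split; nra.
Qed.

Lemma unimodal_beta_dist a b x : 0 < a -> b <= 1 -> `|x| <= 1 ->
  `|unimodal_map a b x - unimodal_map a 1 x| <= 2 * (1 - b).
Proof.
move=> a0 b1 x1; have /andP[p0 p1] : 0 <= `|x| `^ a <= 1.
  by apply: powR_itv01 => //; rewrite normr_ge0.
rewrite /unimodal_map ger0_norm; nra.
Qed.

Lemma is_derive_unimodal a b x : x != 0 ->
  is_derive x 1 (unimodal_map a b) (- (2 * b * a * Num.sg x * `|x| `^ (a - 1))).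
Proof.
move=> x0; have [x_gt0|x_lt0|xE] := ltrgtP x 0; last by rewrite xE eqxx in x0.
  apply: (@near_eq_is_derive _ _ _ (fun y => 1 - 2 * b * (- y) `^ a)).
    near=> y; rewrite /unimodal_map ltr0_norm//; near: y.
    exact: lt_nbhsl.
  have Nx0 : 0 < - x by rewrite oppr_gt0.
  have h1 := @is_derive1_comp _ (fun u => u `^ a) -%R x _ _
    (is_derive1_powR a Nx0) (is_deriveN (is_derive_id x 1)).
  have h2 := is_deriveB (is_derive_cst (1 : R) x 1) (is_deriveZ (2 * b) h1).
  apply: (is_derive_eq h2); rewrite /GRing.scale/= ltr0_sg// ltr0_norm//; ring.
apply: (@near_eq_is_derive _ _ _ (fun y => 1 - 2 * b * y `^ a)).
  near=> y; rewrite /unimodal_map gtr0_norm//; near: y.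
  exact: lt_nbhsr.
have h2 := is_deriveB (is_derive_cst (1 : R) x 1) (is_deriveZ (2 * b) (is_derive1_powR a x_lt0)).
apply: (is_derive_eq h2); rewrite /GRing.scale/= gtr0_sg// gtr0_norm//; ring.
Unshelve. all: by end_near. Qed.

Variables (pi : R -> R).
Hypothesis (hpi : boundary_condition pi).
Notation stat T xi mu := (stationary (@noise R) (noisy_map pi T xi) mu).

Lemma lyapunov_exponentE a b xi (mu : probability X R) :
  1 < a -> 0 < b <= 1 -> 0 < xi -> stat (unimodal_map a b) xi mu ->
  lyapunov_exponent (unimodal_map a b) mu =
  (ln (2 * b * a) - (a - 1) * mean_nlog mu)%:E.
Proof.
move=> a1 b01 xi0 smu; have /andP[b0 b1] := b01.
have a0 : 0 < a by exact: lt_trans a1.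
have hT := unimodal_selfmap a0 b01.
have muS : mu phase_space = 1%E.
  by have [] := (stationary_measureP hpi hT.1 hT.2 mu xi0).2 smu.
have mS : measurable (phase_space : set X) by exact: measurable_itv.
have mn : measurable_fun setT (fun x : X => ln (2 * b * a) - (a - 1) * nlog x).
  by apply: measurable_funB => //; apply: measurable_funM => //; exact: measurable_nlog.
have n0 (x : X) : (0 <= (nlog x)%:E)%E by rewrite lee_fin nlog_ge0.
have [E _] := mean_nlog_truncate hpi hT xi0 smu (lexx 0).
have inn : mu.-integrable setT (EFin \o nlog).
  apply/integrableP; split.
    by apply/measurable_EFinP; exact: measurable_nlog.
  by under eq_integral do rewrite /= ger0_norm ?nlog_ge0//; rewrite E ltry.
pose Z : set X := [set (0 : R)].
have mZ : measurable Z by exact: (@measurable_set1 R 0).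
have mu0 : mu Z = 0%E.
  have mA1 : measurable_fun setT (fun z : X => (\1_Z z : R)%:E).
    by apply/measurable_EFinP; exact: measurable_indic.
  suff H : (mu Z <= 0)%E by apply/eqP; rewrite -measure_le0.
  have -> : mu Z = (\int[mu]_x (\1_Z x)%:E)%E by rewrite integral_indic// setIT.
  apply: (le_trans (stationary_dominated hpi hT xi0 smu mA1 _)).
    by move=> x; rewrite lee_fin.
  rewrite integral_indic// (@subset_measure0 _ _ _ m _ Z) ?mule0//.
  - exact: measurableI.
  - exact: lebesgue_measure_set1.
rewrite /lyapunov_exponent.
(* The formula for [ln |T'|] holds off the critical point; [h] isolates that point, which is
   [mu]-null because [mu] is dominated by Lebesgue measure. *)
pose h (x : X) : \bar R := if x == 0 :> R then lne (`|derive1 (unimodal_map a b) 0|)%:E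
  else (ln (2 * b * a) - (a - 1) * nlog x)%:E.
transitivity (\int[mu]_(x in phase_space) h x)%E.
  apply: eq_integral => x; rewrite inE /phase_space/= in_itv/= -ler_norml => x1.
  rewrite /h; case: eqVneq => [->//|x0].
  have [_] := is_derive_unimodal a b x0; rewrite -derive1E => ->.
  have nx0 : 0 < `|x| by rewrite normr_gt0.
  have ba0 : 0 < 2 * b * a by rewrite !mulr_gt0.
  rewrite (_ : `|_| = 2 * b * a * `|x| `^ (a - 1)); last first.
    by rewrite normrN 2!normrM normr_sg x0 mulr1 (ger0_norm (powR_ge0 _ _)) gtr0_norm.
  have p0 : 0 < 2 * b * a * `|x| `^ (a - 1) by rewrite mulr_gt0// powR_gt0.
  rewrite /= leNgt p0/=.
  by rewrite lnM ?posrE ?powR_gt0// ln_powR /nlog clamp_id// mulrN opprK.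
have muSc : mu (~` phase_space) = 0%E by rewrite probability_setC// muS subee.
transitivity (\int[mu]_x (ln (2 * b * a) - (a - 1) * nlog x)%:E)%E.
  rewrite integral_mkcond; apply: ae_eq_integral => //.
  - apply/(measurable_restrictT h) => //; apply: measurable_funTS.
    apply: (@measurable_fun_ifT _ _ X _ (cst _) (fun x => (ln (2 * b * a) - (a - 1) * nlog x)%:E) (fun x : X => x == 0 :> R)) => //.
    + by apply: measurable_fun_eqr.
    + exact/measurable_EFinP.
  - exact/measurable_EFinP.
  - exists (Z `|` ~` phase_space); split.
    + by apply: measurableU => //; exact: measurableC.
    + by rewrite measureU0//; exact: measurableC.
    + move=> x /= H; apply: contrapT => H'; apply: H => _.
      rewrite patchE mem_set /h; last by apply: contrapT => xS; apply: H'; right.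
      by case: eqVneq => // x0; case: H'; left.
rewrite -[LHS]fineK; last first.
  apply: (integrable_fin_num measurableT).
  apply: (@integrableB _ _ _ mu setT measurableT (cst (ln (2 * b * a))%:E) (fun x => ((a - 1) * nlog x)%:E)).
    exact: (bmf_integrable mu (bmf_cst _ _)).
  exact: (integrableZl measurableT (a - 1) inn).
congr EFin; rewrite -[LHS]/(\int[mu]_x (ln (2 * b * a) - (a - 1) * nlog x)).
rewrite RintegralB//; last 2 first.
- exact: (bmf_integrable mu (bmf_cst _ _)).
- exact: (integrableZl measurableT (a - 1) inn).
by rewrite Rintegral_probability_cst RintegralZl.
Qed.

Lemma mean_nlog_full_noise T (mu : probability X R) : selfmap T ->
  stat T 2 mu -> mean_nlog mu = 1.
Proof.
move=> hT smu; have mphi := measurable_noisy_map hpi hT.1 2.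
have mn : measurable_fun setT (fun x : X => (nlog x)%:E).
  by apply/measurable_EFinP; exact: measurable_nlog.
have n0 (x : X) : (0 <= (nlog x)%:E)%E by rewrite lee_fin nlog_ge0.
rewrite /mean_nlog /Rintegral -(ge0_stationary_integral mphi smu mn n0).
rewrite -[RHS]/(fine 1%E); congr fine.
transitivity (\int[mu]_x cst 1 x)%E; last first.
  by rewrite integral_cst// mul1e; exact: probability_setT.
apply: eq_integral => x _.
by rewrite (noisy_map_full hpi hT.2 x mn n0) integral_nlog -EFinM mulVf.
Qed.

End unimodal.

(** * Uniform contraction *)

Section expansion.
Context {R : realType}.
Notation m := (@lebesgue_measure R).
Implicit Types (a b u x y g e r : R).

(** Young's inequality for the product [x * 1] with the exponents [a] and [a / (a - 1)]. *)
Lemma powR_bernoulli a x : 1 < a -> 0 <= x -> 1 + a * (x - 1) <= x `^ a.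
Proof.
move=> a1 x0; have a0 : 0 < a by exact: lt_trans a1.
have ac : a^-1 + (a / (a - 1))^-1 = 1.
  by rewrite invf_div; field; rewrite lt0r_neq0//= lt0r_neq0// subr_gt0.
have := conjugate_powR x0 (@ler01 R) a0 _ ac.
rewrite powR1 mulr1 invf_div => /(_ _).
rewrite divr_gt0 ?subr_gt0// => /(_ isT) h.
have : x * a <= x `^ a + (a - 1).
  have -> : x `^ a + (a - 1) = (x `^ a / a + 1 * ((a - 1) / a)) * a.
    by field; rewrite lt0r_neq0.
  by rewrite ler_pM2r.
lra.
Qed.

Lemma powR_lipschitz a x y : 1 < a -> 0 <= x <= 1 -> 0 <= y <= 1 ->
  `|x `^ a - y `^ a| <= a * `|x - y|.
Proof.
move=> a1; have a0 : 0 < a by exact: lt_trans a1.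
wlog xy : x y / y <= x.
  move=> H hx hy; have [|/ltW] := leP y x; first by move=> yx; exact: H.
  by move=> xy; rewrite distrC (distrC x); exact: H.
move=> /andP[x0 x1] /andP[y0 y1].
have yxa : y `^ a <= x `^ a by apply: ge0_ler_powR; rewrite ?nnegrE// ltW.
rewrite !ger0_norm ?subr_ge0//.
have [xE|xn0] := eqVneq x 0.
  have -> : y = 0 by apply/le_anti; rewrite y0 andbT -xE.
  by rewrite xE !subrr mulr0.
have xp : 0 < x by rewrite lt_neqAle eq_sym xn0.
have yx0 : 0 <= y / x by rewrite divr_ge0.
have := powR_bernoulli a1 yx0.
have -> : y `^ a = x `^ a * (y / x) `^ a by rewrite -powRM// mulrC divfK.
have xax : x `^ a = x * x `^ (a - 1) by rewrite mulr_powRB1.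
have /andP[p0 p1] : 0 <= x `^ (a - 1) <= 1 by apply: powR_itv01; rewrite ?subr_gt0// x0.
move: ((y / x) `^ a) => s hs.
have : x `^ a * (1 - s) <= x `^ a * (a * (1 - y / x)).
  by rewrite ler_wpM2l ?powR_ge0//; lra.
rewrite mulrBr mulr1 => h; apply: (le_trans h).
rewrite xax; have -> : x * x `^ (a - 1) * (a * (1 - y / x)) = x `^ (a - 1) * (a * (x - y)).
  by field; rewrite lt0r_neq0.
by rewrite ler_piMl// mulr_ge0 ?(ltW a0)// subr_ge0.
Qed.

Lemma unimodal_lipschitz a x y : 1 < a -> `|x| <= 1 -> `|y| <= 1 ->
  `|unimodal_map a 1 x - unimodal_map a 1 y| <= 2 * a * `|x - y|.
Proof.
move=> a1 x1 y1; rewrite /unimodal_map mulr1.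
have -> : 1 - 2 * `|x| `^ a - (1 - 2 * `|y| `^ a) = - (2 * (`|x| `^ a - `|y| `^ a)) by ring.
rewrite normrN normrM ger0_norm// -mulrA ler_pM2l//.
apply: (le_trans (powR_lipschitz a1 _ _)); rewrite ?normr_ge0//.
by rewrite ler_pM2l ?ler_dist_dist// (lt_trans _ a1).
Qed.

(** Bernoulli's inequality at [u ^+ 2] with the exponent [a / 2], which exceeds 1. *)
Lemma one_minus_powR_le a u : 2 < a -> 0 <= u <= 1 ->
  1 - u `^ a <= a / 2 * (1 - u ^+ 2).
Proof.
move=> a2 /andP[u0 u1]; have a21 : 1 < a / 2 by rewrite ltr_pdivlMr// mul1r.
have := powR_bernoulli a21 (sqr_ge0 u).
rewrite -powR_mulrn// -powRrM.
have -> : 2%:R * (a / 2) = a by field.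
lra.
Qed.

(* [weight] compensates the contraction near the critical point 0: with [1 - 1/a <= g < 1] the map
   1 - 2 |x|^a expands the metric dx / weight off a neighbourhood of 0 of radius of order e^(1/a). *)
Definition weight g e x := (1 - x ^+ 2 + e) `^ g.

Lemma exponent_gt0 a g : 2 < a -> 1 - a^-1 <= g -> 0 < g.
Proof.
move=> a2; apply: lt_le_trans.
by rewrite subr_gt0 invf_lt1 ?(lt_trans _ a2)// ltr1n.
Qed.

(** With [p = u^a] one has [1 - (T u)^2 = 4 p (1 - p) <= 2 a p (1 - u^2)]. The regularisation [e] is
    absorbed by the factor [1 + 1/(2r)]: by [2 a p e] if [2 a p >= 1], and otherwise by means of
    [r e <= p]. Raising to the power [g] produces [(2a)^(g - 1)], the gain, and [u^(a g)], which is
    at most the [u^(a - 1)] of the derivative because [g >= 1 - 1/a]. *)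
Lemma unimodal_expansion a g e r u : 2 < a -> 1 - a^-1 <= g -> g < 1 -> 0 < e -> 0 < r ->
  0 <= u <= 1 -> r * e <= u `^ a ->
  weight g e (unimodal_map a 1 u) <=
  (2 * a) `^ (g - 1) * (1 + (2 * r)^-1) * (2 * a * u `^ (a - 1)) * weight g e u.
Proof.
move=> a2 ga g1 e0 r0 u01 rep; have /andP[u0 u1] := u01.
have a0 : 0 < a by exact: lt_trans a2.
have g0 := exponent_gt0 a2 ga.
have h1 := one_minus_powR_le a2 u01.
have := powR_itv01 a0 u01; set p := u `^ a in rep h1 * => /andP[p0 p1].
rewrite /weight /unimodal_map mulr1 (ger0_norm u0) -/p.
have -> : 1 - (1 - 2 * p) ^+ 2 + e = 4 * p * (1 - p) + e by ring.
set s := 1 - u ^+ 2 in h1 *.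
have s0 : 0 <= s by rewrite subr_ge0 expr_le1.
have se0 : 0 < s + e by rewrite ltr_wpDl.
have K : 4 * p * (1 - p) + e <= 2 * a * p * (1 + (2 * r)^-1) * (s + e).
  have r20 : 0 < (2 * r)^-1 by rewrite invr_gt0 mulr_gt0.
  have rr : (2 * r)^-1 * (2 * r) = 1 by rewrite mulVf// lt0r_neq0// mulr_gt0.
  move: ((2 * r)^-1) rr r20 => z rr z0.
  have b1 : 4 * p * (1 - p) <= 2 * a * p * s.
    have -> : 2 * a * p * s = 4 * p * (a / 2 * s) by field.
    by rewrite ler_wpM2l// mulr_ge0.
  have ap0 : 0 <= 2 * a * p by rewrite !mulr_ge0// ltW.
  have apz : 0 <= 2 * a * p * z by rewrite mulr_ge0// ltW.
  have h0 : 0 <= 2 * a * p * z * (s + e) by rewrite mulr_ge0// ltW.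
  have [ap|ap] := leP 1 (2 * a * p).
    have : e <= 2 * a * p * e by rewrite ler_peMl// ltW.
    lra.
  (* below the threshold [2 a p < 1] one has [s >= 1 / a] *)
  have as1 : 1 <= a * s.
    have : 2 * p <= 1 by nra.
    by move: h1; lra.
  have : e <= 2 * a * p * z * s.
    have : e <= 2 * p * z.
      have : r * e * (2 * z) <= p * (2 * z) by rewrite ler_wpM2r// mulr_ge0// ltW.
      have -> : r * e * (2 * z) = (z * (2 * r)) * e by ring.
      rewrite rr.
      lra.
    move=> h; apply: (le_trans h).
    have -> : 2 * a * p * z * s = (2 * p * z) * (a * s) by ring.
    by rewrite ler_peMr// !mulr_ge0// ltW.
  have : 0 <= 2 * a * p * z * e by rewrite mulr_ge0// ltW.
  have : 0 <= 2 * a * p * e by rewrite mulr_ge0// ltW.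
  lra.
apply: (@le_trans _ _ ((2 * a * p * (1 + (2 * r)^-1) * (s + e)) `^ g)).
  apply: ge0_ler_powR; rewrite ?nnegrE ?(ltW g0)//.
    by rewrite addr_ge0 ?(ltW e0)// mulr_ge0 ?subr_ge0// mulr_ge0.
  by rewrite !mulr_ge0 ?(ltW a0) ?(ltW se0)// addr_ge0// invr_ge0 mulr_ge0 ?ltW.
have z0 : 0 <= (2 * r)^-1 by rewrite invr_ge0 mulr_ge0 ?ltW.
rewrite powRM ?(ltW se0)//; last by rewrite !mulr_ge0 ?(ltW a0)// addr_ge0.
rewrite ler_wpM2r ?powR_ge0// powRM; last 2 first.
- by rewrite !mulr_ge0 ?(ltW a0).
- by rewrite addr_ge0.
rewrite [leRHS]mulrAC; apply: ler_pM; rewrite ?powR_ge0//; last first.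
  by apply: ler1_powR; [rewrite lerDl|exact: ltW].
rewrite powRM ?mulr_ge0 ?(ltW a0)//.
have -> : (2 * a) `^ g = (2 * a) `^ (g - 1) * (2 * a).
  by rewrite [RHS]mulrC mulr_powRB1// mulr_ge0// ltW.
rewrite -mulrA ler_wpM2l ?powR_ge0// ler_wpM2l ?mulr_ge0 ?(ltW a0)//.
rewrite /p -powRrM.
move: u0; rewrite le_eqVlt => /predU1P[<-|u0].
  by rewrite !powR0//; rewrite ?mulf_neq0 ?lt0r_neq0// subr_gt0 (lt_trans _ a2)// ltr1n.
apply: ger_powR; first by rewrite u0 u1.
have : a * (1 - a^-1) <= a * g by rewrite ler_pM2l.
by rewrite mulrBr mulr1 divff// lt0r_neq0.
Qed.

End expansion.

Section antiderivative.
Context {R : realType}.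
Notation m := (@lebesgue_measure R).

Lemma antiderivative_exists (f : R -> R) (L : R) : continuous f ->
  exists F : R -> R, forall x, - L < x < L -> is_derive x 1 F (f x).
Proof.
move=> cf; exists (fun x => \int[m]_(t in `[- L, x]) f t) => x /andP[x1 x2].
have inf : m.-integrable `[- L, L] (EFin \o f).
  apply: continuous_compact_integrable; first exact: segment_compact.
  exact: continuous_subspaceT.
have [dF F'] := continuous_FTC1_closed x2 inf x1 (cf x).
by apply: DeriveDef; [exact: dF|rewrite -derive1E].
Qed.

Lemma is_derive_ge0_le (F f : R -> R) (a b : R) : a <= b ->
  (forall x, a <= x <= b -> is_derive x 1 F (f x)) ->
  (forall x, a <= x <= b -> 0 <= f x) -> F a <= F b.
Proof.
rewrite le_eqVlt => /predU1P[->//|ab] dF f0.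
have [| |c] := @MVT _ F f a b ab.
- by move=> x; rewrite in_itv/= => /andP[ax xb]; apply: dF; rewrite !ltW.
- apply: continuous_in_subspaceT => x; rewrite inE/= in_itv/= => xab.
  exact: (is_derive_continuous (dF x xab)).
rewrite in_itv/= => /andP[ac cb] FE.
by rewrite -subr_ge0 FE mulr_ge0 ?subr_ge0 ?(ltW ab)// f0// !ltW.
Qed.

End antiderivative.

(** * Intervals reach the critical point *)

Section doeblin.
Context {R : realType}.
Notation m := (@lebesgue_measure R).
Notation X := (measurableTypeR R).
Implicit Types (a b u x y g e r : R).

Lemma continuous_powR_gt0 (f : R -> R) p x : {for x, continuous f} -> 0 < f x ->
  {for x, continuous (fun y => f y `^ p)}.
Proof.
move=> cf f0; apply: (@continuous_comp _ _ _ f (fun u => u `^ p)) => //.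
exact: (is_derive_continuous (is_derive1_powR p f0)).
Qed.

Lemma unimodal_even a b x : unimodal_map a b (- x) = unimodal_map a b x.
Proof. by rewrite /unimodal_map normrN. Qed.

Lemma continuous_powRl a : 0 < a -> continuous (fun x : R => `|x| `^ a).
Proof.
move=> a0 x; have [->|x0] := eqVneq x 0.
  apply/cvgrPdist_lt => e e0; exists (e `^ a^-1) => /=; first by rewrite powR_gt0.
  move=> y /=; rewrite sub0r normrN => ye.
  rewrite normr0 powR0 ?lt0r_neq0// sub0r normrN ger0_norm ?powR_ge0//.
  rewrite -[e]powRr1 ?(ltW e0)// -(mulVf (lt0r_neq0 a0)) powRrM.
  by apply: gt0_ltr_powR => //; rewrite nnegrE ?powR_ge0.
apply: continuous_powR_gt0; last by rewrite normr_gt0.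
exact: norm_continuous.
Qed.

Lemma unimodal_continuous a b : 0 < a -> continuous (unimodal_map a b).
Proof.
move=> a0 x; apply: cvgB; first exact: cvg_cst.
by apply: cvgM; [exact: cvg_cst|exact: continuous_powRl].
Qed.

Section hitting.
Variables (a g e r : R).
Hypotheses (a2 : 2 < a) (ga : 1 - a^-1 <= g) (g1 : g < 1) (e0 : 0 < e) (r0 : 0 < r).
Hypothesis contr : (2 * a) `^ (g - 1) * (1 + (2 * r)^-1) < 1.
Notation T := (unimodal_map a 1).

(* An interval whose iterates all avoid the neighbourhood of 0 has exponentially growing length for
   the metric dx / weight, of total mass 2 W 1. *)
Lemma interval_hits_zero l : 0 < l -> exists n : nat, forall c d, -1 <= c -> d <= 1 -> l <= d - c ->
  exists k z, [/\ (k <= n)%N, c <= z <= d & `|iter k T z| `^ a < r * e].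
Proof.
move=> l0.
(* The maximum extends the density [1 / weight] continuously beyond [-1, 1], so that it has a
   primitive around the whole interval. *)
pose w x := (Num.max 0 (1 - x ^+ 2) + e) `^ (- g).
have base0 x : 0 < Num.max 0 (1 - x ^+ 2) + e by rewrite ltr_wpDl// le_max lexx.
have cw : continuous w.
  move=> x; apply: (@continuous_powR_gt0 (fun x => Num.max 0 (1 - x ^+ 2) + e)); last exact: base0.
  apply: cvgD; last exact: cvg_cst.
  apply: (@continuous_max _ _ (cst 0) (fun x => 1 - x ^+ 2)); first exact: cvg_cst.
  by apply: cvgB; [exact: cvg_cst|exact: exprn_continuous].
have wE x : `|x| <= 1 -> w x = (weight g e x)^-1.
  move=> x1; rewrite /w powRN /weight max_r// subr_ge0.
  by rewrite -real_normK ?num_real// expr_le1.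
have w0 x : 0 < w x by rewrite powR_gt0.
have [W0 dW0] := antiderivative_exists 4 cw.
(* Antisymmetrising makes [W] odd for any choice of the primitive, at the price of the derivative
   [2 w]. *)
pose W x := W0 x - W0 (- x).
have we x : w (- x) = w x by rewrite /w sqrrN.
have dW x : -4 < x < 4 -> is_derive x 1 W (2 * w x).
  move=> x4; have Nx4 : -4 < - x < 4 by move: x4; lra.
  have h1 := @is_derive1_comp _ W0 -%R x _ _ (dW0 _ Nx4) (is_deriveN (is_derive_id x 1)).
  apply: (is_derive_eq (is_deriveB (dW0 _ x4) h1)).
  by rewrite we mulrN1 opprK -mulr2n mulr_natl.
have WN x : W (- x) = - W x by rewrite /W opprK opprB.
have Wle c d : -1 <= c -> c <= d -> d <= 1 -> W c <= W d.
  move=> c1 cd d1; apply: (@is_derive_ge0_le _ W (fun x => 2 * w x)) => // x /andP[xc xd].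
    by apply: dW; lra.
  by rewrite mulr_ge0// ltW.
pose q := (2 * a) `^ (g - 1) * (1 + (2 * r)^-1).
have a0 : 0 < a by exact: lt_trans a2.
have q0 : 0 < q.
  by rewrite mulr_gt0// ?powR_gt0 ?mulr_gt0// addr_gt0// invr_gt0 mulr_gt0.
have TS x : `|x| <= 1 -> `|T x| <= 1.
  by apply: (unimodal_selfmap a0 _).2; rewrite ltr01 lexx.
have expand c d : 0 < c -> c <= d -> d <= 1 -> (forall x, c <= x <= d -> r * e <= `|x| `^ a) ->
   q^-1 * (W d - W c) <= W (T c) - W (T d).
  move=> c0 cd d1 hr.
  have : - W (T c) - q^-1 * W c <= - W (T d) - q^-1 * W d.
    apply: (@is_derive_ge0_le _ (fun x => - W (T x) - q^-1 * W x)
      (fun x => - (2 * w (T x) * (- (2 * 1 * a * Num.sg x * `|x| `^ (a - 1)))) - q^-1 * (2 * w x))) => //.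
    - move=> x /andP[xc xd]; have x0 : 0 < x by exact: lt_le_trans xc.
      have := TS x; rewrite !ler_norml => /(_ ltac:(apply/andP; split; lra)) /andP[t1 t2].
      have h1 := @is_derive1_comp _ W T x _ _ (dW (T x) ltac:(lra)) (is_derive_unimodal a 1 (lt0r_neq0 x0)).
      have h2 := is_deriveZ q^-1 (dW x ltac:(lra)).
      exact: (is_deriveB (is_deriveN h1) h2).
    - move=> x /andP[xc xd]; have x0 : 0 < x by exact: lt_le_trans xc.
      have x1 : x <= 1 by exact: le_trans d1.
      have nx1 : `|x| <= 1 by rewrite gtr0_norm.
      have xa := hr x; rewrite xc xd gtr0_norm// in xa.
      have := @unimodal_expansion _ a g e r x a2 ga g1 e0 r0 _ (xa isT).
      rewrite (ltW x0) x1 => /(_ isT).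
      rewrite !wE ?TS// gtr0_sg// gtr0_norm// -/q.
      have v1 : 0 < weight g e x by rewrite -invr_gt0 -wE.
      have v2 : 0 < weight g e (T x) by rewrite -invr_gt0 -wE// TS.
      set A := 2 * a * x `^ (a - 1) => h.
      rewrite subr_ge0 mulr1 (_ : - (_ * - _) = 2 * (A / weight g e (T x))); last first.
        by rewrite /A; ring.
      have qv : 0 < q * weight g e x by exact: mulr_gt0.
      rewrite mulrCA ler_pM2l// -invfM ler_pdivlMr// mulrC ler_pdivrMr//.
      by rewrite mulrA [A * q]mulrC.
  by move: (q^-1) (W c) (W d) (W (T c)) (W (T d)) => A0 A1 A2 A3 A4; lra.
have qV : 1 < q^-1 by rewrite invf_gt1.
have q1 : 0 <= q^-1 by rewrite ltW// (lt_trans ltr01).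
(* An interval without points close to 0 lies on one side of 0, and evenness of [T] reduces to the
   positive side. There [T] is monotone and expands [W]; a point found in the image interval is
   lifted by the intermediate value theorem. At [n = 0] the length would exceed the total mass. *)
have reach n : forall c d, -1 <= c -> c <= d -> d <= 1 ->
    2 * W 1 < q^-1 ^+ n * (W d - W c) ->
    exists k z, [/\ (k <= n)%N, c <= z <= d & `|iter k T z| `^ a < r * e].
  elim: n => [c d c1 cd d1|n IH c d c1 cd d1 Hn].
    rewrite expr0 mul1r => h; exfalso.
    have := Wle _ _ c1 cd d1; have := Wle (-1) c (lexx _) c1 ltac:(lra).
    have := Wle d 1 ltac:(lra) d1 (lexx _); rewrite WN; lra.
  have [[z [zcd zr]]|nz] := pselect (exists z, c <= z <= d /\ `|z| `^ a < r * e).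
    by exists 0%N, z.
  have hr x : c <= x <= d -> r * e <= `|x| `^ a.
    by move=> xcd; rewrite leNgt; apply/negP => h; apply: nz; exists x.
  have pos c' d' : 0 < c' -> c' <= d' -> d' <= 1 -> (forall x, c' <= x <= d' -> r * e <= `|x| `^ a) ->
      2 * W 1 < q^-1 ^+ n.+1 * (W d' - W c') ->
      exists k z, [/\ (k <= n.+1)%N, c' <= z <= d' & `|iter k T z| `^ a < r * e].
    move=> c0 cd' d1' hr' Hn'.
    have ex := expand _ _ c0 cd' d1' hr'.
    have /TS : `|c'| <= 1 by rewrite gtr0_norm// (le_trans cd').
    have /TS : `|d'| <= 1 by rewrite gtr0_norm// (lt_le_trans c0).
    rewrite !ler_norml => /andP[td1 td2] /andP[tc1 tc2].
    have Tdc : T d' <= T c'.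
      have d0' : 0 < d' := lt_le_trans c0 cd'.
      rewrite /unimodal_map (gtr0_norm c0) (gtr0_norm d0') lerD2l lerN2 ler_pM2l ?mulr_gt0//.
      by apply: ge0_ler_powR; rewrite ?nnegrE//; exact: ltW.
    have [|k [z [kn zT zr]]] := IH (T d') (T c') td1 Tdc tc2.
      apply: lt_le_trans Hn' _; rewrite exprSr -mulrA ler_wpM2l//.
      by rewrite exprn_ge0.
    have [z' zcd' Tz'] : exists2 z', z' \in `[c', d'] & T z' = z.
      apply: IVT => //.
        by apply: continuous_subspaceT => x; apply: unimodal_continuous.
      by rewrite (min_r Tdc) (max_l Tdc).
    exists k.+1, z'; split; [exact: kn|by move: zcd'; rewrite in_itv/=|].
    by rewrite iterSr Tz'.
  have [c0|c0] := ltP 0 c; first exact: pos.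
  have [d0|d0] := ltP d 0; last first.
    exfalso; have := hr 0; rewrite c0 d0 normr0 powR0 ?lt0r_neq0// => /(_ isT).
    by rewrite leNgt mulr_gt0.
  have [|||||k [z [kn zcd zr]]] := pos (- d) (- c).
  - by rewrite oppr_gt0.
  - by rewrite lerN2.
  - by rewrite lerNl.
  - move=> x /andP[h1 h2]; rewrite -normrN; apply: hr.
    by rewrite lerNr h2 lerNl h1.
  - by rewrite !WN opprK addrC.
  exists k, (- z); split => //; first by rewrite lerNr lerNl andbC.
  case: k kn zr => [|k] kn zr; first by rewrite /= normrN.
  by rewrite iterSr unimodal_even -iterSr.
have wlow x : `|x| <= 1 -> (1 + e) `^ (- g) <= w x.
  move=> x1.
  have s0 : 0 <= 1 - x ^+ 2 by rewrite subr_ge0 -real_normK ?num_real// expr_le1.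
  have b1 : 0 < 1 - x ^+ 2 + e by rewrite ltr_wpDl.
  have b2 : 0 < 1 + e by rewrite addr_gt0.
  have g0 := ltW (exponent_gt0 a2 ga).
  rewrite wE// /weight powRN lef_pV2 ?posrE ?powR_gt0//.
  apply: ge0_ler_powR; rewrite ?nnegrE ?(ltW b1) ?(ltW b2)//.
  by rewrite lerD2r lerBlDr lerDl sqr_ge0.
set k0 := (1 + e) `^ (- g) in wlow.
have k00 : 0 < k0 by apply: powR_gt0; exact: addr_gt0.
have Wlow c d : -1 <= c -> c <= d -> d <= 1 -> 2 * k0 * (d - c) <= W d - W c.
  move=> c1 cd d1.
  have : W c - 2 * k0 * c <= W d - 2 * k0 * d; last by lra.
  apply: (@is_derive_ge0_le _ (fun x => W x - 2 * k0 * x) (fun x => 2 * w x - 2 * k0 * 1)) => //.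
    move=> x /andP[xc xd].
    exact: (is_deriveB (dW x ltac:(lra)) (is_deriveZ (2 * k0) (is_derive_id x 1))).
  move=> x /andP[xc xd]; have := wlow x; rewrite ler_norml => /(_ ltac:(lra)); lra.
have k0l : 0 < 2 * k0 * l by rewrite !mulr_gt0.
have [n Hn] : exists n : nat, 2 * W 1 < q^-1 ^+ n * (2 * k0 * l).
  have qn : `|q| < 1 by rewrite gtr0_norm.
  have W1 : 0 <= W 1.
    have := Wle (-1) 1 (lexx _) ltac:(lra) (lexx _); rewrite WN; lra.
  have h0 : 0 < 2 * k0 * l / (2 * W 1 + 1) by rewrite divr_gt0//; lra.
  have /cvgrPdist_lt /(_ _ h0)[n _ /(_ n (leqnn n))] := cvg_expr qn.
  rewrite sub0r normrN ger0_norm ?exprn_ge0 ?(ltW q0)// => qnh.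
  exists n; rewrite exprVn [X in _ < X]mulrC ltr_pdivlMr ?exprn_gt0//.
  move: qnh; rewrite ltr_pdivlMr; last lra.
  have : 0 < q ^+ n by rewrite exprn_gt0.
  by move: (q ^+ n) => Q Q0; lra.
exists n => c d c1 d1 lcd.
have cd : c <= d by rewrite -subr_ge0 (le_trans (ltW l0)).
apply: reach => //; apply: lt_le_trans Hn _; rewrite ler_wpM2l ?exprn_ge0//.
apply: le_trans (Wlow _ _ c1 cd d1).
by rewrite ler_pM2l// mulr_gt0.
Qed.

End hitting.
End doeblin.

(** * Doeblin minorization along pseudo-orbits *)

Section doeblin_chain.
Context {R : realType}.
Notation m := (@lebesgue_measure R).
Notation X := (measurableTypeR R).
Variable (pi : R -> R).
Hypothesis (hpi : boundary_condition pi).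
Notation P T xi := (transition (@noise R) (noisy_map pi T xi)).

Lemma transition_noisy_lower (T : R -> R) xi (g : X -> R) x c d : selfmap T -> 0 < xi ->
  bmf g -> (forall x, 0 <= g x) -> -1 <= c -> c <= d -> d <= 1 ->
  T (clamp x) - xi <= c -> d <= T (clamp x) + xi ->
  (2 * xi)^-1 * \int[m]_(z in `]c, d]) g z <= P T xi g x.
Proof.
move=> hT xi0 bg g0 c1 cd d1 Tc Td.
rewrite transition_noisyE// ler_pM2l ?invr_gt0 ?mulr_gt0//.
have bgpi := bmf_bc hpi bg.
have -> : \int[m]_(z in `]c, d]) g z = \int[m]_(z in `]c, d]) g (pi z).
  apply: eq_Rintegral => z; rewrite inE/= in_itv/= => /andP[cz zd].
  by rewrite (bc_id hpi)//; apply/andP; split; [exact: le_lt_trans cz|exact: le_trans d1].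
rewrite /Rintegral fine_le//.
- apply: integrable_fin_num => //; exact: (bmf_integrable_itv bgpi (lebesgue_itv_lty _ _ _ _)).
- apply: integrable_fin_num => //; exact: (bmf_integrable_itv bgpi (lebesgue_itv_lty _ _ _ _)).
apply: ge0_subset_integral => //.
- by apply/measurable_EFinP; apply: measurable_funTS; exact: bgpi.1.
- by move=> z _; rewrite lee_fin.
- move=> z /=; rewrite !in_itv/= => /andP[cz zd]; apply/andP; split.
    by rewrite (le_trans Tc)// ltW.
  exact: le_trans Td.
Qed.

Section chain.
Variables (a xi0 b xi : R).
Hypotheses (a2 : 2 < a) (xi00 : 0 < xi0) (xi01 : xi0 <= 1) (b01 : 0 < b <= 1)
  (b1 : 2 * (1 - b) <= xi0 / 8) (xi0xi : xi0 <= xi).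
Notation T1 := (unimodal_map a 1).
Notation T := (unimodal_map a b).
Variables (delta s : R).
Hypotheses (deltaE : delta = xi0 / (16 * a)) (sE : s = delta / (2 * xi)).

(* Every point near y is carried in n steps onto the left end of the interval with density at least k.
   Pseudo-orbits of the noiseless map, of the form x, z, ..., T^j z close to 0, 1, -1, -1, ..., give
   such a minorization with the same n for all x and xi. *)
Definition reach n k y := forall g : X -> R, bmf g -> (forall x, 0 <= g x <= 1) ->
  forall x, `|clamp x - y| <= delta ->
    k * \int[m]_(z in `]-1, -1 + delta]) g z <= iter n (P T xi) g x.

Let a0 : 0 < a. Proof. exact: lt_trans a2. Qed.
Let delta_gt0 : 0 < delta. Proof. by rewrite deltaE divr_gt0// mulr_gt0. Qed.
Let xi_gt0 : 0 < xi. Proof. exact: lt_le_trans xi0xi. Qed.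
Let delta_le : delta <= xi0 / 32.
Proof.
have h : 32 <= 16 * a by move: a2; lra.
by rewrite deltaE ler_pM2l// lef_pV2 ?posrE ?mulr_gt0.
Qed.
Let hT : selfmap T. Proof. exact: unimodal_selfmap. Qed.

(** Error budget: [xi0 / 8] for replacing [b] by 1, [2 a delta = xi0 / 8] by the Lipschitz bound
    (whence [delta]), and [xi0 / 4] for the jump to [y']. The total is half of the smallest noise
    radius. *)
Lemma image_near x y y' : `|y| <= 1 -> `|clamp x - y| <= delta ->
  `|T1 y - y'| <= xi0 / 4 -> `|T (clamp x) - y'| <= xi0 / 2.
Proof.
move=> y1 xy yy'.
have [_ b1'] := andP b01.
have h1 := unimodal_beta_dist a0 b1' (clamp_norm x).
have h2 := unimodal_lipschitz (lt_trans (ltr1n _ 2) a2) (clamp_norm x) y1.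
have h3 : 2 * a * `|clamp x - y| <= xi0 / 8.
  apply: le_trans (_ : 2 * a * delta <= _); first by rewrite ler_pM2l// mulr_gt0.
  by rewrite le_eqVlt deltaE; apply/orP; left; apply/eqP; field; rewrite lt0r_neq0.
have -> : T (clamp x) - y' = (T (clamp x) - T1 (clamp x)) + (T1 (clamp x) - T1 y) + (T1 y - y').
  by ring.
apply: le_trans (ler_normD _ _) _; apply: le_trans (lerD (ler_normD _ _) (lexx _)) _.
by move: h1 h2 h3 yy' b1; move: `|_| `|_| `|_| `|_| => *; lra.
Qed.

Lemma reach_base : reach 1 (2 * xi)^-1 (-1).
Proof.
move=> g bg g01 x xy /=.
have g0 z : 0 <= g z by have /andP[] := g01 z.
have T1N : T1 (-1) = -1 by rewrite /unimodal_map normrN normr1 powR1; ring.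
have := @image_near x (-1) (-1); rewrite T1N normrN normr1 subrr normr0.
move=> /(_ (lexx _) xy ltac:(move: xi00; lra)); rewrite ler_norml => /andP[h1 h2].
by apply: transition_noisy_lower => //; move: delta_gt0 delta_le xi00 xi01 xi0xi; lra.
Qed.

Implicit Types k : R.

(** The noise has density at least [1 / (2 xi)] on an interval of length [delta] ending at [y'],
    whose mass is [s]. The interval extends from [y'] towards the interior, so as to stay in
    [-1, 1]. *)
Lemma reach_step n k y y' : 0 <= k -> `|y| <= 1 -> `|y'| <= 1 ->
  `|T1 y - y'| <= xi0 / 4 -> reach n k y' -> reach n.+1 (k * s) y.
Proof.
move=> k0 y1 y'1 yy' H g bg g01 x xy; rewrite iterS.
have mphi := measurable_noisy_map hpi hT.1 xi.
set I := \int[m]_(z in _) _.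
have bi := bmf_iter_transition (@noise R) mphi n bg.
have i0 z : 0 <= iter n (P T xi) g z.
  by have /andP[] := iter_transition_itv (@noise R) mphi n bg g01 z.
have := image_near y1 xy yy'; rewrite ler_norml => /andP[h1 h2].
move: (y'1); rewrite ler_norml => /andP[l1 l2].
have [c [d [c1 d1 dc [Tc Td cyd]]]] : exists c d : R, [/\ -1 <= c, d <= 1, d - c = delta &
    [/\ T (clamp x) - xi <= c, d <= T (clamp x) + xi & c <= y' <= d]].
  have [y'0|y'0] := leP y' 0.
    by exists y', (y' + delta); split; [..|split]; move: delta_gt0 delta_le xi00 xi01 xi0xi; lra.
  by exists (y' - delta), y'; split; [..|split]; move: delta_gt0 delta_le xi00 xi01 xi0xi; lra.
have cd : c <= d by rewrite -subr_ge0 dc ltW.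
apply: le_trans (transition_noisy_lower hT xi_gt0 bi i0 c1 cd d1 Tc Td).
rewrite (_ : k * s * I = (2 * xi)^-1 * (k * I * delta)); last by rewrite sE; field; rewrite lt0r_neq0.
rewrite ler_pM2l ?invr_gt0 ?mulr_gt0// -dc -(@Rintegral_itv_cst _ false false)//.
apply: le_Rintegral => //.
- exact: (bmf_integrable_itv (bmf_cst _ _) (lebesgue_itv_lty _ _ _ _)).
- exact: (bmf_integrable_itv bi (lebesgue_itv_lty _ _ _ _)).
- move=> z /=; rewrite in_itv/= => /andP[cz zd]; apply: H => //.
  rewrite clamp_id; last by rewrite ler_norml; apply/andP; split; move: delta_gt0 delta_le xi00 xi01; lra.
  by rewrite ler_norml; apply/andP; split; move: delta_gt0 delta_le xi00 xi01; lra.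
Qed.

Let s_gt0 : 0 < s. Proof. by rewrite sE divr_gt0// mulr_gt0. Qed.

Lemma reach_exact n k y : 0 <= k -> `|y| <= 1 -> reach n k (T1 y) -> reach n.+1 (k * s) y.
Proof.
move=> k0 y1; apply: reach_step => //; last by rewrite subrr normr0; move: xi00; lra.
by apply: (unimodal_selfmap a0 _).2; rewrite ?ltr01 ?lexx.
Qed.

Lemma reach_orbit n k y j : 0 <= k -> `|y| <= 1 -> reach n k (iter j T1 y) ->
  reach (n + j) (k * s ^+ j) y.
Proof.
move=> k0; elim: j y => [|j IH] y y1; first by rewrite addn0 expr0 mulr1.
rewrite iterSr => /IH h; rewrite addnS exprSr mulrA; apply: reach_exact => //.
  by rewrite mulr_ge0// exprn_ge0// ltW.
by apply: h; apply: (unimodal_selfmap a0 _).2; rewrite ?ltr01 ?lexx.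
Qed.

(** Itinerary from any [x]: a jump to [z], [j] exact steps to a point near 0, a jump to 1, the exact
    step to -1, [n - j] idle steps at the fixed point -1, and the landing step. Idling makes the
    length [n + 4] independent of [x]. *)
Lemma reach_chain n : (forall c d, -1 <= c -> d <= 1 -> xi0 / 4 <= d - c ->
    exists j z, [/\ (j <= n)%N, c <= z <= d & 2 * `|iter j T1 z| `^ a <= xi0 / 4]) ->
  0 < s ^+ (n + 4) < 1 /\
  contracting (@noise R) (noisy_map pi T xi) (n + 4) (1 - s ^+ (n + 4)).
Proof.
move=> hits.
have s1 : s < 1.
  rewrite sE ltr_pdivrMr ?mulr_gt0// mul1r; move: delta_le xi0xi xi00; lra.
split; first by rewrite exprn_gt0//= exprn_ilt1// ?addn4// ltW.
have -> : s ^+ (n + 4) = (2 * xi)^-1 * s ^+ (n + 3) * (-1 + delta - -1).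
  rewrite addn4 addn3 exprS [X in X * _]sE; field; exact: lt0r_neq0.
apply: noisy_contracting => //; first by move: delta_gt0; lra.
move=> g bg g01 x.
set y := clamp x; have y1 : `|y| <= 1 := clamp_norm x.
have T1S z : `|z| <= 1 -> `|T1 z| <= 1.
  by apply: (unimodal_selfmap a0 _).2; rewrite ltr01 lexx.
have Ty : `|T1 y| <= 1 by exact: T1S.
move: (Ty); rewrite ler_norml => /andP[Ty1 Ty2].
have [j [z [jn zy zr]]] : exists j z, [/\ (j <= n)%N,
    (`|z| <= 1) && (`|T1 y - z| <= xi0 / 4) & 2 * `|iter j T1 z| `^ a <= xi0 / 4].
  have [h|h] := leP (T1 y) 0.
    have [||| j [z [jn /andP[z1 z2] zr]]] := hits (T1 y) (T1 y + xi0 / 4); [by []|by move: xi01; lra|by move: xi00; lra|].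
    by exists j, z; split => //; rewrite !ler_norml; apply/andP; split; apply/andP; split; move: delta_gt0 delta_le xi00 xi01; lra.
  have [||| j [z [jn /andP[z1 z2] zr]]] := hits (T1 y - xi0 / 4) (T1 y); [by move: xi01; lra|by []|by move: xi00; lra|].
  by exists j, z; split => //; rewrite !ler_norml; apply/andP; split; apply/andP; split; move: delta_gt0 delta_le xi00 xi01; lra.
have /andP[z1 yz] := zy.
have k0 : 0 <= (2 * xi)^-1 :> R by rewrite invr_ge0 mulr_ge0// ltW.
have T11 : T1 1 = -1 by rewrite /unimodal_map normr1 powR1; ring.
have T1N : T1 (-1) = -1 by rewrite /unimodal_map normrN normr1 powR1; ring.
have iN i : iter i T1 (-1) = -1 by elim: i => //= i ->.
have r1 : reach (1 + (n - j)) ((2 * xi)^-1 * s ^+ (n - j)) (-1).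
  apply: reach_orbit => //; first by rewrite normrN normr1.
  by rewrite iN; exact: reach_base.
have kk i : 0 <= (2 * xi)^-1 * s ^+ i by rewrite mulr_ge0// exprn_ge0// ltW.
have r2 : reach (1 + (n - j)).+1 ((2 * xi)^-1 * s ^+ (n - j) * s) 1.
  by apply: reach_exact => //; rewrite ?normr1// T11.
rewrite -mulrA -exprSr in r2.
have w1 : `|iter j T1 z| <= 1 by elim: (j) => //= i; exact: T1S.
have r3 : reach (1 + (n - j)).+2 ((2 * xi)^-1 * s ^+ (n - j).+1 * s) (iter j T1 z).
  apply: reach_step r2 => //; first by rewrite normr1.
  move: (iter j _ z) zr => w zr.
  rewrite /unimodal_map mulr1 addrAC subrr sub0r normrN ger0_norm; first exact: zr.
  by rewrite mulr_ge0 ?powR_ge0.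
rewrite -mulrA -exprSr in r3.
have r4 := reach_orbit (kk _) z1 r3.
have r5 := reach_step (mulr_ge0 (kk _) (exprn_ge0 _ (ltW s_gt0))) y1 z1 yz r4.
have e1 : ((1 + (n - j)).+2 + j).+1 = (n + 4)%N by move: jn; clear; lia.
have e2 : ((n - j).+2 + j.+1)%N = (n + 3)%N by move: jn; clear; lia.
rewrite e1 -mulrA -exprSr -mulrA -exprD e2 in r5.
by apply: r5 => //; rewrite subrr normr0 ltW.
Qed.

End chain.

Lemma unimodal_contracting a xi0 : 2 < a -> 0 < xi0 <= 1 -> exists N, forall b xi,
  0 < b <= 1 -> 2 * (1 - b) <= xi0 / 8 -> xi0 <= xi ->
  exists2 c, 0 < c < 1 & contracting (@noise R) (noisy_map pi (unimodal_map a b) xi) N c.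
Proof.
move=> a2 /andP[xi00 xi01].
have a0 : 0 < a by exact: lt_trans a2.
(* The least admissible exponent [g = 1 - 1/a] suffices for hitting. *)
pose q := (2 * a) `^ (1 - a^-1 - 1).
have q0 : 0 < q by rewrite powR_gt0// mulr_gt0.
have q1 : q < 1.
  rewrite /q addrAC subrr sub0r powRN invf_lt1 ?powR_gt0 ?mulr_gt0//.
  have : 1 `^ a^-1 < (2 * a) `^ a^-1.
    by apply: gt0_ltr_powR; rewrite ?invr_gt0// ?nnegrE//; lra.
  by rewrite powR1.
(* This makes the rate [q (1 + 1/(2r))] equal to [(1 + q) / 2]; then [e] is set so that
   [r e = xi0 / 8], the closeness to 0 that a jump to 1 requires. *)
pose r := q / (1 - q).
have r0 : 0 < r by rewrite divr_gt0// subr_gt0.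
pose e := xi0 / (8 * r).
have e0 : 0 < e by rewrite divr_gt0// mulr_gt0.
have re : r * e = xi0 / 8 by rewrite /e; field; rewrite lt0r_neq0.
have contr : q * (1 + (2 * r)^-1) < 1.
  rewrite (_ : q * _ = (1 + q) / 2); first by lra.
  have qn0 := lt0r_neq0 q0; have qn1 : 1 - q != 0 by rewrite lt0r_neq0// subr_gt0.
  by rewrite /r; field; rewrite ?qn0 ?qn1.
have g1 : 1 - a^-1 < 1 by rewrite ltrBlDr ltrDl invr_gt0.
have l0 : 0 < xi0 / 4 by lra.
have [n Hn] := interval_hits_zero a2 (lexx _) g1 e0 r0 contr l0.
exists (n + 4)%N => b xi b01 b1 xi0xi.
have [|s01 ctr] := @reach_chain a xi0 b xi a2 xi00 xi01 b01 b1 xi0xi _ _ erefl erefl n.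
  move=> c d c1 d1 cd; have [j [z [jn zcd]]] := Hn c d c1 d1 cd.
  by rewrite re => h; exists j, z; split => //; lra.
exists (1 - (xi0 / (16 * a) / (2 * xi)) ^+ (n + 4)) => //.
by move: s01 => /andP[]; lra.
Qed.

End doeblin_chain.

(** * Regularity of stationary measures at small noise *)

Section reflected_primitives.
Context {R : realType}.
Notation m := (@lebesgue_measure R).
Notation X := (measurableTypeR R).
Implicit Types (x y z t s c e : R) (h k F f : R -> R).

Lemma is_derive_norm_le F f a b B : a <= b ->
  (forall x, a <= x <= b -> is_derive x 1 F (f x)) ->
  (forall x, a <= x <= b -> `|f x| <= B) -> `|F b - F a| <= B * (b - a).
Proof.
move=> ab dF fB.
have h1 : F a - B * a <= F b - B * b + 2 * B * (b - a).
  suff : B * a + F a <= B * b + F b by lra.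
  apply: (@is_derive_ge0_le _ (fun x => B * x + F x) (fun x => B * 1 + f x)) => // x xab.
    exact: (is_deriveD (is_deriveZ B (is_derive_id x 1)) (dF x xab)).
  by have := fB x xab; rewrite ler_norml => /andP[]; lra.
have h2 : B * a - F a <= B * b - F b.
  apply: (@is_derive_ge0_le _ (fun x => B * x - F x) (fun x => B * 1 - f x)) => // x xab.
    exact: (is_deriveB (is_deriveZ B (is_derive_id x 1)) (dF x xab)).
  by have := fB x xab; rewrite ler_norml => /andP[]; lra.
by rewrite ler_norml; apply/andP; split; lra.
Qed.

Lemma is_derive0_eq F a b : a <= b ->
  (forall x, a <= x <= b -> is_derive x 1 F 0) -> F a = F b.
Proof.
move=> ab dF; apply/eqP; rewrite eq_sym -subr_eq0 -normr_le0.
rewrite -(mul0r (b - a)); apply: (@is_derive_norm_le F (fun=> 0)) => // x _.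
by rewrite normr0.
Qed.

(** For a primitive [X] of [chi], the average of [chi] over [[c - t, c + t]], completed by its limit
    at [t = 0]. *)
Definition symmetric_quotient (X chi : R -> R) c t :=
  if t == 0 then chi c else (X (c + t) - X (c - t)) / (2 * t).

Lemma symmetric_quotient_continuous (X chi : R -> R) c L t :
  (forall x, `|x| <= L -> is_derive x 1 X (chi x)) ->
  `|c| <= L -> `|c + t| <= L -> `|c - t| <= L ->
  {for t, continuous (symmetric_quotient X chi c)}.
Proof.
move=> dX cL ctL ctL'.
pose W t := X (c + t) - X (c - t).
have dW s : `|c + s| <= L -> `|c - s| <= L -> is_derive s 1 W (chi (c + s) + chi (c - s)).
  move=> h1 h2.
  have d1 := @is_derive1_comp _ X (fun t => c + t) s _ _ (dX _ h1)
    (is_deriveD (is_derive_cst c s 1) (is_derive_id s 1)).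
  have d2 := @is_derive1_comp _ X (fun t => c - t) s _ _ (dX _ h2)
    (is_deriveB (is_derive_cst c s 1) (is_derive_id s 1)).
  by apply: (is_derive_eq (is_deriveB d1 d2)); rewrite /GRing.scale/=; ring.
have [->|t0] := eqVneq t 0.
  apply/continuous_withinNx; rewrite /symmetric_quotient eqxx.
  have := dW 0; rewrite addr0 subr0 => /(_ cL cL) [exW valW].
  have cvW : (h^-1 *: (W (h *: 1 + 0) - W 0)) @[h --> 0^'] --> chi c + chi c by rewrite -valW.
  have -> : chi c = 2^-1 * (chi c + chi c) by lra.
  apply: (@cvg_trans _ ((2^-1 * (h^-1 *: (W (h *: 1 + 0) - W 0))) @[h --> 0^'])); last first.
    by apply: cvgM => //; exact: cvg_cst.
  apply: near_eq_cvg; near=> h.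
  have h0 : h != 0 by near: h; exact: nbhs_dnbhs_neq.
  rewrite (negPf h0) /W !addr0 !subr0 subrr subr0 /GRing.scale/= !mulr1 invfM; ring.
have cW : {for t, continuous (fun s => W s / (2 * s))}.
  apply: (@cvgM _ _ _ _ W (fun s => (2 * s)^-1)).
    exact: (is_derive_continuous (dW t ctL ctL')).
  apply: cvgV; first by rewrite mulf_neq0.
  by apply: cvgM; [exact: cvg_cst|exact: cvg_id].
have SE : symmetric_quotient X chi c t = W t / (2 * t) by rewrite /symmetric_quotient (negPf t0).
rewrite /prop_for /continuous_at SE; apply: cvg_trans cW.
apply: near_eq_cvg; near=> s.
have s0 : s != 0 by near: s; exact: open_neq.
by rewrite /symmetric_quotient (negPf s0).
Unshelve. all: by end_near. Qed.

(** For [|z| <= 2] this is [|pi z|] under either boundary condition. *)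
Definition fold (z : R) : R := 1 - `| `|z| - 1 |.

Lemma fold_id y : 0 <= y <= 1 -> fold y = y.
Proof. by move=> /andP[y0 y1]; rewrite /fold (ger0_norm y0) ler0_norm; lra. Qed.

Lemma fold_norm_le y : `|y| <= 1 -> fold y = `|y|.
Proof. by move=> y1; rewrite /fold ler0_norm; lra. Qed.

Lemma continuous_clamp : continuous (@clamp R).
Proof.
move=> x; apply: (@continuous_max _ _ (cst (-1)) (fun x => Num.min 1 x)); first exact: cvg_cst.
by apply: (@continuous_min _ _ (cst 1) id); [exact: cvg_cst|exact: cvg_id].
Qed.

Lemma continuous_fold : continuous fold.
Proof.
move=> x; apply: cvgB; first exact: cvg_cst.
apply: (@continuous_comp _ _ _ (fun x => `|x| - 1) (fun x => `|x|)); last exact: norm_continuous.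
by apply: cvgB; [exact: norm_continuous|exact: cvg_cst].
Qed.

Lemma bmf_clamp (f : R -> R) : (forall y, `|y| <= 1 -> {for y, continuous f}) ->
  bmf (fun x : X => f (clamp x)).
Proof.
move=> cf; split.
  apply: continuous_measurable_fun => x.
  by apply: continuous_comp; [exact: continuous_clamp|apply: cf; exact: clamp_norm].
have cw g : (forall y, `|y| <= 1 -> {for y, continuous g}) ->
    exists M : R, forall y, `|y| <= 1 -> g y <= M.
  move=> cg; have [||c _ Hc] := @EVT_max R g (-1) 1; [lra| |].
    apply: continuous_in_subspaceT => y; rewrite inE/= in_itv/= -ler_norml; exact: cg.
  by exists (g c) => y y1; apply: Hc; rewrite in_itv/= -ler_norml.
have [M1 H1] := cw f cf.
have [|M2 H2] := cw (fun y => - f y); first by move=> y y1; apply: cvgN; exact: cf.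
exists (Num.max M1 M2) => x; have x1 := clamp_norm x.
by rewrite ler_norml lerNl !le_max H1// H2// orbT.
Qed.

(* chi is odd and 2-periodic on a neighbourhood of the noise window, and h = chi' is even and 2-periodic
   there, so that [h (pi z) = h z] for both boundary conditions. *)
Definition reflected_primitive (chi h : R -> R) :=
  [/\ continuous h, forall x, h (- x) = h x,
      forall t, `|t| <= 2 -> h (1 + t) = h (1 - t),
      forall x, -4 < x < 4 -> is_derive x 1 chi (h x) & chi 0 = 0 /\ chi 1 = 0].

Lemma norm_le_sym_ind (Q : R -> Prop) L : (forall y, 0 <= y <= L -> Q y) ->
  (forall y, Q (- y) -> Q y) -> forall x, `|x| <= L -> Q x.
Proof.
move=> H HN x; rewrite ler_norml => xL; have [x0|x0] := leP 0 x; first by apply: H; lra.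
by apply/HN/H; lra.
Qed.

Lemma reflected_primitive_odd chi h x : reflected_primitive chi h -> `|x| < 4 -> chi (- x) = - chi x.
Proof.
move=> [_ he _ dchi [chi0 _]] x4.
move: {-2}x (lexx `|x|); apply: norm_le_sym_ind => y; last first.
  by rewrite opprK => ->; rewrite opprK.
move=> /andP[y0 /le_lt_trans/(_ x4) y4]; apply/eqP; rewrite -addr_eq0; apply/eqP.
rewrite -[RHS](_ : chi (- 0) + chi 0 = 0); last by rewrite oppr0 chi0 addr0.
symmetry; apply: (@is_derive0_eq (fun y => chi (- y) + chi y)) => // z zy.
have d1 := @is_derive1_comp _ chi -%R z _ _ (dchi (- z) ltac:(lra)) (is_deriveN (is_derive_id z 1)).
apply: (is_derive_eq (is_deriveD d1 (dchi z ltac:(lra)))).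
by rewrite he /GRing.scale/=; ring.
Qed.

Lemma reflected_primitive_refl chi h t : reflected_primitive chi h -> `|t| <= 2 ->
  chi (1 + t) = - chi (1 - t).
Proof.
move=> [_ _ hr dchi [_ chi1]] t2.
move: t t2; apply: norm_le_sym_ind => y; last by rewrite opprK => ->; rewrite opprK.
move=> /andP[y0 y2]; apply/eqP; rewrite -addr_eq0; apply/eqP.
rewrite -[RHS](_ : chi (1 + 0) + chi (1 - 0) = 0); last by rewrite addr0 subr0 chi1 addr0.
symmetry; apply: (@is_derive0_eq (fun y => chi (1 + y) + chi (1 - y))) => // z zy.
have d1 := @is_derive1_comp _ chi (fun y => 1 + y) z _ _ (dchi (1 + z) ltac:(lra))
  (is_deriveD (is_derive_cst (1 : R) z 1) (is_derive_id z 1)).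
have d2 := @is_derive1_comp _ chi (fun y => 1 - y) z _ _ (dchi (1 - z) ltac:(lra))
  (is_deriveB (is_derive_cst (1 : R) z 1) (is_derive_id z 1)).
apply: (is_derive_eq (is_deriveD d1 d2)).
by rewrite hr ?ler_norml; [rewrite /GRing.scale/=; ring|lra].
Qed.

Lemma reflected_second_primitive chi h : reflected_primitive chi h -> exists X : R -> R,
  [/\ forall x, `|x| <= 3 -> is_derive x 1 X (chi x),
      forall x, `|x| <= 3 -> X (- x) = X x &
      forall t, `|t| <= 2 -> X (1 + t) = X (1 - t)].
Proof.
move=> hc; have [_ _ _ dchi _] := hc.
(* Clipping yields an integrand continuous on the whole line; [chi] is only known to be
   differentiable on []-4, 4[]. *)
pose clip x := Num.max (-3) (Num.min 3 x).
have ccl : continuous (fun x => chi (clip x)).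
  move=> x; apply: continuous_comp; last first.
    apply: (is_derive_continuous (dchi _ _)).
    by rewrite /clip lt_max gt_max gt_min !ltr_nat /=; apply/andP; split; lra.
  apply: (@continuous_max _ _ (cst (-3)) (fun x => Num.min 3 x)); first exact: cvg_cst.
  by apply: (@continuous_min _ _ (cst 3) id); [exact: cvg_cst|exact: cvg_id].
have [F dF] := antiderivative_exists 4 ccl.
have dF' x : `|x| <= 3 -> is_derive x 1 F (chi x).
  rewrite ler_norml => x3.
  have E : clip x = x by rewrite /clip min_r ?max_r//; lra.
  by rewrite -[in chi x]E; apply: dF; lra.
exists F; split => //.
- apply: norm_le_sym_ind => y; last by rewrite opprK.
  move=> /andP[y0 y3]; apply/eqP; rewrite -subr_eq0; apply/eqP.
  rewrite -[RHS](_ : F (- 0) - F 0 = 0); last by rewrite oppr0 subrr.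
  symmetry; apply: (@is_derive0_eq (fun y => F (- y) - F y)) => // z zy.
  have z3 : `|z| <= 3 by rewrite ler_norml; lra.
  have d1 := @is_derive1_comp _ F -%R z _ _ (dF' (- z) ltac:(by rewrite normrN)) (is_deriveN (is_derive_id z 1)).
  apply: (is_derive_eq (is_deriveB d1 (dF' z z3))).
  by rewrite (reflected_primitive_odd hc) ?(le_lt_trans z3) ?ltr_nat// /GRing.scale/=; ring.
- apply: norm_le_sym_ind => y; last by rewrite opprK.
  move=> /andP[y0 y2]; apply/eqP; rewrite -subr_eq0; apply/eqP.
  rewrite -[RHS](_ : F (1 + 0) - F (1 - 0) = 0); last by rewrite addr0 subr0 subrr.
  symmetry; apply: (@is_derive0_eq (fun y => F (1 + y) - F (1 - y))) => // z zy.
  have z1 : `|1 + z| <= 3 by rewrite ler_norml; lra.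
  have z2 : `|1 - z| <= 3 by rewrite ler_norml; lra.
  have d1 := @is_derive1_comp _ F (fun y => 1 + y) z _ _ (dF' _ z1)
    (is_deriveD (is_derive_cst (1 : R) z 1) (is_derive_id z 1)).
  have d2 := @is_derive1_comp _ F (fun y => 1 - y) z _ _ (dF' _ z2)
    (is_deriveB (is_derive_cst (1 : R) z 1) (is_derive_id z 1)).
  apply: (is_derive_eq (is_deriveB d1 d2)).
  by rewrite (reflected_primitive_refl hc) ?ler_norml; [rewrite /GRing.scale/=; ring|lra].
Qed.

(** Extends an even profile on [-1, 1] by reflections. Compared with [reflected_primitive], the
    condition [chi 1 = 0] is absent: it would require [k] to have mean 0 over [0, 1]. *)
Lemma reflected_profile k : (forall x, k (- x) = k x) ->
  (forall y, `|y| <= 1 -> {for y, continuous k}) ->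
  exists chi : R -> R, let h := fun z => k (clamp (fold z)) in
  [/\ continuous h, forall x, h (- x) = h x,
      forall t, `|t| <= 2 -> h (1 + t) = h (1 - t),
      forall x, -4 < x < 4 -> is_derive x 1 chi (h x) & chi 0 = 0].
Proof.
move=> ke kc; pose h := fun z => k (clamp (fold z)).
have hc : continuous h.
  move=> z; apply: (@continuous_comp _ _ _ (fun z => clamp (fold z)) k).
    by apply: continuous_comp; [exact: continuous_fold|exact: continuous_clamp].
  by apply: kc; exact: clamp_norm.
have [F dF] := antiderivative_exists 4 hc.
exists (fun x => F x - F 0); split => //.
- by move=> x; rewrite /h /fold normrN.
- apply: norm_le_sym_ind => t; last by rewrite opprK.
  move=> /andP[t0 t2]; rewrite /h.
  have -> : fold (1 + t) = 1 - t.
    by rewrite /fold (ger0_norm (_ : 0 <= 1 + t)) ?addr_ge0// addrAC subrr add0r ger0_norm.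
  have [t1|t1] := leP t 1; first by rewrite fold_id// subr_ge0 t1 lerBlDr lerDl.
  have -> : fold (1 - t) = - (1 - t).
    by rewrite /fold (ler0_norm (_ : 1 - t <= 0)) ?subr_le0 ?ltW// ler0_norm; lra.
  by rewrite !clamp_id ?normrN ?ke//; rewrite ler0_norm; lra.
- move=> x x4; apply: (is_derive_eq (is_deriveB (dF x x4) (is_derive_cst (F 0) x 1))).
  by rewrite subr0.
- by rewrite subrr.
Qed.

End reflected_primitives.

(** * The weak transfer identity *)

Section transfer_step.
Context {R : realType}.
Implicit Types (x y z t s c B : R) (h chi E : R -> R).
Variables (a xi : R).
Hypotheses (a2 : 2 < a) (xi0 : 0 < xi) (xi1 : xi <= 1).
Notation T := (unimodal_map a 1).

Let a0 : 0 < a. Proof. exact: lt_trans a2. Qed.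

(* With p = |y|^a and P the average over the window [T y - xi, T y + xi], chi2 = P chi / T' and
   [E y = chi2 y / y]; the identity is (P chi)' = T' chi2' + T'' chi2, divided by T'. It is written with a
   primitive X of chi and the reflection about 1, which makes the singularity at y = 0 a difference
   quotient of X at 1 - xi. *)
Lemma primitive_transfer chi h : reflected_primitive chi h ->
  exists (chi2 h2 E : R -> R), [/\ reflected_primitive chi2 h2,
    forall y, `|y| <= 1 -> {for y, continuous E},
    forall y, 0 <= y <= 1 -> chi2 y = y * E y,
    forall y, `|y| <= 1 ->
      (chi (T y + xi) - chi (T y - xi)) / (2 * xi) = h2 y + (a - 1) * E y &
    (forall y B, `|y| <= 1 -> 2 * `|y| `^ a <= xi ->
       (forall s, `|s - 1| <= 2 * xi -> `|chi s| <= B) -> `|E y| <= B / (a * xi)) /\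
    (forall y B, `|y| <= 1 -> y != 0 ->
       (forall s, `|s - T y| <= xi -> `|chi s| <= B) -> `|E y| <= B / (2 * a * `|y| `^ a))].
Proof.
move=> hc; have [_ _ _ dchi _] := hc.
have [X [dX Xe Xr]] := reflected_second_primitive hc.
(* The window around [T y = 1 - 2 p] has lower end [c - 2 p], and its upper end is the mirror image
   of [c + 2 p] about 1, where [X] is symmetric. Its average becomes a symmetric difference of [X]
   at the fixed centre [c]. *)
pose c := 1 - xi.
have ax0 : a * xi != 0 by rewrite lt0r_neq0// mulr_gt0.
pose E y := - symmetric_quotient X chi c (2 * `|y| `^ a) / (a * xi).
(* The derivative that [y * E y] must have; it becomes the new test [h2] after extension by
   reflections. *)
pose D y := - (chi (c + 2 * `|y| `^ a) + chi (c - 2 * `|y| `^ a)) / (2 * xi) - (a - 1) * E y.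
have p01 y : `|y| <= 1 -> 0 <= `|y| `^ a <= 1.
  by move=> y1; apply: powR_itv01 => //; rewrite normr_ge0.
have cp y : `|y| <= 1 -> `|c + 2 * `|y| `^ a| <= 3 /\ `|c - 2 * `|y| `^ a| <= 3.
  by move=> /p01; rewrite /c; move: (_ `^ _) xi0 xi1 => p h1 h2 /andP[h3 h4]; rewrite !ler_norml; split; lra.
have c3 : `|c| <= 3 by rewrite /c ger0_norm; move: xi0 xi1; lra.
have pc y : {for y, continuous (fun y => 2 * `|y| `^ a)}.
  by apply: cvgM; [exact: cvg_cst|exact: continuous_powRl].
have Ec y : `|y| <= 1 -> {for y, continuous E}.
  move=> y1; have [h1 h2] := cp y y1.
  apply: cvgM; last exact: cvg_cst.
  apply: cvgN; apply: (@continuous_comp _ _ _ (fun y => 2 * `|y| `^ a)); first exact: pc.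
  exact: (symmetric_quotient_continuous dX).
have chic s : `|s| <= 3 -> {for s, continuous chi}.
  rewrite ler_norml => s3; apply: (is_derive_continuous (dchi s _)); lra.
have Dc y : `|y| <= 1 -> {for y, continuous D}.
  move=> y1; have [h1 h2] := cp y y1.
  apply: cvgB; last by apply: cvgM; [exact: cvg_cst|exact: Ec].
  apply: cvgM; last exact: cvg_cst.
  apply: cvgN; apply: cvgD.
    apply: (@continuous_comp _ _ _ (fun y => c + 2 * `|y| `^ a)); last exact: chic.
    by apply: cvgD; [exact: cvg_cst|exact: pc].
  apply: (@continuous_comp _ _ _ (fun y => c - 2 * `|y| `^ a)); last exact: chic.
  by apply: cvgB; [exact: cvg_cst|exact: pc].
have De y : D (- y) = D y by rewrite /D /E normrN.
have [chi2 [h2c h2e h2r dchi2 chi20]] := reflected_profile De Dc.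
set h2 := (fun z => _) in h2c h2e h2r dchi2.
have h2E y : `|y| <= 1 -> h2 y = D y.
  move=> y1; rewrite /h2 fold_norm_le// clamp_id ?normr_id//.
  by case: (ger0P y) => // _; rewrite De.
have Tp y : T y = 1 - 2 * `|y| `^ a by rewrite /unimodal_map mulr1.
have Xp y : `|y| <= 1 -> X (c + 2 * `|y| `^ a) = X (T y + xi) /\ X (c - 2 * `|y| `^ a) = X (T y - xi).
  move=> y1; have /andP[p0 p1] := p01 y y1.
  rewrite Tp /c; split; last by congr X; ring.
  rewrite (_ : 1 - xi + _ = 1 + (2 * `|y| `^ a - xi)); last by ring.
  rewrite Xr; first by congr X; ring.
  by rewrite ler_norml; move: xi0 xi1; lra.
have chip y : `|y| <= 1 -> chi (c + 2 * `|y| `^ a) = - chi (T y + xi) /\ chi (c - 2 * `|y| `^ a) = chi (T y - xi).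
  move=> y1; have /andP[p0 p1] := p01 y y1.
  rewrite Tp /c; split; last by congr chi; ring.
  rewrite (_ : 1 - xi + _ = 1 + (2 * `|y| `^ a - xi)); last by ring.
  rewrite (reflected_primitive_refl hc); first by congr (- chi _); ring.
  by rewrite ler_norml; move: xi0 xi1; lra.
(* The window around [T 1 = -1] is symmetric about -1, and [chi] is odd about that point, so its
   average vanishes. *)
have E1 : E 1 = 0.
  rewrite /E /symmetric_quotient normr1 powR1 mulr1 (negPf (_ : 2 != 0)) ?lt0r_neq0//.
  rewrite (_ : X (c + 2) - X (c - 2) = 0) ?mul0r ?oppr0 ?mul0r//.
  have -> : c + 2 = 1 + (2 - xi) by rewrite /c; ring.
  rewrite Xr; last by rewrite ler_norml; move: xi0 xi1; lra.
  have -> : c - 2 = - (1 + xi) by rewrite /c; ring.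
  rewrite Xe; last by rewrite ger0_norm; move: xi0 xi1; lra.
  rewrite Xr; last by rewrite ger0_norm; move: xi0 xi1; lra.
  have -> : 1 - (2 - xi) = - (1 - xi) by ring.
  by rewrite Xe ?subrr// ger0_norm; move: xi0 xi1; lra.
have dyE y : 0 < y < 1 -> is_derive y 1 (fun y => y * E y) (D y).
  move=> /andP[y0 y1].
  have yn : `|y| = y by rewrite gtr0_norm.
  have y1' : `|y| <= 1 by rewrite yn ltW.
  have [cp1 cp2] := cp y y1'; rewrite yn in cp1 cp2.
  have q0 : 0 < y `^ a by exact: powR_gt0.
  pose W z := X (c + 2 * z `^ a) - X (c - 2 * z `^ a).
  have dp := is_deriveZ (2 : R) (is_derive1_powR a y0).
  have d1 := @is_derive1_comp _ X (fun z => c + 2 * z `^ a) y _ _ (dX _ cp1)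
    (is_deriveD (is_derive_cst c y 1) dp).
  have d2 := @is_derive1_comp _ X (fun z => c - 2 * z `^ a) y _ _ (dX _ cp2)
    (is_deriveB (is_derive_cst c y 1) dp).
  have dW : is_derive y 1 W ((chi (c + 2 * y `^ a) + chi (c - 2 * y `^ a)) * (2 * a * y `^ (a - 1))).
    by apply: (is_derive_eq (is_deriveB d1 d2)); rewrite /GRing.scale/=; ring.
  have dV := is_derive1_powR (1 - a) y0.
  have dF := is_deriveZ (- (4 * a * xi)^-1) (is_deriveM dW dV).
  (* For [z > 0] the case distinction disappears and [z * E z] is an explicit product of [W z] and
     the power [z^(1 - a)]. *)
  apply: (@near_eq_is_derive _ _ _ (fun z => - (4 * a * xi)^-1 * (W z * z `^ (1 - a)))).
    near=> z; have z0 : 0 < z by near: z; exact: lt_nbhsr.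
    have qz : 0 < z `^ a by exact: powR_gt0.
    rewrite /E /symmetric_quotient gtr0_norm// mulf_eq0 !gt_eqF//= /W powRB; last first.
      by apply/implyP; rewrite lt0r_neq0.
    rewrite powRr1 ?ltW//; field; rewrite !lt0r_neq0//; exact: mulr_gt0.
  apply: (is_derive_eq dF).
  rewrite /D /E /symmetric_quotient yn mulf_eq0 !gt_eqF//= -/(W y).
  have -> : 1 - a - 1 = - a by ring.
  rewrite powRN (powRB (r := 1)) ?(powRB (r := a)) ?lt0r_neq0 ?implybT// powRr1 ?ltW//.
  by rewrite /GRing.scale/=; field; rewrite !lt0r_neq0//; exact: mulr_gt0.
have chi2E y : 0 <= y <= 1 -> chi2 y = y * E y.
  move=> /andP[]; rewrite le_eqVlt => /predU1P[<- _|y0 y1]; first by rewrite chi20 mul0r.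
  (* The derivative of [z * E z] is available only on the open interval, so the mean value theorem
     is used with continuity up to the ends. *)
  pose F z := chi2 z - z * E z.
  have dF z : z \in `]0, y[ -> is_derive z 1 F ((fun=> 0) z).
    rewrite in_itv/= => /andP[z0 zy]; have z1 : 0 < z < 1 by rewrite z0 (lt_le_trans zy).
    apply: (is_derive_eq (is_deriveB (dchi2 z _) (dyE z z1))); first by move: z1; lra.
    apply/eqP; rewrite subr_eq0; apply/eqP; apply: h2E.
    by rewrite gtr0_norm//; move: z1; lra.
  have [|z _] := @MVT _ F (fun=> 0) 0 y y0 dF.
    apply: continuous_in_subspaceT => z; rewrite inE/= in_itv/= => /andP[z0 zy].
    have z1 : `|z| <= 1 by rewrite ger0_norm// (le_trans zy).
    apply: cvgB; first by apply: (is_derive_continuous (dchi2 z _)); move: z0 zy y1; lra.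
    by apply: cvgM; [exact: cvg_id|exact: Ec].
  by rewrite mul0r /F mul0r chi20 !subr0 => /eqP; rewrite subr_eq0 => /eqP.
exists chi2, h2, E; split => //.
- by split => //; split => //; rewrite chi2E ?lexx ?ler01// E1 mulr0.
- move=> y y1; rewrite h2E// /D subrK; have [-> ->] := chip y y1.
  by rewrite opprD opprK.
(* Near 0, [E] is an average of [chi] over points within [2 xi] of 1, divided by [a xi]. Elsewhere
   it is, up to sign, the average over the noise window divided by [|y T'(y)| = 2 a |y|^a]. *)
- split=> y B y1.
    move=> yxi HB.
    have -> : `|E y| = `|symmetric_quotient X chi c (2 * `|y| `^ a)| / (a * xi).
      by rewrite /E normrM normrN [X in _ * X]gtr0_norm// invr_gt0 mulr_gt0.
    rewrite ler_pM2r ?invr_gt0 ?mulr_gt0//.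
    set t := 2 * `|y| `^ a in yxi *.
    have t0 : 0 <= t by rewrite mulr_ge0// powR_ge0.
    rewrite /symmetric_quotient; have [_|tn0] := eqVneq t 0.
      by apply: HB; rewrite /c ler_norml; move: xi0; lra.
    have tgt0 : 0 < t by rewrite lt0r tn0.
    have t20 : 0 < 2 * t by rewrite pmulr_rgt0.
    rewrite normrM [X in _ * X]gtr0_norm ?invr_gt0// ler_pdivrMr//.
    rewrite (_ : 2 * t = c + t - (c - t)); last by ring.
    apply: (@is_derive_norm_le _ X chi) => [|s|s]; first by lra.
      by move=> sct; apply: dX; rewrite ler_norml; move: sct xi0 xi1; rewrite /c; lra.
    by move=> sct; apply: HB; rewrite ler_norml; move: sct xi0; rewrite /c; lra.
  move=> y0 HB; have q0 : 0 < `|y| `^ a by rewrite powR_gt0// normr_gt0.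
  have /andP[_ q1] := p01 y y1.
  rewrite /E /symmetric_quotient mulf_eq0 !gt_eqF//=; have [-> ->] := Xp y y1.
  rewrite (_ : - (_ / _) / _ = - (X (T y + xi) - X (T y - xi)) / (2 * (2 * `|y| `^ a) * (a * xi))); last first.
    by field; rewrite !lt0r_neq0.
  rewrite normrM normrN [X in _ * X]gtr0_norm ?invr_gt0 ?mulr_gt0//.
  rewrite ler_pdivrMr ?mulr_gt0// (_ : B / _ * _ = B * (T y + xi - (T y - xi))); last first.
    by field; rewrite !lt0r_neq0.
  apply: (@is_derive_norm_le _ X chi) => [|s|s]; first by move: xi0; lra.
    by move=> sct; apply: dX; rewrite ler_norml; move: sct xi0 xi1; rewrite Tp; lra.
  by move=> sct; apply: HB; rewrite ler_norml; move: sct xi0; lra.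
Unshelve. all: by end_near. Qed.

End transfer_step.

(** * Contraction of primitives in the weighted norm *)

Section weight_estimates.
Context {R : realType}.
Implicit Types (x y z t s c B M : R) (h chi E : R -> R).
Variables (a g r xi : R).
Hypotheses (a2 : 2 < a) (ga : 1 - a^-1 <= g) (g1 : g < 1) (r0 : 0 < r)
  (xi0 : 0 < xi) (xi1 : xi <= 2^-1).
Notation T := (unimodal_map a 1).
Let e := r * xi.
Let rho := (r * e) `^ a^-1.
(** The constant of the noiseless expansion, times [1 + 2/r] for the variation of the weight across
    a noise window when [e = r xi]. *)
Definition contraction_rate := (2 * a) `^ (g - 1) * (1 + (2 * r)^-1) * (1 + 2 / r).
Notation q := contraction_rate.

Let a0 : 0 < a. Proof. exact: lt_trans a2. Qed.
Let e0 : 0 < e. Proof. exact: mulr_gt0. Qed.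

Let g0 : 0 < g. Proof. exact: (exponent_gt0 a2 ga). Qed.

Lemma contraction_rate_gt0 : 0 < q.
Proof.
by rewrite !mulr_gt0 ?powR_gt0 ?mulr_gt0// addr_gt0// ?invr_gt0 ?divr_gt0// mulr_gt0.
Qed.

Lemma powR_pred x p : 0 < x -> x `^ p = x * x `^ (p - 1).
Proof.
move=> x0; rewrite powRB ?powRr1 ?(ltW x0)// ?lt0r_neq0 ?implybT//.
by rewrite mulrC divfK// lt0r_neq0.
Qed.

Lemma powR_le_self x : 1 <= x -> x `^ g <= x.
Proof.
move=> x1; have x0 : 0 < x by exact: lt_le_trans x1.
by have := ler_powR x1 (ltW g1); rewrite powRr1// ltW.
Qed.

Lemma powR_ge_self x : 0 <= x <= 1 -> x <= x `^ g.
Proof.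
move=> /andP[]; rewrite le_eqVlt => /predU1P[<- _|x0 x1]; first exact: powR_ge0.
by apply: ger1_powR; [rewrite x0|exact: ltW].
Qed.

Lemma fold_itv s : `|s| <= 2 -> 0 <= fold s <= 1.
Proof.
have s0 := normr_ge0 s.
by rewrite /fold => s2; case: (ler0P (`|s| - 1)) => h; apply/andP; split; lra.
Qed.

(** Since [fold s >= |t| - xi], the base of the weight grows by at most [2 xi = (2 / r) e]. *)
Lemma weight_fold_near s t : `|t| <= 1 -> `|s - t| <= xi ->
  weight g e (fold s) <= (1 + 2 / r) * weight g e t.
Proof.
move=> t1 st.
have sn : `|s| <= `|t| + xi.
  by rewrite -[s](subrK t) [leRHS]addrC (le_trans (ler_normD _ _))// lerD2r.
have tn : `|t| <= `|s| + xi.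
  by rewrite -[t](subrK s) [leRHS]addrC (le_trans (ler_normD _ _))// lerD2r distrC.
have s2 : `|s| <= 2 by move: sn t1 xi1; lra.
have /andP[f0 f1] := fold_itv s2.
have tf : `|t| - fold s <= xi.
  by rewrite /fold; case: (ler0P (`|s| - 1)) => h; move: h sn tn t1; lra.
have t2 : 1 - t ^+ 2 = 1 - `|t| ^+ 2 by rewrite real_normK// num_real.
have w0 : e <= 1 - t ^+ 2 + e.
  by rewrite lerDr t2 subr_ge0 expr_le1.
have w1 : 0 < 1 - t ^+ 2 + e by exact: lt_le_trans w0.
have k1 : 1 <= 1 + 2 / r by rewrite lerDl divr_ge0// ltW.
have f2 : 0 < 1 - fold s ^+ 2 + e.
  by rewrite ltr_wpDl// subr_ge0 expr_le1.
apply: (@le_trans _ _ (((1 + 2 / r) * (1 - t ^+ 2 + e)) `^ g)).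
  apply: ge0_ler_powR; rewrite ?nnegrE ?(ltW f2) ?(ltW g0)// ?mulr_ge0 ?(ltW w1) ?(le_trans _ k1)//.
  have h1 : 2 * xi <= 2 / r * (1 - t ^+ 2 + e).
    rewrite (_ : 2 * xi = 2 / r * e); last by rewrite /e; field; rewrite lt0r_neq0.
    by rewrite ler_pM2l// divr_gt0.
  rewrite mulrDl mul1r; apply: le_trans (lerD (lexx _) h1).
  rewrite t2; move: (fold s) (`|t|) f0 f1 tf t1 (normr_ge0 t) xi0 => f u *; nra.
rewrite powRM ?(ltW w1) ?(le_trans _ k1)//.
by rewrite ler_wpM2r ?powR_ge0// powR_le_self.
Qed.

Lemma weight_fold_le s d : `|s| <= 2 -> `|s - 1| <= d -> weight g e (fold s) <= (2 * d + e) `^ g.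
Proof.
move=> s2 sd; have /andP[f0 f1] := fold_itv s2.
have fd : 1 - fold s <= d.
  apply: le_trans sd; rewrite /fold opprB addrC subrK.
  by have := ler_dist_dist s 1; rewrite normr1.
have f2 : 0 < 1 - fold s ^+ 2 + e.
  by rewrite ltr_wpDl// subr_ge0 expr_le1.
have fd2 : 1 - fold s ^+ 2 <= 2 * d by move: (fold s) f0 f1 fd => f *; nra.
apply: ge0_ler_powR; rewrite ?nnegrE ?(ltW f2) ?(ltW g0)// ?lerD2r//.
by rewrite (le_trans (ltW f2))// lerD2r.
Qed.

Lemma reflected_primitive_fold chi h s : reflected_primitive chi h -> `|s| <= 2 ->
  `|chi s| = `|chi (fold s)|.
Proof.
move=> hc s2.
have -> : `|chi s| = `|chi `|s| |.
  case: (ger0P s) => // _; rewrite (reflected_primitive_odd hc) ?normrN//.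
  by rewrite (le_lt_trans s2)// ltr_nat.
have [s1|s1] := leP `|s| 1; first by rewrite fold_norm_le.
have -> : fold s = 1 - (`|s| - 1) by rewrite /fold [X in 1 - X]ger0_norm// subr_ge0 ltW.
rewrite -[in LHS](subrK 1 `|s|) [in LHS](addrC _ 1) (reflected_primitive_refl hc) ?normrN//.
by rewrite ger0_norm ?subr_ge0 ?ltW//; lra.
Qed.

(** Where [y^a >= r e] the weighted bound is the expansion estimate. Below that, [y <= rho] and
    [chi2 y = y E y]: the factor [rho] beats the size [xi^(g - 1)] of [E] by assumption, and the
    weight is at least 1/2. *)
Lemma primitive_transfer_bound M chi h : 0 <= M -> rho <= 2^-1 ->
  rho * (8 + 2 * r) * xi `^ (g - 1) <= q / 2 ->
  reflected_primitive chi h ->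
  (forall y, 0 <= y <= 1 -> `|chi y| <= M * weight g e y) ->
  exists (chi2 h2 E : R -> R), [/\ reflected_primitive chi2 h2,
    forall y, 0 <= y <= 1 -> `|chi2 y| <= q * M * weight g e y,
    forall y, `|y| <= 1 -> {for y, continuous E},
    forall y, `|y| <= 1 -> `|E y| <= M * ((8 + 2 * r) * xi `^ (g - 1)) &
    forall y, `|y| <= 1 ->
      (chi (T y + xi) - chi (T y - xi)) / (2 * xi) = h2 y + (a - 1) * E y].
Proof.
move=> M0 rho1 rhoq hc Mchi.
have xi1' : xi <= 1 by move: xi1; lra.
have [chi2 [h2 [E [hc2 Ec chi2E idE [Esmall Elarge]]]]] := primitive_transfer a2 xi0 xi1' hc.
have chiw s : `|s| <= 2 -> `|chi s| <= M * weight g e (fold s).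
  move=> s2; rewrite (reflected_primitive_fold hc s2); apply: Mchi.
  exact: fold_itv.
have TS y : `|y| <= 1 -> `|T y| <= 1.
  by apply: (unimodal_selfmap a0 _).2; rewrite ltr01 lexx.
have K0 : 0 <= (8 + 2 * r) * xi `^ (g - 1).
  by rewrite mulr_ge0 ?powR_ge0// addr_ge0// mulr_ge0// ltW.
have xg := powR_pred g xi0.
have Eb y : `|y| <= 1 -> `|E y| <= M * ((8 + 2 * r) * xi `^ (g - 1)).
  move=> y1.
  have /andP[p0 p1] : 0 <= `|y| `^ a <= 1 by apply: powR_itv01; rewrite ?normr_ge0 ?y1.
  (* The relevant points are within [2 xi] of 1 in the first case, and within [2 p + xi <= 4 p] of 1
     in the second, with [p > xi / 2]. In both, the weight is of order the distance to the power
     [g], and dividing by that distance leaves [xi^(g - 1)]. *)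
  have [yxi|yxi] := leP (2 * `|y| `^ a) xi.
    apply: le_trans (Esmall y (M * (2 * (2 * xi) + e) `^ g) y1 yxi _) _.
      move=> s s1; have s2 : `|s| <= 2.
        by move: s1 xi1; rewrite !ler_norml; lra.
      by apply: le_trans (chiw _ s2) _; rewrite ler_wpM2l// weight_fold_le.
    rewrite -mulrA ler_wpM2l// (_ : 2 * (2 * xi) + e = (4 + r) * xi); last by rewrite /e; ring.
    have r4 : 1 <= 4 + r by move: r0; lra.
    rewrite powRM ?(ltW xi0) ?(le_trans _ r4)// xg.
    have -> : (4 + r) `^ g * (xi * xi `^ (g - 1)) / (a * xi) = (4 + r) `^ g / a * xi `^ (g - 1).
      by field; rewrite !lt0r_neq0.
    rewrite ler_wpM2r ?powR_ge0// ler_pdivrMr//.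
    apply: le_trans (powR_le_self r4) _.
    move: a2 r0; nra.
  have y0 : y != 0.
    apply: contraTN yxi => /eqP ->; rewrite normr0 powR0 ?lt0r_neq0// mulr0 -leNgt; exact: ltW.
  set p := `|y| `^ a in p0 p1 yxi *.
  have pgt0 : 0 < p by move: xi0 yxi; lra.
  have r8 : 1 <= 8 + 2 * r by move: r0; lra.
  apply: le_trans (Elarge y (M * (2 * (4 * p) + e) `^ g) y1 y0 _) _.
    move=> s sT; have Tp : T y = 1 - 2 * p by rewrite /unimodal_map mulr1.
    have s2 : `|s| <= 2.
      by move: sT xi1; rewrite Tp !ler_norml; move: p0 p1; lra.
    apply: le_trans (chiw _ s2) _; rewrite ler_wpM2l// weight_fold_le//.
    by move: sT; rewrite Tp !ler_norml; move: yxi; lra.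
  rewrite -/p -mulrA ler_wpM2l//.
  have : (2 * (4 * p) + e) `^ g <= (8 + 2 * r) * p `^ g.
    apply: (@le_trans _ _ (((8 + 2 * r) * p) `^ g)).
      have hp : e <= 2 * r * p by rewrite /e; move: yxi r0; nra.
      apply: ge0_ler_powR; rewrite ?nnegrE ?(ltW g0)// ?mulr_ge0 ?(le_trans _ r8)//.
        by rewrite addr_ge0 ?(ltW e0)// !mulr_ge0.
      by move: hp; lra.
    by rewrite powRM ?(le_trans _ r8)// ler_wpM2r ?powR_ge0// powR_le_self.
  rewrite (powR_pred g pgt0) => hb.
  have pxi : p `^ (g - 1) <= 2 * xi `^ (g - 1).
    have -> : g - 1 = - (1 - g) by ring.
    rewrite !powRN ler_pdivlMr ?powR_gt0// mulrC ler_pdivrMr ?(powR_gt0 _ pgt0)//.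
    apply: (@le_trans _ _ ((2 * p) `^ (1 - g))).
      by apply: ge0_ler_powR; rewrite ?nnegrE ?subr_ge0 ?(ltW g1) ?(ltW xi0) ?mulr_ge0 ?(ltW yxi).
    rewrite powRM// ler_wpM2r ?powR_ge0//.
    have -> : (2 : R) = 2 `^ 1 by rewrite powRr1.
    rewrite -powRrM mul1r; apply: ler_powR; first lra.
    by rewrite lerBlDr lerDl ltW.
  rewrite ler_pdivrMr ?mulr_gt0//; apply: le_trans hb _.
  rewrite (_ : (8 + 2 * r) * (p * _) = (8 + 2 * r) * p * p `^ (g - 1)); last by ring.
  rewrite (_ : _ * (2 * a * p) = (8 + 2 * r) * p * (2 * a * xi `^ (g - 1))); last by ring.
  rewrite ler_pM2l ?mulr_gt0// ?(lt_le_trans _ r8)//; apply: le_trans pxi _.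
  by rewrite ler_wpM2r ?powR_ge0//; move: a2; lra.
have q0 := contraction_rate_gt0.
exists chi2, h2, E; split => // y /andP[y0 y1].
rewrite chi2E ?y0// normrM ger0_norm//.
have y1' : `|y| <= 1 by rewrite ger0_norm.
have re0 : 0 < r * e by exact: mulr_gt0.
have [yre|yre] := leP (r * e) (y `^ a).
  have p0 : 0 < y `^ a by exact: lt_le_trans yre.
  have ygt0 : 0 < y.
    by rewrite lt0r y0 andbT; apply: contraTneq p0 => ->; rewrite powR0 ?ltxx ?lt0r_neq0.
  have ya := powR_pred a ygt0.
  apply: (@le_trans _ _ (y * (M * ((1 + 2 / r) * weight g e (T y)) / (2 * a * `|y| `^ a)))).
    rewrite ler_wpM2l//; apply: Elarge => //; first by rewrite lt0r_neq0.
    move=> s sT; have Ty1 := TS y y1'.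
    have s2 : `|s| <= 2.
      by move: sT xi1 Ty1; rewrite !ler_norml; lra.
    by apply: le_trans (chiw _ s2) _; rewrite ler_wpM2l// weight_fold_near.
  rewrite (ger0_norm y0) ya.
  have y01 : 0 <= y <= 1 by rewrite y0.
  have := unimodal_expansion a2 ga g1 e0 r0 y01 yre.
  set b := y `^ (a - 1); have b0 : 0 < b by exact: powR_gt0.
  set w := weight g e y; set w' := weight g e (T y) => hw.
  have -> : y * (M * ((1 + 2 / r) * w') / (2 * a * (y * b))) = M * (1 + 2 / r) / (2 * a * b) * w'.
    by field; rewrite !lt0r_neq0.
  have c0 : 0 <= M * (1 + 2 / r) / (2 * a * b).
    by rewrite !mulr_ge0 ?invr_ge0 ?mulr_ge0 ?addr_ge0 ?divr_ge0// ltW.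
  apply: le_trans (ler_wpM2l c0 hw) _; rewrite /contraction_rate.
  by rewrite le_eqVlt; apply/orP; left; apply/eqP; field; rewrite !lt0r_neq0.
have yrho : y <= rho.
  rewrite -[y]powRr1// -(mulfV (lt0r_neq0 a0)) powRrM; apply: ge0_ler_powR.
  - by rewrite invr_ge0 ltW.
  - by rewrite nnegrE powR_ge0.
  - by rewrite nnegrE ltW.
  - exact: ltW.
have w12 : 2^-1 <= weight g e y.
  have y2 : y <= 2^-1 := le_trans yrho rho1.
  apply: (@le_trans _ _ (2^-1 `^ g)).
    by apply: powR_ge_self; apply/andP; split; lra.
  have hy : 2^-1 <= 1 - y ^+ 2 + e by move: e0; nra.
  by apply: ge0_ler_powR; rewrite ?nnegrE ?(ltW g0) ?invr_ge0// (le_trans _ hy)// invr_ge0.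
apply: (@le_trans _ _ (rho * (M * ((8 + 2 * r) * xi `^ (g - 1))))).
  by apply: ler_pM => //; exact: Eb.
rewrite (_ : rho * _ = M * (rho * (8 + 2 * r) * xi `^ (g - 1))); last by ring.
apply: le_trans (ler_wpM2l M0 rhoq) _.
rewrite [leRHS](_ : _ = M * (q * weight g e y)); last by ring.
by apply: ler_wpM2l => //; rewrite ler_pM2l.
Qed.

End weight_estimates.

Section stationary_regularity.
Context {R : realType}.
Notation m := (@lebesgue_measure R).
Notation X := (measurableTypeR R).
Implicit Types (x y z t s c B M : R) (h k chi E : R -> R).
Variables (pi : R -> R).
Hypothesis (hpi : boundary_condition pi).
Notation P T xi := (transition (@noise R) (noisy_map pi T xi)).
Notation stat T xi mu := (stationary (@noise R) (noisy_map pi T xi) mu).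

Lemma reflected_primitive_density_fold chi h z : reflected_primitive chi h -> `|z| <= 2 ->
  h (fold z) = h z.
Proof.
move=> [_ he hr _ _] z2.
have -> : h z = h `|z| by case: (ger0P z) => // _; rewrite he.
have [z1|z1] := leP `|z| 1; first by rewrite fold_norm_le.
have -> : fold z = 1 - (`|z| - 1) by rewrite /fold [X in 1 - X]ger0_norm// subr_ge0 ltW.
rewrite -hr; first by congr h; ring.
by rewrite ger0_norm ?subr_ge0 ?(ltW z1)//; lra.
Qed.

(** The symmetries of [h] give [h (pi z) = h z] on the window, so the boundary condition drops out
    and the average is a difference of the primitive. *)
Lemma transition_reflected T xi chi h x : selfmap T -> 0 < xi -> xi <= 1 ->
  reflected_primitive chi h ->
  P T xi (fun x => h (clamp x)) x =
  (chi (T (clamp x) + xi) - chi (T (clamp x) - xi)) / (2 * xi).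
Proof.
move=> hT xi0 xi1 hc; have [ch he _ dchi _] := hc.
have bg : bmf (fun x : X => h (clamp x)) by apply: bmf_clamp => y _; exact: ch.
rewrite transition_noisyE// mulrC; congr (_ / _).
have := hT.2 _ (clamp_norm x); move: (T (clamp x)) => t; rewrite ler_norml => t1.
transitivity (\int[m]_(z in `[t - xi, t + xi]) h z).
  apply: eq_Rintegral => z; rewrite inE/= in_itv/= => zt.
  have z2 : `|z| <= 2 by rewrite ler_norml; lra.
  have fz := bc_norm hpi z2; rewrite -/(fold z) in fz.
  have p1 : `|pi z| <= 1 by rewrite fz; have /andP[] := fold_itv z2.
  rewrite clamp_id// -(reflected_primitive_density_fold hc z2) -fz.
  by case: (ger0P (pi z)) => // _; rewrite he.
rewrite /Rintegral; transitivity (fine (chi (t + xi) - chi (t - xi))%:E) => //.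
congr fine; apply: integral_is_derive; first lra.
  by move=> z _; exact: ch.
by move=> z zt; apply: dchi; lra.
Qed.

Section unimodal.
Variables (a g r xi : R).
Hypotheses (a2 : 2 < a) (ga : 1 - a^-1 <= g) (g1 : g < 1) (r0 : 0 < r)
  (xi0 : 0 < xi) (xi1 : xi <= 2^-1).
Notation T := (unimodal_map a 1).
Notation e := (r * xi).
Notation rho := ((r * e) `^ a^-1).
Notation q := (contraction_rate a g r).
Hypotheses (q1 : q < 1) (rho1 : rho <= 2^-1)
  (rhoq : rho * (8 + 2 * r) * xi `^ (g - 1) <= q / 2).
Variable mu : probability X R.
Hypothesis smu : stat T xi mu.

Let K := (8 + 2 * r) * xi `^ (g - 1).
Let a0 : 0 < a. Proof. exact: lt_trans a2. Qed.
Let hT : selfmap T. Proof. by apply: unimodal_selfmap => //; rewrite ltr01 lexx. Qed.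
Let mphi := measurable_noisy_map hpi hT.1 xi.
Let xi1' : xi <= 1. Proof. by move: xi1; lra. Qed.
Let q0 : 0 < q. Proof. exact: contraction_rate_gt0. Qed.

(* Stationarity turns [h] into [h2 + (a - 1) E]; iterating contracts the primitive by q. *)
Lemma reflected_bound_iter n chi h M : 0 <= M -> reflected_primitive chi h ->
  (forall y, 0 <= y <= 1 -> `|chi y| <= M * weight g e y) ->
  `|\int[mu]_x h (clamp x)| <=
  M * (q ^+ n * ((6 + e) `^ g / xi) + (a - 1) * K / (1 - q)).
Proof.
have K0 : 0 <= (a - 1) * K.
  rewrite mulr_ge0//; first by move: a2; lra.
  by rewrite mulr_ge0 ?powR_ge0// addr_ge0// mulr_ge0// ltW.
have q1' : 0 < 1 - q by rewrite subr_gt0.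
elim: n chi h M => [|n IH] chi h M M0 hc Mchi.
  have [ch _ _ _ _] := hc.
  have bg : bmf (fun x : X => h (clamp x)) by apply: bmf_clamp => y _; exact: ch.
  rewrite -(stationary_Rintegral mphi smu bg) ler_norml.
  apply: Rintegral_bounds => [|x]; first exact: bmf_transition.
  rewrite -ler_norml (transition_reflected _ hT xi0 xi1' hc).
  rewrite normrM [X in _ * X]gtr0_norm ?invr_gt0 ?mulr_gt0// ler_pdivrMr ?mulr_gt0//.
  have Tx1 := hT.2 _ (clamp_norm x); set t := T (clamp x) in Tx1 *.
  (* No contraction yet: points of modulus at most 2 are within 3 of 1, whence [6 + e]. *)
  have H s : `|s - t| <= xi -> `|chi s| <= M * (6 + e) `^ g.
    move=> st; have s2 : `|s| <= 2 by move: st Tx1 xi1'; rewrite !ler_norml; lra.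
    have /andP[f0 f1] := fold_itv s2.
    rewrite (reflected_primitive_fold hc s2); apply: le_trans (Mchi _ (fold_itv s2)) _.
    rewrite ler_wpM2l//.
    have := @weight_fold_le _ a g r xi a2 ga r0 xi0 s 3 s2.
    rewrite (_ : 2 * 3 = 6 :> R); last by ring.
    by apply; move: s2; rewrite !ler_norml; lra.
  apply: le_trans (ler_normB _ _) _.
  have h1 := H (t + xi); have h2 := H (t - xi).
  rewrite addrAC subrr add0r gtr0_norm// in h1.
  rewrite addrAC subrr sub0r normrN gtr0_norm// in h2.
  apply: le_trans (lerD (h1 (lexx _)) (h2 (lexx _))) _.
  rewrite expr0 mul1r mulrDr mulrDl.
  rewrite [X in _ <= X + _](_ : _ = M * (6 + e) `^ g + M * (6 + e) `^ g); last first.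
    by field; rewrite lt0r_neq0.
  rewrite lerDl; apply: mulr_ge0; last by rewrite mulr_ge0// ltW.
  by rewrite mulr_ge0// divr_ge0// ltW.
have [chi2 [h2 [E [hc2 chi2M Ec EM idE]]]] :=
  primitive_transfer_bound a2 ga g1 r0 xi0 xi1 M0 rho1 rhoq hc Mchi.
have [ch _ _ _ _] := hc.
have bg : bmf (fun x : X => h (clamp x)) by apply: bmf_clamp => y _; exact: ch.
have bg2 : bmf (fun x : X => h2 (clamp x)).
  by have [ch2 _ _ _ _] := hc2; apply: bmf_clamp => y _; exact: ch2.
have bE : bmf (fun x : X => E (clamp x)) by exact: bmf_clamp.
rewrite -(stationary_Rintegral mphi smu bg).
have -> : \int[mu]_x P T xi (fun x => h (clamp x)) x =
    \int[mu]_x h2 (clamp x) + (a - 1) * \int[mu]_x E (clamp x).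
  rewrite -RintegralZl//; last exact: bmf_integrable.
  rewrite -RintegralD//; last 2 first.
  - exact: bmf_integrable.
  - exact: (bmf_integrable _ (bmfZ _ bE)).
  by apply: eq_Rintegral => x _; rewrite (transition_reflected _ hT xi0 xi1' hc) idE ?clamp_norm.
apply: le_trans (ler_normD _ _) _.
have qM : 0 <= q * M by rewrite mulr_ge0// ltW.
have h1 := IH chi2 h2 (q * M) qM hc2 chi2M.
have h3 : `|(a - 1) * \int[mu]_x E (clamp x)| <= M * ((a - 1) * K).
  have a1 : 0 <= a - 1 by move: a2; lra.
  rewrite normrM ger0_norm// mulrCA ler_wpM2l// ler_norml.
  by apply: Rintegral_bounds => // x; rewrite -ler_norml; apply: EM; exact: clamp_norm.
apply: le_trans (lerD h1 h3) _.
rewrite exprS le_eqVlt; apply/orP; left; apply/eqP.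
by field; rewrite !lt0r_neq0.
Qed.

(** The initial term carries [q ^+ n] and disappears in the limit, with its factor [1 / xi]; only
    the geometric series remains. *)
Lemma reflected_bound chi h M : 0 <= M -> reflected_primitive chi h ->
  (forall y, 0 <= y <= 1 -> `|chi y| <= M * weight g e y) ->
  `|\int[mu]_x h (clamp x)| <= M * ((a - 1) * K / (1 - q)).
Proof.
move=> M0 hc Mchi; set C := (a - 1) * K / (1 - q); set I := `|_|.
have H n := @reflected_bound_iter n chi h M M0 hc Mchi.
set K0 := (6 + e) `^ g / xi in H.
have lim : (M * (q ^+ n * K0 + C) @[n --> \oo] --> M * (0 * K0 + C))%classic.
  apply: cvgM; first exact: cvg_cst.
  apply: cvgD; last exact: cvg_cst.
  apply: cvgM; last exact: cvg_cst.
  by apply: cvg_expr; rewrite gtr0_norm.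
rewrite mul0r add0r in lim.
apply: (ler_cvg_to (cvg_cst I) lim).
exact: nearW.
Qed.

(** Subtracting the mean of [k] over [0, 1] makes the primitive vanish at 1. Monotonicity of [k]
    bounds the corrected primitive by [mean * (1 - y)], and [1 - y] is at most the weight, so [mean]
    serves as weighted norm. *)
Lemma stationary_mean_le k (F : R -> R) : (forall x, k (- x) = k x) ->
  (forall y, `|y| <= 1 -> {for y, continuous k}) ->
  (forall x y, 0 <= x -> x <= y -> y <= 1 -> k y <= k x) -> 0 <= k 1 ->
  (forall x, 0 <= x <= 1 -> is_derive x 1 F (k x)) ->
  \int[mu]_x k (clamp x) <= (F 1 - F 0) * (1 + (a - 1) * K / (1 - q)).
Proof.
move=> ke kc kd k1 dF.
have k0 x : 0 <= x <= 1 -> 0 <= k x by move=> /andP[x0 x1]; apply: le_trans k1 _; exact: kd.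
have [chi [hc he hr dchi chi0]] := reflected_profile ke kc.
set h := (fun z => _) in hc he hr dchi.
have hk y : `|y| <= 1 -> h y = k y.
  move=> y1; rewrite /h fold_norm_le// clamp_id ?normr_id//.
  by case: (ger0P y) => // _; rewrite ke.
set mean := F 1 - F 0.
have chiF x : 0 <= x <= 1 -> chi x = F x - F 0.
  move=> /andP[x0 x1]; have : chi 0 - F 0 = chi x - F x.
    apply: (@is_derive0_eq _ (fun x => chi x - F x)) => // z /andP[z0 zx].
    have z1 : `|z| <= 1 by rewrite ger0_norm// (le_trans zx).
    apply: (is_derive_eq (is_deriveB (dchi z _) (dF z _))); first by move: z0 zx x1; lra.
      by rewrite z0 (le_trans zx).
    by apply/eqP; rewrite subr_eq0; apply/eqP; exact: hk.
  by rewrite chi0; lra.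
have Fm x y : 0 <= x -> x <= y -> y <= 1 ->
    (y - x) * k y <= F y - F x /\ F y - F x <= (y - x) * k x.
  move=> x0 xy y1; split.
    have : F x - k y * x <= F y - k y * y; last by lra.
    apply: (@is_derive_ge0_le _ (fun z => F z - k y * z) (fun z => k z - k y * 1)) => // z /andP[xz zy].
      apply: (is_deriveB (dF z _) (is_deriveZ (k y) (is_derive_id z 1))).
      by rewrite (le_trans x0)//= (le_trans zy).
    by rewrite mulr1 subr_ge0 kd// (le_trans x0).
  have : k x * x - F x <= k x * y - F y; last by lra.
  apply: (@is_derive_ge0_le _ (fun z => k x * z - F z) (fun z => k x * 1 - k z)) => // z /andP[xz zy].
    apply: (is_deriveB (is_deriveZ (k x) (is_derive_id z 1)) (dF z _)).
    by rewrite (le_trans x0)//= (le_trans zy).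
  by rewrite mulr1 subr_ge0 kd// (le_trans zy).
have mean0 : 0 <= mean.
  have [h1 _] := Fm 0 1 (lexx _) ler01 (lexx _); move: h1 k1; rewrite -/mean; lra.
have hc2 : reflected_primitive (fun x => chi x - mean * x) (fun x => h x - mean).
  split.
  - by move=> x; apply: cvgB; [exact: hc|exact: cvg_cst].
  - by move=> x; congr (_ - _); exact: he.
  - by move=> t t2; congr (_ - _); exact: hr.
  - move=> x x4; apply: (is_derive_eq (is_deriveB (dchi x x4) (is_deriveZ mean (is_derive_id x 1)))).
    by rewrite /GRing.scale/= mulr1.
  - by rewrite chi0 mulr0 subr0 chiF ?lexx ?ler01// mulr1 subrr.
have Mchi y : 0 <= y <= 1 -> `|chi y - mean * y| <= mean * weight g e y.
  move=> y01; have /andP[y0 y1] := y01.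
  have w1 : 1 - y <= weight g e y.
    have e0 : 0 < e by exact: mulr_gt0.
    have g0 := exponent_gt0 a2 ga.
    apply: (@le_trans _ _ ((1 - y) `^ g)).
      by apply: powR_ge_self => //; apply/andP; split; lra.
    have hy : 1 - y <= 1 - y ^+ 2 + e by move: e0; nra.
    by apply: ge0_ler_powR; rewrite ?nnegrE ?(ltW g0) ?subr_ge0// (le_trans _ hy)// subr_ge0.
  apply: le_trans (ler_wpM2l mean0 w1); rewrite chiF//.
  have [h1 h2] := Fm 0 y (lexx _) y0 y1.
  have [h3 h4] := Fm y 1 y0 y1 (lexx _).
  rewrite subr0 in h1 h2.
  have ky := k0 y y01.
  have meanE : mean = (F y - F 0) + (F 1 - F y) by rewrite /mean; ring.
  move: h1 h2 h3 h4 k1 ky mean0; rewrite meanE ler_norml.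
  move: (F y - F 0) (F 1 - F y) (k y) (k 1) => A B c d *; apply/andP; split; nra.
have := reflected_bound mean0 hc2 Mchi.
have bk : bmf (fun x : X => k (clamp x)) by exact: bmf_clamp.
have -> : \int[mu]_x (h (clamp x) - mean) = \int[mu]_x k (clamp x) - mean.
  rewrite -[in RHS](@Rintegral_probability_cst _ X R mu mean) -RintegralB//; last 2 first.
  - exact: bmf_integrable.
  - exact: (bmf_integrable _ (bmf_cst _ _)).
  by apply: eq_Rintegral => x _; rewrite hk ?clamp_norm.
rewrite ler_norml => /andP[_]; move: (_ / _) => C; lra.
Qed.

End unimodal.
End stationary_regularity.

(** * Positive Lyapunov exponent at small noise *)

Section small_noise.
Context {R : realType}.
Notation m := (@lebesgue_measure R).
Notation X := (measurableTypeR R).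
Implicit Types (x y z t s c B M : R).
Variables (pi : R -> R).
Hypothesis (hpi : boundary_condition pi).
Notation P T xi := (transition (@noise R) (noisy_map pi T xi)).
Notation stat T xi mu := (stationary (@noise R) (noisy_map pi T xi) mu).

Lemma transition_window_ge T xi (h : X -> R) x L : selfmap T -> 0 < xi -> bmf h ->
  (forall z, `|z - T (clamp x)| <= xi -> L <= h (pi z)) -> L <= P T xi h x.
Proof.
move=> hT xi0 bh hL; rewrite transition_noisyE//.
have bhpi := bmf_bc hpi bh.
set t := T (clamp x) in hL *.
rewrite [leLHS](_ : L = (2 * xi)^-1 * (L * (t + xi - (t - xi)))); last first.
  by field; rewrite lt0r_neq0.
rewrite ler_pM2l ?invr_gt0 ?mulr_gt0//.
rewrite -(@Rintegral_itv_cst R true false); last lra.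
apply: le_Rintegral => //.
- exact: (bmf_integrable_itv (bmf_cst _ _) (lebesgue_itv_lty _ _ _ _)).
- exact: (bmf_integrable_itv bhpi (lebesgue_itv_lty _ _ _ _)).
- by move=> z /=; rewrite in_itv/= => zt; apply: hL; rewrite ler_norml; lra.
Qed.

Section unimodal.
Variables (a g r xi : R).
Hypotheses (a2 : 2 < a) (ga : 1 - a^-1 <= g) (g1 : g < 1) (r0 : 0 < r)
  (xi0 : 0 < xi) (xi1 : xi <= 2^-1).
Notation T := (unimodal_map a 1).
Notation e := (r * xi).
Notation rho := ((r * e) `^ a^-1).
Notation q := (contraction_rate a g r).
Hypotheses (q1 : q < 1) (rho1 : rho <= 2^-1)
  (rhoq : rho * (8 + 2 * r) * xi `^ (g - 1) <= q / 2).

Let K := (8 + 2 * r) * xi `^ (g - 1).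
Let a0 : 0 < a. Proof. exact: lt_trans a2. Qed.
Let e0 : 0 < e. Proof. exact: mulr_gt0. Qed.
Let hT : selfmap T. Proof. by apply: unimodal_selfmap => //; rewrite ltr01 lexx. Qed.
Let q0 : 0 < q. Proof. exact: contraction_rate_gt0. Qed.
Let g0 : 0 < g. Proof. exact: (exponent_gt0 a2 ga). Qed.
Let rho0 : 0 < rho. Proof. by rewrite powR_gt0 ?mulr_gt0. Qed.

Lemma weight_gt0 x : `|x| <= 1 -> 0 < weight g e x.
Proof.
move=> x1; rewrite powR_gt0// ltr_wpDl//.
by rewrite subr_ge0 -real_normK ?num_real// expr_le1.
Qed.

Lemma weight_norm x : weight g e `|x| = weight g e x.
Proof. by rewrite /weight real_normK// num_real. Qed.

Lemma weight_anti x y : 0 <= x -> x <= y -> y <= 1 -> weight g e y <= weight g e x.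
Proof.
move=> x0 xy y1; have y0 := le_trans x0 xy.
have h1 : 0 <= 1 - y ^+ 2 by rewrite subr_ge0 expr_le1.
have h2 : y ^+ 2 >= x ^+ 2 by rewrite lerXn2r.
by apply: ge0_ler_powR; rewrite ?nnegrE ?(ltW g0)//; move: e0; lra.
Qed.

(* v is |clamp x| away from 0, and rho, the radius of the critical neighbourhood, otherwise. *)
Lemma weight_image x : exists v, [/\ 0 < v, Num.min (nlog x) (- ln rho) <= - ln v &
  (1 + 2 / r) * weight g e (T (clamp x)) <=
    q * (2 * a * v `^ (a - 1)) * weight g e (clamp x)].
Proof.
have y1 := clamp_norm x; set y := clamp x in y1 *.
have TE : T y = T `|y| by rewrite /unimodal_map normr_id.
have r2 : 0 < 1 + 2 / r by rewrite addr_gt0// divr_gt0.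
have re0 : 0 < r * e by exact: mulr_gt0.
have rhoa : rho `^ a = r * e by rewrite -powRrM mulVf ?lt0r_neq0// powRr1// ltW.
have key v : 0 <= v <= 1 -> r * e <= v `^ a -> weight g e (T y) <= weight g e (T v) ->
    weight g e v <= weight g e y ->
    (1 + 2 / r) * weight g e (T y) <= q * (2 * a * v `^ (a - 1)) * weight g e y.
  move=> v01 vre h1 h2; have h3 := unimodal_expansion a2 ga g1 e0 r0 v01 vre.
  have c0 : 0 <= q * (2 * a * v `^ (a - 1)).
    by apply: mulr_ge0; [exact: ltW|rewrite mulr_ge0 ?powR_ge0// mulr_ge0// ltW].
  apply: le_trans (ler_wpM2l c0 h2).
  rewrite [leRHS](_ : _ = (1 + 2 / r) * ((2 * a) `^ (g - 1) * (1 + (2 * r)^-1) *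
    (2 * a * v `^ (a - 1)) * weight g e v)); last by rewrite /contraction_rate; ring.
  by apply: ler_wpM2l; [exact: ltW|exact: le_trans h1 h3].
have [yre|yre] := leP (r * e) (`|y| `^ a).
  have y0 : 0 < `|y|.
    rewrite lt0r normr_ge0 andbT; apply: contraTN yre => /eqP ->.
    by rewrite powR0 ?lt0r_neq0// -ltNge.
  exists `|y|; split => //; first by rewrite /nlog ge_min lexx.
  by apply: key; [rewrite normr_ge0 y1|exact: yre|rewrite -TE|rewrite weight_norm].
exists rho; split => //; first by rewrite ge_min lexx orbT.
have yrho : `|y| <= rho.
  rewrite leNgt; apply/negP => h; move: yre; rewrite ltNge => /negP; apply.
  rewrite -rhoa; apply: ge0_ler_powR.
  - exact: ltW.
  - by rewrite nnegrE ltW.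
  - by rewrite nnegrE.
  - exact: ltW.
have rho11 : rho <= 1 by move: rho1; lra.
have re2 : r * e <= 2^-1.
  by rewrite -rhoa; apply: le_trans rho1; apply: ge1r_powR; rewrite ?rho0//; move: a2; lra.
apply: key.
- by rewrite (ltW rho0) rho11.
- by rewrite rhoa.
- rewrite /unimodal_map (gtr0_norm rho0) rhoa !mulr1.
  have p0 : 0 <= `|y| `^ a by exact: powR_ge0.
  by apply: weight_anti; move: re2 yre p0; lra.
- by rewrite -(weight_norm y); apply: weight_anti; rewrite ?normr_ge0.
Qed.

Lemma bmf_Nln_weight : bmf (fun x : X => - ln (weight g e (clamp x))).
Proof.
apply: (bmf_clamp (f := fun y => - ln (weight g e y))) => y yn.
have base0 : 0 < 1 - y ^+ 2 + e.
  by rewrite ltr_wpDl// subr_ge0 -real_normK ?num_real// expr_le1.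
have cw : {for y, continuous (weight g e)}.
  apply: (@continuous_powR_gt0 _ (fun y => 1 - y ^+ 2 + e)) => //.
  apply: cvgD; last exact: cvg_cst.
  by apply: cvgB; [exact: cvg_cst|exact: exprn_continuous].
by apply: cvgN; exact: (continuous_comp cw (continuous_ln (weight_gt0 yn))).
Qed.

(* The coboundary of - ln weight makes the truncated ln |T'| uniformly positive. *)
Lemma expansion_pointwise x :
  - ln q <= ln (2 * a) - (a - 1) * Num.min (nlog x) (- ln rho) +
    P T xi (fun x => - ln (weight g e (clamp x))) x - - ln (weight g e (clamp x)).
Proof.
have [v [v0 minv hv]] := weight_image x.
have y1 := clamp_norm x; have Ty1 := hT.2 _ y1.
have w0 := weight_gt0 y1; have wT0 := weight_gt0 Ty1.
have r2 : 0 < 1 + 2 / r by rewrite addr_gt0// divr_gt0.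
have bphi := bmf_Nln_weight.
have hL : - ln ((1 + 2 / r) * weight g e (T (clamp x))) <=
    P T xi (fun x => - ln (weight g e (clamp x))) x.
  apply: transition_window_ge => // z zT; rewrite lerN2.
  have z2 : `|z| <= 2 by move: zT Ty1 xi1; rewrite !ler_norml; lra.
  have fz := bc_norm hpi z2; rewrite -/(fold z) in fz.
  have p1 : `|pi z| <= 1 by rewrite fz; have /andP[] := fold_itv z2.
  rewrite clamp_id// ler_ln ?posrE ?mulr_gt0 ?weight_gt0//.
  by rewrite -weight_norm fz; exact: (weight_fold_near a2 ga g1 r0 xi0 xi1 Ty1 zT).
have va : 0 < v `^ (a - 1) by exact: powR_gt0.
have hv' : ln ((1 + 2 / r) * weight g e (T (clamp x))) <=
    ln q + (ln (2 * a) + (a - 1) * ln v) + ln (weight g e (clamp x)).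
  have a20 : 0 < 2 * a by rewrite mulr_gt0.
  have c0 : 0 < 2 * a * v `^ (a - 1) by exact: mulr_gt0.
  have d0 : 0 < q * (2 * a * v `^ (a - 1)) by exact: mulr_gt0.
  have f0 : 0 < (1 + 2 / r) * weight g e (T (clamp x)) by exact: mulr_gt0.
  have h0 : 0 < q * (2 * a * v `^ (a - 1)) * weight g e (clamp x) by exact: mulr_gt0.
  have := hv; rewrite -(ler_ln f0 h0) (lnM d0 w0) (lnM q0 c0) (lnM a20 va).
  by rewrite ln_powR.
have a1 : 0 <= a - 1 by move: a2; lra.
have := ler_wpM2l a1 minv.
move: hL hv'; move: (P T xi _ x) (ln (weight _ _ _)) (ln v) (Num.min _ _) (ln ((1 + _) * _)) (ln q) (ln (2 * a)).
by move=> p w l mn A B C; lra.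
Qed.

Let Nlnrho0 : 0 <= - ln rho.
Proof. by rewrite oppr_ge0 ln_le0//; move: rho1; lra. Qed.

(** The pointwise bound is integrated; the coboundary has mean 0 by stationarity, which leaves the
    gain [ln q]. *)
Lemma mean_truncated_nlog_le (mu : probability X R) : stat T xi mu ->
  (a - 1) * \int[mu]_x Num.min (nlog x) (- ln rho) <= ln (2 * a) + ln q.
Proof.
move=> smu; have bmin := bmf_min_nlog Nlnrho0.
have mphi := measurable_noisy_map hpi hT.1 xi.
have bphi := bmf_Nln_weight.
have bP := bmf_transition (@noise R) mphi bphi.
set I := \int[mu]_x _.
pose G (x : X) := P T xi (fun x => - ln (weight g e (clamp x))) x - - ln (weight g e (clamp x)).
have bG : bmf G by exact: bmfB.
have G0 : \int[mu]_x G x = 0.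
  rewrite RintegralB//; last 2 first.
  - exact: bmf_integrable.
  - exact: bmf_integrable.
  by rewrite (stationary_Rintegral mphi smu bphi) subrr.
have : \int[mu]_x (- ln q) <= \int[mu]_x ((ln (2 * a) - (a - 1) * Num.min (nlog x) (- ln rho)) + G x).
  apply: le_Rintegral => //.
  - exact: (bmf_integrable _ (bmf_cst _ _)).
  - by apply: bmf_integrable; apply: bmfD => //; apply: bmfB; [exact: bmf_cst|exact: bmfZ].
  - by move=> x _; rewrite /G addrA; exact: expansion_pointwise.
rewrite Rintegral_probability_cst RintegralD//; last 2 first.
- by apply: bmf_integrable; apply: bmfB; [exact: bmf_cst|exact: bmfZ].
- exact: bmf_integrable.
rewrite G0 RintegralB//; last 2 first.
- exact: (bmf_integrable _ (bmf_cst _ _)).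
- exact: (bmf_integrable _ (bmfZ _ bmin)).
rewrite Rintegral_probability_cst RintegralZl//; last exact: bmf_integrable.
by rewrite -/I; lra.
Qed.

Lemma ln_le_sqrt s : 0 < s -> ln s <= 2 * s `^ 2^-1.
Proof.
move=> s0; have : ln (s `^ 2^-1) <= s `^ 2^-1 by rewrite ltW// ln_sublinear// powR_gt0.
by rewrite ln_powR; lra.
Qed.

(** The excess over [- ln rho] is at most [ln (2 rho / (|x| + exp (- M)))], traded for a square
    root: an even function, decreasing in [|x|], with integral bounded uniformly in [M]. The term
    [exp (- M)] keeps it continuous at 0, as [stationary_mean_le] requires. *)
Lemma min_nlog_le x M : 0 <= M ->
  Num.min (nlog x) M <= Num.min (nlog x) (- ln rho) +
    2 * (2 * rho) `^ 2^-1 * (`|clamp x| + expR (- M)) `^ (- 2^-1).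
Proof.
move=> M0; set k := 2 * _ * _.
have k0 : 0 <= k by rewrite !mulr_ge0 ?powR_ge0.
have n0 := nlog_ge0 x.
have h1 : Num.min (nlog x) M <= nlog x + k.
  by apply: (@le_trans _ _ (nlog x)); rewrite ?ge_min ?lexx// lerDl.
suff h2 : Num.min (nlog x) M <= - ln rho + k.
  by rewrite -lerBlDr le_min !lerBlDr h1.
(* At 0 the convention gives [nlog 0 = 0], so the bound only needs nonnegativity. *)
rewrite /k /nlog; have [->|u0] := eqVneq (clamp x) 0.
  rewrite normr0 ln0// oppr0 add0r min_l// addr_ge0//.
  by rewrite !mulr_ge0 ?powR_ge0.
set u := `|clamp x|; have {u0} ugt0 : 0 < u by rewrite normr_gt0.
set d := expR (- M); have d0 : 0 < d by exact: expR_gt0.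
have ud0 : 0 < u + d by exact: addr_gt0.
set w := Num.max u d; have w0 : 0 < w by rewrite lt_max ugt0.
have uw : u + d <= 2 * w.
  by have : u <= w by [rewrite le_max lexx]; have : d <= w by [rewrite le_max lexx orbT]; lra.
apply: (@le_trans _ _ (- ln w)).
  rewrite /w; case: (leP u d) => _; last by rewrite ge_min lexx.
  by rewrite /d expRK opprK ge_min lexx orbT.
rewrite addrC -lerBlDr opprK.
have s0 : 0 < 2 * rho / (u + d) by rewrite divr_gt0// mulr_gt0.
have -> : - ln w + ln rho = ln (rho / w) by rewrite ln_div ?posrE// addrC.
apply: (@le_trans _ _ (ln (2 * rho / (u + d)))).
  rewrite (ler_ln (divr_gt0 rho0 w0) s0) ler_pdivrMr// mulrAC ler_pdivlMr//.
  by rewrite [leRHS](_ : _ = rho * (2 * w)) ?ler_pM2l//; ring.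
apply: le_trans (ln_le_sqrt s0) _.
rewrite powRM ?mulr_ge0 ?invr_ge0 ?(ltW rho0) ?(ltW ud0)// mulrA.
by rewrite -(powR_inv1 (ltW ud0)) -powRrM mulN1r.
Qed.

Lemma mean_nlog_le (mu : probability X R) : stat T xi mu ->
  mean_nlog mu <= (ln (2 * a) + ln q) / (a - 1) +
    8 * rho `^ 2^-1 * (1 + (a - 1) * K / (1 - q)).
Proof.
move=> smu; have a1 : 0 < a - 1 by move: a2; lra.
set C := 1 + _; set A := _ / (a - 1).
have C0 : 0 <= C.
  rewrite addr_ge0// divr_ge0 ?subr_ge0 ?(ltW q1)// mulr_ge0 ?(ltW a1)//.
  by rewrite mulr_ge0 ?powR_ge0// addr_ge0// mulr_ge0// ltW.
apply/ler_addgt0Pr => eps eps0.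
pose c := (4 + 4 / xi) * 2.
have c0 : 0 < c by rewrite mulr_gt0// addr_gt0// divr_gt0.
(* [M = - ln d] makes the final truncation error at most [eps]; all other bounds are uniform in
   [d]. *)
pose d := Num.min 1 (eps / c).
have d0 : 0 < d by rewrite lt_min ltr01 divr_gt0.
have d1 : d <= 1 by rewrite ge_min lexx.
pose M := - ln d.
have M0 : 0 <= M by rewrite oppr_ge0 ln_le0.
have dE : expR (- M) = d by rewrite opprK lnK.
have [_ /andP[_]] := mean_nlog_truncate hpi hT xi0 smu M0.
rewrite dE (_ : (4 + 4 / xi) * (2 * d) = c * d) => [h1|]; last by rewrite /c; ring.
have cd : c * d <= eps by rewrite mulrC -ler_pdivlMr// ge_min lexx orbT.
pose k y := 2 * (2 * rho) `^ 2^-1 * (`|y| + d) `^ (- 2^-1).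
(* A primitive of [k] on [0, 1]; its increment is at most
   [4 (2 rho)^(1/2) 2^(1/2) = 8 rho^(1/2)]. *)
pose F y := 4 * (2 * rho) `^ 2^-1 * (y + d) `^ 2^-1.
have kc y : `|y| <= 1 -> {for y, continuous k}.
  move=> _; apply: cvgM; first exact: cvg_cst.
  apply: (@continuous_powR_gt0 _ (fun y => `|y| + d)); last by rewrite ltr_wpDl.
  by apply: cvgD; [exact: norm_continuous|exact: cvg_cst].
have kd x y : 0 <= x -> x <= y -> y <= 1 -> k y <= k x.
  move=> x0 xy y1; have y0 := le_trans x0 xy.
  rewrite /k ler_wpM2l ?mulr_ge0 ?powR_ge0//.
  have xd : 0 < x + d by rewrite ltr_wpDl.
  have yd : 0 < y + d by rewrite ltr_wpDl.
  rewrite !ger0_norm// !powRN lef_pV2 ?posrE ?powR_gt0//.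
  by apply: ge0_ler_powR; rewrite ?nnegrE ?invr_ge0 ?(ltW xd) ?(ltW yd) ?lerD2r.
have dF x : 0 <= x <= 1 -> is_derive x 1 F (k x).
  move=> /andP[x0 x1]; have xd : 0 < x + d by rewrite ltr_wpDl.
  have h := @is_derive1_comp _ (fun u => u `^ 2^-1) (fun y => y + d) x _ _
    (is_derive1_powR 2^-1 xd) (is_deriveD (is_derive_id x 1) (is_derive_cst d x 1)).
  apply: (is_derive_eq (is_deriveZ (4 * (2 * rho) `^ 2^-1) h)).
  rewrite /k ger0_norm// /GRing.scale/= (_ : 2^-1 - 1 = - 2^-1); last by field.
  by field.
have ke x : k (- x) = k x by rewrite /k normrN.
have k1 : 0 <= k 1 by rewrite !mulr_ge0 ?powR_ge0.
have h2 := stationary_mean_le hpi a2 ga g1 r0 xi0 xi1 q1 rho1 rhoq smu ke kc kd k1 dF.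
rewrite -/K -/C in h2.
have hF : F 1 - F 0 <= 8 * rho `^ 2^-1.
  have F0 : 0 <= F 0 by rewrite !mulr_ge0 ?powR_ge0.
  suff : F 1 <= 8 * rho `^ 2^-1 by lra.
  have h4 : (1 + d) `^ 2^-1 <= 2 `^ 2^-1.
    by apply: ge0_ler_powR; rewrite ?nnegrE ?invr_ge0 ?addr_ge0 ?(ltW d0)//; lra.
  have h5 : 0 <= 4 * (2 * rho) `^ 2^-1 by rewrite mulr_ge0 ?powR_ge0.
  apply: le_trans (ler_wpM2l h5 h4) _.
  rewrite powRM ?(ltW rho0)// (_ : 4 * _ * _ = 4 * (2 `^ 2^-1 * 2 `^ 2^-1) * rho `^ 2^-1); last by ring.
  rewrite -powRD; last by apply/implyP => _; rewrite lt0r_neq0.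
  rewrite (_ : 2^-1 + 2^-1 = 1); last by field.
  by rewrite powRr1// (_ : 4 * 2 = 8)//; ring.
have h3 : \int[mu]_x Num.min (nlog x) M <=
    \int[mu]_x Num.min (nlog x) (- ln rho) + \int[mu]_x k (clamp x).
  rewrite -RintegralD//; last 2 first.
  - exact: (bmf_integrable _ (bmf_min_nlog Nlnrho0)).
  - exact: (bmf_integrable _ (bmf_clamp kc)).
  apply: le_Rintegral => //.
  - exact: (bmf_integrable _ (bmf_min_nlog M0)).
  - apply: bmf_integrable; apply: bmfD; [exact: bmf_min_nlog|exact: bmf_clamp].
  - by move=> x _; rewrite /k -dE; exact: min_nlog_le.
have h4 : \int[mu]_x Num.min (nlog x) (- ln rho) <= A.
  by rewrite ler_pdivlMr// mulrC; exact: mean_truncated_nlog_le.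
have h5 := ler_wpM2r C0 hF.
have h6 := lerD (le_trans h3 (lerD h4 (le_trans h2 h5))) cd.
exact: (le_trans h1 h6).
Qed.

End unimodal.

(** The exponents of [xi] are [1/(2a)] and [- 1/(4a)], so the left side is a constant times
    [xi^(1/(4a))]. *)
Lemma noise_level_exists (a r eta : R) : 2 < a -> 0 < r -> 0 < eta ->
  exists xi, [/\ 0 < xi, xi <= 2^-1 &
    ((r * (r * xi)) `^ a^-1) `^ 2^-1 * xi `^ (1 - (4 * a)^-1 - 1) <= eta].
Proof.
move=> a2 r0 eta0; have a0 : 0 < a by exact: lt_trans a2.
pose w := eta / (r * r) `^ (2 * a)^-1.
have rr : 0 < (r * r) `^ (2 * a)^-1 by rewrite powR_gt0 ?mulr_gt0.
have w0 : 0 < w by exact: divr_gt0.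
pose xi := Num.min 2^-1 (w `^ (4 * a)).
have xi0 : 0 < xi by rewrite lt_min invr_gt0 ltr0n powR_gt0.
exists xi; split => //; first by rewrite ge_min lexx.
have xw : xi `^ (4 * a)^-1 <= w.
  apply: (@le_trans _ _ ((w `^ (4 * a)) `^ (4 * a)^-1)).
    apply: ge0_ler_powR; rewrite ?nnegrE ?invr_ge0 ?powR_ge0 ?(ltW xi0) ?mulr_ge0 ?(ltW a0)//.
    by rewrite ge_min lexx orbT.
  by rewrite -powRrM mulfV ?powRr1 ?(ltW w0)// lt0r_neq0// mulr_gt0.
rewrite mulrA -powRrM -invfM [a * 2]mulrC powRM ?mulr_ge0 ?(ltW r0) ?(ltW xi0)//.
have -> : 1 - (4 * a)^-1 - 1 = (4 * a)^-1 - (2 * a)^-1 by field; rewrite lt0r_neq0.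
rewrite -mulrA -powRD; last by apply/implyP => _; rewrite lt0r_neq0.
rewrite (_ : _ + (_ - _) = (4 * a)^-1); last by ring.
by rewrite [leLHS]mulrC -ler_pdivlMr.
Qed.

(* The error terms are of order xi^(1/(2a) + g - 1); g is chosen with 1 - g < 1 / (2a). *)
Lemma positive_lyapunov_small_noise (a : R) : 2 < a -> exists xi, [/\ 0 < xi, xi <= 2^-1 &
  forall mu : probability X R, stat (unimodal_map a 1) xi mu ->
    0 < ln (2 * a) - (a - 1) * mean_nlog mu].
Proof.
move=> a2; have a0 : 0 < a by exact: lt_trans a2.
have a1 : 0 < a - 1 by move: a2; lra.
pose g := 1 - (4 * a)^-1.
have ga : 1 - a^-1 <= g.
  by rewrite lerD2l lerN2 lef_pV2 ?posrE ?mulr_gt0//; lra.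
have g1 : g < 1 by rewrite ltrBlDr ltrDl invr_gt0 mulr_gt0.
pose q0 := (2 * a) `^ (g - 1).
have q00 : 0 < q0 by rewrite powR_gt0 ?mulr_gt0.
have q01 : q0 < 1.
  rewrite /q0 /g addrAC subrr sub0r powRN invf_lt1 ?powR_gt0 ?mulr_gt0//.
  have : 1 `^ (4 * a)^-1 < (2 * a) `^ (4 * a)^-1.
    by apply: gt0_ltr_powR; rewrite ?invr_gt0 ?mulr_gt0// ?nnegrE//; lra.
  by rewrite powR1.
(* With [r = 2 / t] the two corrections in the rate are [1 + t/4] and [1 + t], whose product is at
   most [1 + 3 t]; then [q0 (1 + 3 t) < 1]. *)
pose t := (1 - q0) / 4.
have t0 : 0 < t by rewrite /t; lra.
pose r := 2 / t; have r0 : 0 < r by exact: divr_gt0.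
pose q := contraction_rate a g r.
have qE : q = q0 * (1 + t / 4) * (1 + t).
  by rewrite /q /contraction_rate -/q0 /r; congr (_ * (1 + _) * (1 + _)); field; rewrite lt0r_neq0.
have qpos : 0 < q by rewrite qE !mulr_gt0// addr_gt0// divr_gt0.
have q1 : q < 1.
  rewrite qE -mulrA; have : (1 + t / 4) * (1 + t) <= 1 + 3 * t.
    by move: t0 q00; rewrite /t; nra.
  move=> h; apply: le_lt_trans (ler_wpM2l (ltW q00) h) _.
  by move: t0 q00 q01; rewrite /t; nra.
have Nq : 0 < - ln q by rewrite oppr_gt0 ln_lt0// qpos.
pose D := 1 + (a - 1) * (8 + 2 * r) / (1 - q).
have D1 : 1 <= D.
  rewrite lerDl divr_ge0 ?subr_ge0 ?(ltW q1)// mulr_ge0 ?(ltW a1)//.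
  by rewrite addr_ge0// mulr_ge0// ltW.
have D0 : 0 < D by exact: lt_le_trans D1.
(* The three bounds ensure [rho <= 1/2], the condition that [rho] beats [xi^(g - 1)], and a final
   error of at most half the gain [- ln q / (a - 1)]. *)
pose eta := Num.min 2^-1 (Num.min (q / (2 * (8 + 2 * r))) (- ln q / (a - 1) / (16 * D))).
have r8 : 0 < 8 + 2 * r by rewrite addr_gt0// mulr_gt0.
have eta0 : 0 < eta.
  by rewrite !lt_min invr_gt0 ltr0n/=; apply/andP; split; rewrite !divr_gt0// ?mulr_gt0.
have [xi [xi0 xi1 hxi]] := noise_level_exists a2 r0 eta0.
exists xi; split => // mu smu.
rewrite -/g in hxi; set rho := (r * (r * xi)) `^ a^-1 in hxi.
set s := rho `^ 2^-1 in hxi; set y := xi `^ (g - 1) in hxi.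
have s0 : 0 <= s by exact: powR_ge0.
have rhoE : rho = s * s.
  rewrite -powRD; last by apply/implyP; rewrite (_ : 2^-1 + 2^-1 = 1) ?oner_eq0//; field.
  by rewrite (_ : 2^-1 + 2^-1 = 1) ?powRr1 ?powR_ge0//; field.
have y1 : 1 <= y.
  rewrite /y -[g - 1]opprB powRN invf_ge1 ?powR_gt0//.
  have : xi `^ (1 - g) <= 1 `^ (1 - g).
    by apply: ge0_ler_powR; rewrite ?nnegrE ?subr_ge0 ?(ltW g1) ?(ltW xi0)//; lra.
  by rewrite powR1.
have sy : s <= s * y by rewrite ler_peMr.
have e1 : eta <= 2^-1 by rewrite ge_min lexx.
have e2 : (8 + 2 * r) * eta <= q / 2.
  have h : eta <= q / (2 * (8 + 2 * r)) by rewrite !ge_min lexx orbT.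
  apply: le_trans (ler_wpM2l (ltW r8) h) _.
  by rewrite le_eqVlt; apply/orP; left; apply/eqP; field; rewrite lt0r_neq0.
have e3 : 8 * D * eta <= - ln q / (a - 1) / 2.
  have h : eta <= - ln q / (a - 1) / (16 * D) by rewrite !ge_min lexx !orbT.
  have D8 : 0 <= 8 * D by rewrite mulr_ge0// ltW.
  apply: le_trans (ler_wpM2l D8 h) _.
  by rewrite le_eqVlt; apply/orP; left; apply/eqP; field; rewrite !lt0r_neq0.
have s12 : s <= 2^-1 by exact: le_trans sy (le_trans hxi e1).
have rho1 : rho <= 2^-1 by rewrite rhoE; move: s0 s12; nra.
have rhoq : rho * (8 + 2 * r) * y <= q / 2.
  apply: le_trans e2; rewrite rhoE.
  rewrite (_ : s * s * (8 + 2 * r) * y = (8 + 2 * r) * (s * (s * y))); last by ring.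
  rewrite ler_pM2l//; apply: le_trans hxi; rewrite ler_piMl ?mulr_ge0 ?(le_trans _ y1)//.
  by move: s12; lra.
have := mean_nlog_le a2 ga g1 r0 xi0 xi1 q1 rho1 rhoq smu.
rewrite -/q -/rho -/s -/y => hm.
have h8 : 8 * s * (1 + (a - 1) * ((8 + 2 * r) * y) / (1 - q)) <= 8 * D * eta.
  have h : 1 + (a - 1) * ((8 + 2 * r) * y) / (1 - q) <= D * y.
    rewrite [leRHS](_ : _ = y + (a - 1) * ((8 + 2 * r) * y) / (1 - q)) ?lerD2r//.
    by rewrite /D; field; rewrite subr_eq0 eq_sym lt_eqF.
  apply: (@le_trans _ _ (8 * s * (D * y))); first by rewrite ler_wpM2l// mulr_ge0.
  rewrite (_ : 8 * s * (D * y) = 8 * D * (s * y)); last by ring.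
  by rewrite ler_wpM2l// mulr_ge0// ltW.
have := le_trans hm (lerD (lexx _) (le_trans h8 e3)).
rewrite (_ : _ + _ = (ln (2 * a) + ln q / 2) / (a - 1)); last first.
  by field; rewrite lt0r_neq0.
rewrite ler_pdivlMr// mulrC; move: (mean_nlog mu) Nq => l Nq; lra.
Qed.

End small_noise.

(** * The zero of Lambda and the conclusion *)

Section Lambda_root.
Context {R : realType}.
Implicit Types (s t x y c : R) (h : R -> R).

Lemma is_derive_horner_step h t c l : is_derive t 1 h l ->
  is_derive t 1 (fun s => 1 + c * (s * h s)) (c * (h t + t * l)).
Proof.
move=> dh; have d1 := is_deriveZ c (is_deriveM (is_derive_id t 1) dh).
apply: (is_derive_eq (is_deriveD (is_derive_cst (1 : R) t 1) d1)).
by rewrite /GRing.scale/=; ring.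
Qed.

(* Taylor polynomial of exp whose last coefficient is multiplied by c. *)
Definition exp_taylor c s : R :=
  1 + 1 * (s * (1 + 2^-1 * (s * (1 + 3^-1 * (s * (1 + 4^-1 * (s * (1 + 5^-1 * (s * c))))))))).

(** All lower terms cancel. The product decreases for [c = 1], and for [c = 21/20] it increases up
    to [t = 5/21]; comparison with its value 1 at 0 bounds [expR] from below and from above. *)
Lemma is_derive_exp_taylor c t : is_derive t 1 (fun s => expR (- s) * exp_taylor c s)
  (expR (- t) * (t ^+ 4 / 24 * (c - 1 - c * t / 5))).
Proof.
have d5 := is_derive_horner_step 1 (is_derive_horner_step 2^-1 (is_derive_horner_step 3^-1
  (is_derive_horner_step 4^-1 (is_derive_horner_step 5^-1 (is_derive_cst c t 1))))).
have dE := @is_derive1_comp _ expR -%R t _ _ (is_derive_expR (- t)) (is_deriveN (is_derive_id t 1)).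
apply: (is_derive_eq (is_deriveM dE d5)).
by rewrite /GRing.scale/= !(mulr0, addr0); field.
Qed.

Lemma expR_ge_taylor t : 0 <= t -> exp_taylor 1 t <= expR t.
Proof.
move=> t0; have : - (expR (- 0) * exp_taylor 1 0) <= - (expR (- t) * exp_taylor 1 t).
  apply: (@is_derive_ge0_le _ (fun s => - (expR (- s) * exp_taylor 1 s))
    (fun s => - (expR (- s) * (s ^+ 4 / 24 * (1 - 1 - 1 * s / 5))))) => // s /andP[s0 _].
    exact: (is_deriveN (is_derive_exp_taylor 1 s)).
  rewrite oppr_ge0 mulr_ge0_le0 ?expR_ge0// mulr_ge0_le0//; last lra.
  by rewrite mulr_ge0// exprn_ge0.
rewrite oppr0 expR0 mul1r lerN2 {2}/exp_taylor !(mulr0, mul0r) addr0.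
by rewrite expRN mulrC ler_pdivrMr ?expR_gt0// mul1r.
Qed.

Lemma expR_le_taylor t : 0 <= t <= 21 / 100 -> expR t <= exp_taylor (21 / 20) t.
Proof.
move=> /andP[t0 t1]; have : expR (- 0) * exp_taylor (21 / 20) 0 <= expR (- t) * exp_taylor (21 / 20) t.
  apply: (@is_derive_ge0_le _ (fun s => expR (- s) * exp_taylor (21 / 20) s)
    (fun s => expR (- s) * (s ^+ 4 / 24 * (21 / 20 - 1 - 21 / 20 * s / 5)))) => // s /andP[s0 st].
    exact: is_derive_exp_taylor.
  rewrite mulr_ge0 ?expR_ge0// mulr_ge0//; last lra.
  by rewrite mulr_ge0// exprn_ge0.
rewrite oppr0 expR0 mul1r {1}/exp_taylor !(mulr0, mul0r) addr0.
by rewrite expRN mulrC ler_pdivlMr ?expR_gt0// mul1r.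
Qed.

(** From [ln (1 + u) <= u], the logarithm gains at most [(y - x) / x <= (y - x) / 2], half of what
    the linear term loses. *)
Lemma Lambda_decreasing x y : 2 <= x -> x < y -> Lambda y < Lambda x.
Proof.
move=> x2 xy; have x0 : 0 < x by exact: lt_le_trans x2.
have y0 : 0 < y by exact: lt_trans xy.
have : ln (y / x) <= (y - x) / x.
  rewrite (_ : y / x = 1 + (y - x) / x); last by field; rewrite lt0r_neq0.
  apply: le_ln1Dx; apply: (@lt_le_trans _ _ 0); first by rewrite ltrN10.
  by rewrite divr_ge0 ?subr_ge0 ?(ltW xy) ?(ltW x0).
rewrite ln_div ?posrE// => h.
have : (y - x) / x <= (y - x) / 2.
  by rewrite ler_pM2l ?subr_gt0// lef_pV2 ?posrE.
by rewrite /Lambda; lra.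
Qed.

Lemma Lambda_continuous x : 0 < x -> {for x, continuous (@Lambda R)}.
Proof.
move=> x0; apply: cvgB; last exact: cvg_id.
apply: cvgD; last exact: cvg_cst.
by apply: cvgD; [exact: cvg_cst|exact: continuous_ln].
Qed.

Lemma Lambda_ge0 : 0 <= Lambda (2 + 678 / 10 ^+ 3 + 34 / 10 ^+ 5 : R).
Proof.
set x := _ + _; have xE : x = 2 + 678 / 10 ^+ 3 + 34 / 10 ^+ 5 by [].
(* Dividing by 8 brings the argument below 0.21, where degree 5 is precise enough; [b] is a decimal
   between the Taylor bound of [expR t] and the eighth root of [2 x]. *)
pose t := (x - 1) / 8.
pose b : R := 1 + 233 / 10 ^+ 3 + 422 / 10 ^+ 6 + 6 / 10 ^+ 7.
have x0 : 0 < x by rewrite xE; lra.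
have bt : exp_taylor (21 / 20) t <= b by rewrite /b /exp_taylor /t xE; lra.
have t01 : 0 <= t <= 21 / 100 by rewrite /t xE; lra.
have eb : expR (x - 1) <= b ^+ 8.
  rewrite (_ : x - 1 = t * 8%:R); last by rewrite /t divfK.
  rewrite expRM_natr lerXn2r ?nnegrE ?expR_ge0//; first by rewrite /b; lra.
  exact: le_trans (expR_le_taylor t01) bt.
have bx : b ^+ 8 <= 2 * x by rewrite /b xE; lra.
have : x - 1 <= ln (2 * x).
  by rewrite -[leLHS]expRK ler_ln ?posrE ?expR_gt0 ?mulr_gt0// (le_trans eb).
by rewrite lnM ?posrE// /Lambda; lra.
Qed.

Lemma Lambda_le0 : Lambda (2 + 678 / 10 ^+ 3 + 35 / 10 ^+ 5 : R) <= 0.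
Proof.
set x := _ + _; have xE : x = 2 + 678 / 10 ^+ 3 + 35 / 10 ^+ 5 by [].
pose t := (x - 1) / 8.
pose b : R := 1 + 233 / 10 ^+ 3 + 423 / 10 ^+ 6 + 45 / 10 ^+ 8.
have x0 : 0 < x by rewrite xE; lra.
have bt : b <= exp_taylor 1 t by rewrite /b /exp_taylor /t xE; lra.
have t0 : 0 <= t by rewrite /t xE; lra.
have b0 : 0 <= b by rewrite /b; lra.
have eb : b ^+ 8 <= expR (x - 1).
  rewrite (_ : x - 1 = t * 8%:R); last by rewrite /t divfK.
  by rewrite expRM_natr lerXn2r ?nnegrE ?expR_ge0// (le_trans bt)// expR_ge_taylor.
have bx : 2 * x <= b ^+ 8 by rewrite /b xE; lra.
have : ln (2 * x) <= x - 1.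
  by rewrite -[leRHS]expRK ler_ln ?posrE ?expR_gt0 ?mulr_gt0// (le_trans bx).
by rewrite lnM ?posrE// /Lambda; lra.
Qed.

Lemma Lambda_root : exists r : R, Lambda r = 0 /\
  2 + 678 / 10 ^+ 3 + 34 / 10 ^+ 5 <= r <= 2 + 678 / 10 ^+ 3 + 35 / 10 ^+ 5.
Proof.
have := Lambda_ge0; have := Lambda_le0.
set x := _ + 34 / _; set y := _ + 35 / _ => yle xge.
have xy : x <= y by rewrite /x /y; lra.
have [||r] := @IVT R (@Lambda R) x y 0 xy.
- apply: continuous_in_subspaceT => z; rewrite inE/= in_itv/= => /andP[xz _].
  by apply: Lambda_continuous; apply: lt_le_trans xz; rewrite /x; lra.
- by rewrite ge_min le_max yle xge orbT.
by rewrite in_itv/= => xry L0; exists r.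
Qed.

End Lambda_root.

(** [xi1] is fixed at [b = 1], where the exponent is [L > 0]. Moving [b] costs at most [L / 4]
    through the mean of [nlog] and [L / 4] through [ln b], so the sign at [xi1] persists. *)
Lemma noise_induced_order_unimodal (R : realType) (pi : R -> R) (a : R) :
  boundary_condition pi -> 2 < a -> Lambda a < 0 ->
  exists eps : R, 0 < eps /\ forall b : R, 0 < b <= 1 -> 1 - eps < b <= 1 ->
    noise_induced_order pi (unimodal_map a b).
Proof.
move=> hpi a2 La; have a0 : 0 < a by exact: lt_trans a2.
have a1 : 0 < a - 1 by lra.
have [xi1 [xi10 xi1h posl]] := positive_lyapunov_small_noise hpi a2.
have xi101 : 0 < xi1 <= 1 by rewrite xi10; lra.
have [N HN] := unimodal_contracting hpi a2 xi101.
have b1 : 0 < (1 : R) <= 1 by rewrite ltr01 lexx.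
have hT1 : selfmap (unimodal_map a 1) by exact: unimodal_selfmap.
have [c1 c101 ctr1] : exists2 c, 0 < c < 1 &
    contracting (@noise R) (noisy_map pi (unimodal_map a 1) xi1) N c.
  by apply: HN => //; rewrite subrr mulr0 divr_ge0// ltW.
have [mu1 smu1] := noisy_stationary_exists hpi hT1 xi10 c101 ctr1.
pose L := ln (2 * a) - (a - 1) * mean_nlog mu1.
have L0 : 0 < L by exact: posl smu1.
have e0 : 0 < L / (4 * (a - 1)) by rewrite divr_gt0// mulr_gt0.
have [d d0 Hd] := mean_nlog_continuity hpi hT1 xi10 (lexx xi1) c101 ctr1 smu1 e0.
(* In turn: [2 (1 - b) <= xi1 / 8] for the uniform contraction, [2 (1 - b) <= d] for the continuity
   of the mean, and [ln b > - L / 4]. *)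
pose eps := Num.min (xi1 / 16) (Num.min (d / 2) (1 - expR (- (L / 4)))).
have eps0 : 0 < eps.
  rewrite !lt_min !divr_gt0//= subr_gt0 expR_lt1 oppr_lt0 divr_gt0//.
exists eps; split => // b b01 /andP[beps _]; have /andP[bgt0 ble1] := b01.
have [E1 [E2 E3]] : 1 - b < xi1 / 16 /\ 1 - b < d / 2 /\ expR (- (L / 4)) < b.
  have : 1 - b < eps by lra.
  rewrite /eps !lt_min => /and3P[h1 h2 h3]; split=> //; split => //; lra.
have hT : selfmap (unimodal_map a b) by exact: unimodal_selfmap.
have ctr (xi : R) : xi1 <= xi -> exists2 c, 0 < c < 1 &
    contracting (@noise R) (noisy_map pi (unimodal_map a b) xi) N c.
  by apply: HN => //; lra.
have pos (xi : R) : xi1 <= xi -> 0 < xi by exact: lt_le_trans.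
pose stat (xi : R) (mu : probability (measurableTypeR R) R) :=
  stationary (@noise R) (noisy_map pi (unimodal_map a b) xi) mu.
(* Below [xi1] the family is filled with the arbitrary value [mu1]. *)
have /choice[mu Hmu] : forall xi : R, exists mu, xi1 <= xi -> stat xi mu.
  move=> xi; have [h|h] := leP xi1 xi; last by exists mu1; discriminate.
  have [c c01 cc] := ctr _ h.
  by have [nu snu] := noisy_stationary_exists hpi hT (pos _ h) c01 cc; exists nu.
have /choice[f Hf] : forall xi : R, exists f, xi1 <= xi -> has_density f (mu xi).
  move=> xi; have [h|h] := leP xi1 xi; last by exists (fun=> 0); discriminate.
  by have [f hf] := stationary_has_density hpi hT (pos _ h) (Hmu _ h); exists f.
pose lambda (xi : R) :=  ln (2 * b * a) - (a - 1) * mean_nlog (mu xi).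
have lnE : ln (2 * b * a) = ln (2 * a) + ln b.
  have a20 : 0 < 2 * a by exact: mulr_gt0.
  by rewrite (mulrAC 2 b a) (lnM a20 bgt0).
exists xi1, 2; split; first by rewrite xi10; lra.
exists mu, f, lambda; split.
- move=> xi h; have xi0 := pos _ h; have smu := Hmu _ h.
  have a11 : 1 < a by lra.
  split; [split|exact: Hf|exact: (lyapunov_exponentE hpi a11 b01 xi0 smu)].
    exact/(stationary_measureP hpi hT.1 hT.2 _ xi0).
  move=> nu /(stationary_measureP hpi hT.1 hT.2 _ xi0) snu A mA.
  have [c c01 cc] := ctr _ h.
  exact: (contracting_stationary_unique (measurable_noisy_map hpi hT.1 xi) c01 cc snu smu).
- apply/subspace_continuousP => xi /=; rewrite in_itv/= andbT => h.
  apply/cvgrPdist_le => e e_gt0; have [c c01 cc] := ctr _ h.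
  have e1 : 0 < e / (a - 1) by exact: divr_gt0.
  have [d' d'0 Hd'] := mean_nlog_continuity hpi hT xi10 h c01 cc (Hmu _ h) e1.
  rewrite near_withinE; near=> xi' => /=.
  have hd : `|xi - xi'| <= d' by near: xi'; apply: (@cvgr_dist_le _ _ _ (nbhs xi)) => //; exact: cvg_id.
  rewrite in_itv/= andbT => h'.
  rewrite (_ : lambda xi - lambda xi' = (a - 1) * (mean_nlog (mu xi') - mean_nlog (mu xi))); last first.
    by rewrite /lambda; ring.
  rewrite normrM gtr0_norm// distrC mulrC -ler_pdivlMr//.
  apply: Hd' (Hmu _ h') => //.
  by move=> x _; rewrite subrr normr0 ltW.
- have h := lexx xi1.
  have hd : forall x, `|x| <= 1 -> `|unimodal_map a 1 x - unimodal_map a b x| <= d.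
    by move=> x x1; rewrite distrC; apply: le_trans (unimodal_beta_dist a0 ble1 x1) _; lra.
  have := Hd _ xi1 (mu xi1) hT h hd; rewrite subrr normr0 => /(_ (ltW d0) (Hmu _ h)).
  rewrite ler_pdivlMr ?mulr_gt0// => hl.
  have lb : - (L / 4) < ln b by rewrite -ltr_expR lnK.
  have hl' : 4 * ((a - 1) * (mean_nlog (mu xi1) - mean_nlog mu1)) <= L.
    apply: le_trans hl; rewrite distrC.
    rewrite (_ : 4 * _ = (mean_nlog (mu xi1) - mean_nlog mu1) * (4 * (a - 1))); last by ring.
    by rewrite ler_pM2r ?mulr_gt0// ler_norm.
  rewrite /lambda lnE; move: lb hl' L0; rewrite /L; lra.
- have h2 : xi1 <= 2 by lra.
  rewrite /lambda (mean_nlog_full_noise hpi hT (Hmu _ h2)) mulr1 lnE.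
  have lb : ln b <= 0 by rewrite ln_le0.
  by move: La; rewrite /Lambda lnM ?posrE//; lra.
Unshelve. all: by end_near.
Qed.

Theorem theorem1p1p7 (R : realType) (pi : R -> R)
    (hpi : boundary_condition pi) :
  exists alphat : R,
    [/\ 2 <= alphat,
        Lambda alphat = 0,
        (forall a : R, 2 <= a -> Lambda a = 0 -> a = alphat),
        2 + 678 / 10 ^+ 3 + 34 / 10 ^+ 5 <= alphat
          <= 2 + 678 / 10 ^+ 3 + 35 / 10 ^+ 5 &
        (forall alpha : R, alphat < alpha ->
          exists eps : R, 0 < eps /\
            forall beta : R, 0 < beta <= 1 -> 1 - eps < beta <= 1 ->
              noise_induced_order pi (unimodal_map alpha beta))].
Proof.
have [r [r_root /andP[r1 r2]]] := @Lambda_root R.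
have r_ge2 : 2 <= r by lra.
exists r; split => //; first last.
- move=> alpha ra; apply: noise_induced_order_unimodal => //; first exact: le_lt_trans ra.
  by rewrite -r_root Lambda_decreasing.
- by rewrite r1.
- move=> a a2 La; have [ar|ra|//] := ltgtP a r.
  + by have := Lambda_decreasing a2 ar; rewrite La r_root ltxx.
  + by have := Lambda_decreasing r_ge2 ra; rewrite La r_root ltxx.
Qed.
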